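(* Let $\mu\ge 0$. Let $\partial_x$ denote a partial derivative on $\mathbb{R}^2$, either $\partial_{x_1}$ or $\partial_{x_2}$. Then, for any $\delta>0$ and $\epsilon>0$, there is a constant $C_{\mu,\epsilon,\delta}$ depending only on $\mu$, $\epsilon$ and $\delta$ such that, for all functions $f\neq 0$ and $g$ on $\mathbb{R}^2$ for which the norms on the right-hand side are finite, $$ \left\|\left[(\ln(I-\Delta))^\mu\partial_x, g\right] f \right\|_{L^2} \le C_{\mu,\epsilon,\delta} \left(1+ \left(\ln\left(1+ \frac{\|f\|_{\dot{H}^\delta}}{\|f\|_{L^2}}\right)\right)^{\mu}\right)\, \|f\|_{L^2}\, \|g\|_{H^{2+3\epsilon}}. $$
   Context: The operator $(\ln(I-\Delta))^\mu$ is the Fourier multiplier $\widehat{(\ln(I-\Delta))^\mu f}(\xi)=\left(\ln(1+|\xi|^2)\right)^\mu\widehat f(\xi)$. The brackets denote the commutator $$\left[(\ln(I-\Delta))^\mu\partial_x, g\right] f = (\ln(I-\Delta))^\mu\partial_x(f g) - \left((\ln(I-\Delta))^\mu\partial_x f\right) g.$$ $\dot H^\delta$ is the standard homogeneous Sobolev space with $\|f\|_{\dot H^\delta}=\|(-\Delta)^{\delta/2}f\|_{L^2}$, and $H^s$ is the standard inhomogeneous Sobolev space; all norms are over $\mathbb{R}^2$. *)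

(* Defs.v *)
From HB Require Import structures.
From mathcomp Require Import all_boot all_order all_algebra.
From mathcomp Require Import all_classical all_reals all_analysis.
From mathcomp Require Import complex.

Set Implicit Arguments.
Unset Strict Implicit.
Unset Printing Implicit Defensive.

Import Order.TTheory GRing.Theory Num.Theory.
Import numFieldNormedType.Exports.

Local Open Scope classical_set_scope.
Local Open Scope complex_scope.
Local Open Scope ring_scope.

Section defs.
Context {R : realType}.

(* Functions are pointwise representatives, functions on the plane being
   [R * R -> R[i]]; the plane carries the product of the Borel sigma-algebras. *)

Definition leb2 : {measure set (measurableTypeR R * measurableTypeR R) -> \bar R} :=
  (@lebesgue_measure R \x @lebesgue_measure R)%E.

Definition dot (x y : R * R) : R := x.1 * y.1 + x.2 * y.2.

Definition cis (t : R) : R[i] := cos t +i* sin t.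

Definition cintegral (D : set (R * R)) (f : R * R -> R[i]) : R[i] :=
  (\int[leb2]_(x in D) complex.Re (f x)) +i*
  (\int[leb2]_(x in D) complex.Im (f x)).

Definition cmeasurable (f : R * R -> R[i]) : Prop :=
  measurable_fun [set: measurableTypeR R * measurableTypeR R]
    (fun x => complex.Re (f x)) /\
  measurable_fun [set: measurableTypeR R * measurableTypeR R]
    (fun x => complex.Im (f x)).

Definition L2norm (f : R * R -> R[i]) : \bar R :=
  Lnorm leb2 2%:E (fun x => (Normc.normc (f x))%:E).

Definition is_L2 (f : R * R -> R[i]) : Prop :=
  cmeasurable f /\ (L2norm f < +oo)%E.

(* Fourier transform on L2, with the unitary normalization
     (2 pi)^-1 \int f(x) e^{- i x . xi} dx,
   taken as the L2 limit of the integrals over the squares [-n, n]^2. *)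

Definition fourier_trunc (f : R * R -> R[i]) (n : nat) (xi : R * R) : R[i] :=
  ((2 * pi)^-1)%:C *
  cintegral (`[- n%:R, n%:R] `*` `[- n%:R, n%:R])
    (fun x => f x * cis (- dot x xi)).

Definition is_fourier (f F : R * R -> R[i]) : Prop :=
  is_L2 F /\
  L2norm (fun xi => F xi - fourier_trunc f n xi) @[n --> \oo] --> 0%E.

(* For f in L2 such an F exists, and is unique almost everywhere, by
   Plancherel's theorem. *)
Definition fourier (f : R * R -> R[i]) : R * R -> R[i] :=
  xget (fun=> 0) [set F | is_fourier f F].

(* L2 Fourier multipliers: f is in the domain of T_m if m \hat f is in L2, and
   then T_m f is the L2 function with Fourier transform m \hat f. *)

Definition fmult_dom (m f : R * R -> R[i]) : Prop :=
  is_L2 f /\ is_L2 (fun xi => m xi * fourier f xi).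

Definition fmult (m f : R * R -> R[i]) : R * R -> R[i] :=
  xget (fun=> 0) [set u | is_L2 u /\
    {ae leb2, forall xi, fourier u xi = m xi * fourier f xi}].

Definition riesz_symbol (s : R) (xi : R * R) : R[i] :=
  (dot xi xi `^ (s / 2))%:C.

Definition bessel_symbol (s : R) (xi : R * R) : R[i] :=
  ((1 + dot xi xi) `^ (s / 2))%:C.

(* Only used for s >= 0 and, in the homogeneous case, only on L2 functions. *)
Definition in_dotH (s : R) (f : R * R -> R[i]) : Prop :=
  fmult_dom (riesz_symbol s) f.

Definition dotH_norm (s : R) (f : R * R -> R[i]) : \bar R :=
  L2norm (fmult (riesz_symbol s) f).

Definition in_H (s : R) (f : R * R -> R[i]) : Prop :=
  fmult_dom (bessel_symbol s) f.

Definition H_norm (s : R) (f : R * R -> R[i]) : \bar R :=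
  L2norm (fmult (bessel_symbol s) f).

Definition coord (j : 'I_2) (x : R * R) : R := if j == ord0 then x.1 else x.2.

(* Symbol of (ln (I - Delta))^mu d/dx_j. *)
Definition lnpow_deriv_symbol (mu : R) (j : 'I_2) (xi : R * R) : R[i] :=
  (ln (1 + dot xi xi) `^ mu)%:C * (0 +i* coord j xi).

(* For u in L2 and m of polynomial growth, T_m u is in general only a
   distribution, in some H^{-s}.  Distributions are tested with the bilinear
   pairing extending \int u phi; by Parseval, for the unitary transform,
     \int u phi = \int \hat u(xi) \hat phi(- xi) dxi,
   whence the action of T_m u on a test function. *)
Definition fmult_distr (m u phi : R * R -> R[i]) : R[i] :=
  cintegral setT (fun xi => m xi * fourier u xi * fourier phi (- xi)).

(* [T_m, g] f = T_m (f g) - (T_m f) g as a distribution, where the product of a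
   distribution with g is given by < T g, phi > = < T, g phi >.  All terms make
   sense for f in L2 and g in H^s with s > 2: then f g is in L2, g phi is in H^s
   for phi in H^oo, and T_m f is in H^{-s} for the symbols m above. *)
Definition commutator_distr (m g f phi : R * R -> R[i]) : R[i] :=
  fmult_distr m (fun x => f x * g x) phi -
  fmult_distr m f (fun x => g x * phi x).

(* Test functions are those of H^oo, the intersection of all the H^s; this
   contains the Schwartz space, so that identities tested on it imply equality
   of tempered distributions. *)
Definition test_function (phi : R * R -> R[i]) : Prop :=
  forall k : nat, in_H k%:R phi.

(* The distribution T is (represented by) the L2 function h. *)
Definition distr_is_L2 (T : (R * R -> R[i]) -> R[i]) (h : R * R -> R[i]) : Prop :=
  is_L2 h /\
  forall phi, test_function phi -> cintegral setT (fun x => h x * phi x) = T phi.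

End defs.

(* Main.v *)
(* On the Fourier side the commutator is the integral operator with kernel
     (2 pi)^-1 (m(xi) - m(eta)) \hat g(xi - eta) \hat f(eta),
   where m(xi) = ln(1 + |xi|^2)^mu i xi_j.  Writing <xi>^2 = 1 + |xi|^2, the
   symbol satisfies
     |m(xi) - m(eta)| <= C <xi - eta>^(1 + eps) (1 + ln(1 + |eta|^2)^mu),
   so Young's inequality (L^1 * L^2 into L^2) bounds the commutator by the product
   of the L^1 norm of <.>^(1 + eps) \hat g, controlled by |g|_{H^(2 + 3 eps)}
   through Cauchy-Schwarz, and of the L^2 norm of (1 + ln(1 + |.|^2)^mu) \hat f.
   The latter is controlled by
     ln(1 + |eta|^2)^mu <= C (1 + (ln a)^mu) (1 + |eta|^delta / a),
   applied with a = 1 + |f|_{\dot H^delta} / |f|_{L^2}.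

   The L^2 theory of the Fourier transform rests on Abel summation: the transform
   of exp(- e (|x_1| + |x_2|)) is a product of Poisson kernels, which yields the
   contraction property and the inversion formula for indicators of rectangles.
   The multiplication formula, the integral of \hat f g being that of f \hat g,
   extends inversion to all of L^2. *)
From HB Require Import structures.
From mathcomp Require Import all_boot all_order all_algebra.
From mathcomp Require Import all_classical all_reals all_analysis.
From mathcomp Require Import measurable_realfun complex zify ring lra.
Require Import Defs.
Set Implicit Arguments.
Unset Strict Implicit.
Unset Printing Implicit Defensive.
Import Order.TTheory GRing.Theory Num.Theory.
Import numFieldNormedType.Exports.
Local Open Scope classical_set_scope.
Local Open Scope complex_scope.
Local Open Scope ring_scope.

(** * Complex-valued integrals *)

(** The exponent [2 + 3 * eps] is the sum of [1 + eps], spent on the symbol, and [1 + 2 * eps],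
    spent on Cauchy-Schwarz: the square of <xi>^-(1 + 2 eps) decays faster than the dimension 2
    requires. The obstacle is that T_m f alone is only a distribution: for small [delta] the
    function m \hat f need not be in L2. The kernel formula is therefore derived inside the pairing
    with a test function. The double integral carrying m(xi) converges absolutely because the test
    function absorbs m, the one carrying m(xi) - m(eta) because of the kernel bound, and the one
    carrying m(eta) as the difference of these two. In the symbol estimate the logarithmic weight
    sits on eta alone, so that moving it there costs g only a small power of <xi - eta>. Poisson
    kernels suit the L2 theory because everything reduces to explicit primitives on the line:
    exponentials times cosines for the transform of the weight, arctangents for indicators of
    intervals. The contraction property precedes Plancherel's identity, which is a consequence of
    inversion. *)

Notation normc := Normc.normc.
Notation Rec := complex.Re.
Notation Imc := complex.Im.

Section complex_norm.
Context {R : realType}.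
Implicit Types (z w : R[i]) (a : R).

Lemma normc_sqr z : normc z ^+ 2 = Rec z ^+ 2 + Imc z ^+ 2.
Proof. by case: z => a b /=; rewrite sqr_sqrtr// addr_ge0// sqr_ge0. Qed.

Lemma normc_ge0 z : 0 <= normc z.
Proof. by case: z => a b /=; rewrite sqrtr_ge0. Qed.

Lemma le_Rec_normc z : `|Rec z| <= normc z.
Proof.
by rewrite -(ler_pXn2r (n := 2)) ?nnegrE ?normc_ge0// normc_sqr real_normK
  ?num_real// lerDl sqr_ge0.
Qed.

Lemma le_Imc_normc z : `|Imc z| <= normc z.
Proof.
by rewrite -(ler_pXn2r (n := 2)) ?nnegrE ?normc_ge0// normc_sqr real_normK
  ?num_real// lerDr sqr_ge0.
Qed.

Lemma normc_le_ReIm z : normc z <= `|Rec z| + `|Imc z|.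
Proof.
rewrite -(ler_pXn2r (n := 2)) ?nnegrE ?normc_ge0 ?addr_ge0// normc_sqr.
rewrite sqrrD !real_normK ?num_real// addrAC lerDl.
by rewrite mulrn_wge0// mulr_ge0.
Qed.

Lemma normcR a : normc a%:C = `|a|.
Proof. by rewrite /= expr0n addr0 sqrtr_sqr. Qed.

Lemma normcJ z : normc z^* = normc z.
Proof. by case: z => a b /=; rewrite sqrrN. Qed.

Lemma RecM z w : Rec (z * w) = Rec z * Rec w - Imc z * Imc w.
Proof. by case: z; case: w. Qed.

Lemma ImcM z w : Imc (z * w) = Rec z * Imc w + Imc z * Rec w.
Proof. by case: z => a b; case: w. Qed.

Lemma RecD z w : Rec (z + w) = Rec z + Rec w.
Proof. by case: z; case: w. Qed.

Lemma ImcD z w : Imc (z + w) = Imc z + Imc w.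
Proof. by case: z; case: w. Qed.

Lemma RecN z : Rec (- z) = - Rec z. Proof. by case: z. Qed.
Lemma ImcN z : Imc (- z) = - Imc z. Proof. by case: z. Qed.
Lemma RecJ z : Rec z^* = Rec z. Proof. by case: z. Qed.
Lemma ImcJ z : Imc z^* = - Imc z. Proof. by case: z. Qed.

Lemma complex_eq z w : Rec z = Rec w -> Imc z = Imc w -> z = w.
Proof. by case: z => a b; case: w => c d /= -> ->. Qed.

Lemma mulcJ z : z * z^* = (normc z ^+ 2)%:C.
Proof.
by rewrite normc_sqr; apply: complex_eq; case: z => a b /=; ring.
Qed.

Lemma normc_eq0 z : (normc z == 0) = (z == 0).
Proof.
apply/eqP/eqP => [|->]; first exact: Normc.eq0_normc.
by rewrite /= expr0n addr0 sqrtr0.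
Qed.

Lemma normc_opp z : normc (- z) = normc z.
Proof. by case: z => a b /=; rewrite !sqrrN. Qed.

Lemma ler_normcD z w : normc (z + w) <= normc z + normc w.
Proof. exact: le_normcD. Qed.

Lemma ler_normcB z w : normc (z - w) <= normc z + normc w.
Proof. by rewrite (le_trans (ler_normcD _ _))// normc_opp. Qed.

Lemma normc_distC z w : normc (z - w) = normc (w - z).
Proof. by rewrite -normc_opp opprB. Qed.

End complex_norm.

(** Stated over any measurable space because lines, the plane and its square all occur; on the plane
    it is convertible with [cmeasurable]. *)
Definition cmfun {R : realType} d (T : measurableType d) (f : T -> R[i]) :=
  measurable_fun setT (fun x => Rec (f x)) /\
  measurable_fun setT (fun x => Imc (f x)).

Definition cint {R : realType} d (T : measurableType d)
    (mu : {measure set T -> \bar R}) (f : T -> R[i]) : R[i] :=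
  (\int[mu]_x Rec (f x)) +i* (\int[mu]_x Imc (f x)).

Definition cL1 {R : realType} d (T : measurableType d)
    (mu : {measure set T -> \bar R}) (f : T -> R[i]) : Prop :=
  cmfun f /\ (\int[mu]_x (normc (f x))%:E < +oo)%E.

Section cmfun.
Context {R : realType} d (T : measurableType d).
Implicit Types (f g : T -> R[i]).

Lemma cmfun_normc f : cmfun f -> measurable_fun setT (fun x => normc (f x)).
Proof.
case=> mr mi; have -> : (fun x => normc (f x)) =
    (fun x => Num.sqrt (Rec (f x) ^+ 2 + Imc (f x) ^+ 2)).
  by apply/funext => x; case: (f x).
apply: (@measurableT_comp _ _ _ _ _ _ (@Num.sqrt R)).
  by apply: continuous_measurable_fun; exact: sqrt_continuous.
by apply: measurable_funD; exact: measurable_funX.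
Qed.

Lemma cmfun_enormc f : cmfun f -> measurable_fun setT (fun x => (normc (f x))%:E).
Proof. by move=> mf; apply/measurable_EFinP; exact: cmfun_normc. Qed.

Lemma cmfun_cst (c : R[i]) : cmfun (fun _ : T => c).
Proof. by split; exact: measurable_cst. Qed.

Lemma cmfunD f g : cmfun f -> cmfun g -> cmfun (fun x => f x + g x).
Proof.
move=> [fr fi] [gr gi]; split.
  by under eq_fun do rewrite RecD; exact: measurable_funD.
by under eq_fun do rewrite ImcD; exact: measurable_funD.
Qed.

Lemma cmfunN f : cmfun f -> cmfun (fun x => - f x).
Proof.
move=> [fr fi]; split.
  by under eq_fun do rewrite RecN; exact: measurable_funN.
by under eq_fun do rewrite ImcN; exact: measurable_funN.
Qed.

Lemma cmfunB f g : cmfun f -> cmfun g -> cmfun (fun x => f x - g x).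
Proof. by move=> mf mg; apply: cmfunD => //; exact: cmfunN. Qed.

Lemma cmfunM f g : cmfun f -> cmfun g -> cmfun (fun x => f x * g x).
Proof.
move=> [fr fi] [gr gi]; split.
  under eq_fun do rewrite RecM.
  by apply: measurable_funB; exact: measurable_funM.
under eq_fun do rewrite ImcM.
by apply: measurable_funD; exact: measurable_funM.
Qed.

Lemma cmfunJ f : cmfun f -> cmfun (fun x => (f x)^*).
Proof.
move=> [fr fi]; split.
  by under eq_fun do rewrite RecJ.
by under eq_fun do rewrite ImcJ; exact: measurable_funN.
Qed.

Lemma cmfunR (h : T -> R) : measurable_fun setT h -> cmfun (fun x => (h x)%:C).
Proof. by move=> mh; split => //=; exact: measurable_cst. Qed.

Lemma cmfun_cis (h : T -> R) : measurable_fun setT h -> cmfun (fun x => cis (h x)).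
Proof.
move=> mh; split => /=.
  apply: (@measurableT_comp _ _ _ _ _ _ (@cos R)) => //.
  by apply: continuous_measurable_fun; exact: continuous_cos.
apply: (@measurableT_comp _ _ _ _ _ _ (@sin R)) => //.
by apply: continuous_measurable_fun; exact: continuous_sin.
Qed.

Lemma cmfun_comp d' (T' : measurableType d') (phi : T' -> T) f :
  measurable_fun setT phi -> cmfun f -> cmfun (fun x => f (phi x)).
Proof.
move=> mphi [fr fi]; split.
  exact: (measurableT_comp fr).
exact: (measurableT_comp fi).
Qed.

End cmfun.

Lemma normc_cis {R : realType} (t : R) : normc (cis t) = 1.
Proof. by rewrite /= cos2Dsin2 sqrtr1. Qed.

Lemma cisD {R : realType} (s t : R) : cis (s + t) = cis s * cis t.
Proof. by apply: complex_eq; rewrite /= ?cosD ?sinD; ring. Qed.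

Lemma cisN {R : realType} (t : R) : cis (- t) = (cis t)^*.
Proof. by rewrite /cis cosN sinN. Qed.

Section cint_theory.
Context {R : realType} d (T : measurableType d) (mu : {measure set T -> \bar R}).
Implicit Types (f g : T -> R[i]).
Local Open Scope ereal_scope.

Lemma eq_cint f g : f =1 g -> cint mu f = cint mu g.
Proof. by move=> fg; congr cint; apply/funext. Qed.

Lemma cL1_le f (h : T -> \bar R) : cmfun f -> (forall x, (normc (f x))%:E <= h x) ->
  measurable_fun setT h -> \int[mu]_x h x < +oo -> cL1 mu f.
Proof.
move=> mf fh mh hoo; split => //; apply: le_lt_trans hoo.
apply: ge0_le_integral => //.
- by move=> x _; rewrite lee_fin normc_ge0.
- exact: cmfun_enormc.
Qed.

Lemma cL1_Re f : cL1 mu f -> mu.-integrable setT (fun x => (Rec (f x))%:E).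
Proof.
move=> [mf foo]; apply/integrableP; split; first by apply/measurable_EFinP; case: mf.
apply: le_lt_trans foo; apply: ge0_le_integral => //.
- by apply/measurable_EFinP/measurableT_comp => //; case: mf.
- exact: cmfun_enormc.
- by move=> x _; rewrite lee_fin le_Rec_normc.
Qed.

Lemma cL1_Im f : cL1 mu f -> mu.-integrable setT (fun x => (Imc (f x))%:E).
Proof.
move=> [mf foo]; apply/integrableP; split; first by apply/measurable_EFinP; case: mf.
apply: le_lt_trans foo; apply: ge0_le_integral => //.
- by apply/measurable_EFinP/measurableT_comp => //; case: mf.
- exact: cmfun_enormc.
- by move=> x _; rewrite lee_fin le_Imc_normc.
Qed.

Lemma cL1D f g : cL1 mu f -> cL1 mu g -> cL1 mu (fun x => f x + g x)%R.
Proof.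
move=> [mf foo] [mg goo].
apply: (@cL1_le _ (fun x => (normc (f x))%:E + (normc (g x))%:E)).
- exact: cmfunD.
- by move=> x; rewrite -EFinD lee_fin ler_normcD.
- by apply: emeasurable_funD; exact: cmfun_enormc.
- rewrite ge0_integralD//; first exact: lte_add_pinfty.
  + by move=> x _; rewrite lee_fin normc_ge0.
  + exact: cmfun_enormc.
  + by move=> x _; rewrite lee_fin normc_ge0.
  + exact: cmfun_enormc.
Qed.

Lemma cL1N f : cL1 mu f -> cL1 mu (fun x => - f x)%R.
Proof.
move=> [mf foo]; split; first exact: cmfunN.
by under eq_integral do rewrite normc_opp.
Qed.

Lemma cL1B f g : cL1 mu f -> cL1 mu g -> cL1 mu (fun x => f x - g x)%R.
Proof. by move=> mf mg; apply: cL1D => //; exact: cL1N. Qed.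

Lemma cL1Mbounded f g (M : R) : cL1 mu f -> cmfun g ->
  (forall x, (normc (g x) <= M)%R) -> cL1 mu (fun x => f x * g x)%R.
Proof.
move=> [mf foo] mg gM.
apply: (@cL1_le _ (fun x => `|M|%:E * (normc (f x))%:E)).
- exact: cmfunM.
- move=> x; rewrite -EFinM lee_fin Normc.normcM mulrC ler_wpM2r ?normc_ge0//.
  by rewrite (le_trans (gM x))// ler_norm.
- by apply: measurable_funeM; exact: cmfun_enormc.
- rewrite ge0_integralZl//.
  + by rewrite lte_mul_pinfty//= lee_fin.
  + exact: cmfun_enormc.
  + by move=> x _; rewrite lee_fin normc_ge0.
Qed.

Lemma cL1Z (c : R[i]) f : cL1 mu f -> cL1 mu (fun x => c * f x)%R.
Proof.
move=> fL; under eq_fun do rewrite mulrC.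
by apply: (@cL1Mbounded _ _ (normc c)) => //; exact: cmfun_cst.
Qed.

Lemma cL1J f : cL1 mu f -> cL1 mu (fun x => (f x)^*)%R.
Proof.
move=> [mf foo]; split; first exact: cmfunJ.
by under eq_integral do rewrite normcJ.
Qed.

Lemma cintD f g : cL1 mu f -> cL1 mu g ->
  (cint mu (fun x => f x + g x) = cint mu f + cint mu g)%R.
Proof.
move=> fL gL; apply: complex_eq; rewrite /cint.
  rewrite RecD /= -RintegralD//; [|exact: cL1_Re|exact: cL1_Re].
  by apply: eq_Rintegral => x _; rewrite RecD.
rewrite ImcD /= -RintegralD//; [|exact: cL1_Im|exact: cL1_Im].
by apply: eq_Rintegral => x _; rewrite ImcD.
Qed.

Lemma cintZ (c : R[i]) f : cL1 mu f ->
  (cint mu (fun x => c * f x) = c * cint mu f)%R.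
Proof.
move=> fL; have ir := cL1_Re fL; have ii := cL1_Im fL.
have iZ (k : R) (h : T -> R) : mu.-integrable setT (EFin \o h) ->
    mu.-integrable setT (EFin \o (fun x => k * h x)%R).
  move=> hi; rewrite (_ : _ \o _ = (fun x => k%:E * (EFin \o h) x)).
    exact: integrableZl.
  by apply/funext => x /=; rewrite EFinM.
apply: complex_eq; rewrite /cint.
  rewrite RecM /= -!RintegralZl// -RintegralB//; [|exact: iZ|exact: iZ].
  by apply: eq_Rintegral => x _; rewrite RecM.
rewrite ImcM /= -!RintegralZl// -RintegralD//; [|exact: iZ|exact: iZ].
by apply: eq_Rintegral => x _; rewrite ImcM.
Qed.

Lemma cintN f : cL1 mu f -> (cint mu (fun x => - f x) = - cint mu f)%R.
Proof.
by move=> fL; rewrite -mulN1r -cintZ//; apply: eq_cint => x; rewrite mulN1r.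
Qed.

Lemma cintB f g : cL1 mu f -> cL1 mu g ->
  (cint mu (fun x => f x - g x) = cint mu f - cint mu g)%R.
Proof. by move=> fL gL; rewrite -cintN// -cintD//; exact: cL1N. Qed.

Lemma cintJ f : cL1 mu f -> (cint mu (fun x => (f x)^*) = (cint mu f)^*)%R.
Proof.
move=> fL; apply: complex_eq; rewrite /cint /=.
  by apply: eq_Rintegral => x _; rewrite RecJ.
rewrite -mulN1r -RintegralZl//; last exact: cL1_Im.
by apply: eq_Rintegral => x _; rewrite ImcJ mulN1r.
Qed.

(* Rotating the value of the integral onto the positive real axis reduces the
   complex triangle inequality to the real one. *)
Lemma le_normc_cint f : cL1 mu f -> (normc (cint mu f))%:E <= \int[mu]_x (normc (f x))%:E.
Proof.
move=> fL; set z := cint mu f.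
have [->|z0] := eqVneq z 0%R.
  rewrite /= expr0n addr0 sqrtr0; apply: integral_ge0 => x _.
  by rewrite lee_fin normc_ge0.
have nz : (0 < normc z)%R by rewrite lt_neqAle eq_sym normc_eq0 z0 normc_ge0.
pose u : R[i] := (z^* * ((normc z)^-1)%:C)%R.
have nu : normc u = 1%R.
  by rewrite Normc.normcM normcJ normcR ger0_norm ?invr_ge0 ?normc_ge0// divff ?gt_eqF.
have uz : (u * z)%R = (normc z)%:C%R.
  rewrite /u mulrAC [(_^* * _)%R]mulrC mulcJ -rmorphM/= expr2 mulfK//.
  by rewrite gt_eqF.
have uL := cL1Z u fL.
have -> : normc z = Rec (cint mu (fun x => u * f x)%R) by rewrite cintZ// uz.
rewrite /cint /=.
rewrite fineK; last first.
  by apply: integrable_fin_num => //; exact: cL1_Re.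
apply: (le_trans (lee_abs _)).
have /measurable_int muL := cL1_Re uL.
apply: (le_trans (le_abse_integral _ _ _)) => //.
apply: ge0_le_integral => //.
- exact: measurableT_comp.
- by apply: cmfun_enormc; case: fL.
- by move=> x _; rewrite lee_fin (le_trans (le_Rec_normc _))// Normc.normcM nu mul1r.
Qed.

Lemma ae_eq_cint f g : cmfun f -> cmfun g -> {ae mu, forall x, f x = g x} ->
  cint mu f = cint mu g.
Proof.
move=> [fr fi] [gr gi] fg; rewrite /cint /Rintegral; congr (fine _ +i* fine _).
  apply: ae_eq_integral => //; [exact/measurable_EFinP..|].
  by apply: filterS fg => x ->.
apply: ae_eq_integral => //; [exact/measurable_EFinP..|].
by apply: filterS fg => x ->.
Qed.

Lemma ae_eq_int_normc f g (k : R -> R) : measurable_fun setT k ->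
  (forall x, (0 <= k x)%R) -> cmfun f -> cmfun g ->
  {ae mu, forall x, f x = g x} ->
  \int[mu]_x (k (normc (f x)))%:E = \int[mu]_x (k (normc (g x)))%:E.
Proof.
move=> mk k0 mf mg fg; apply: ge0_ae_eq_integral => //.
- by apply/measurable_EFinP/measurableT_comp => //; exact: cmfun_normc.
- by apply/measurable_EFinP/measurableT_comp => //; exact: cmfun_normc.
- by move=> x _; rewrite lee_fin.
- by move=> x _; rewrite lee_fin.
- by apply: filterS fg => x ->.
Qed.

Lemma normc_RRe (h : T -> R) :
  cint mu (fun x => (h x)%:C) = (\int[mu]_x h x)%:C%R.
Proof.
rewrite /cint /=; congr (_ +i* _).
by rewrite /Rintegral integral0.
Qed.

End cint_theory.

(** * Square-integrable functions *)

(** Almost everywhere the lower limit of [f n] is [g], so Fatou's lemma passes a uniform bound on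
    integrals to the limit, with neither domination nor monotonicity. *)
Lemma fatou_le {R : realType} d (T : measurableType d) (mu : {measure set T -> \bar R})
    (f : nat -> T -> \bar R) (g : T -> \bar R) (c : \bar R) :
  (forall n, measurable_fun setT (f n)) -> (forall n x, 0 <= f n x)%E ->
  measurable_fun setT g -> (forall x, 0 <= g x)%E ->
  {ae mu, forall x, f ^~ x @ \oo --> g x} ->
  (forall n, \int[mu]_x f n x <= c)%E -> (\int[mu]_x g x <= c)%E.
Proof.
move=> mf f0 mg g0 fg fc.
have mlf : measurable_fun setT (fun x => limn_einf (f ^~ x)).
  rewrite (_ : (fun x => _) = (fun x => - limn_esup (fun n => - f n x)%E)%E).
    apply: measurableT_comp => //; apply: measurable_fun_limn_esup => n.
    exact: measurableT_comp.
  by apply/funext => x; rewrite -limn_einfN; congr limn_einf; apply/funext => n /=;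
    rewrite oppeK.
have lf0 x : (0 <= limn_einf (f ^~ x))%E.
  rewrite limn_einf_lim; apply: lime_ge; first exact: is_cvg_einfs.
  by apply: nearW => n; apply: le_ereal_inf_tmp => _ [m _ <-].
rewrite (_ : (\int[mu]_x g x = \int[mu]_x limn_einf (f ^~ x))%E); last first.
  apply: ge0_ae_eq_integral => //.
  by apply: filterS fg => x fgx _; have [-> _] := cvg_limn_einf_sup fgx.
have := @fatou _ _ _ mu setT measurableT f mf (fun n x _ => f0 n x).
move=> /le_trans; apply; rewrite limn_einf_lim.
apply: lime_le; first exact: is_cvg_einfs.
apply: nearW => n; apply: ereal_inf_le; exists (\int[mu]_x f n x)%E => //.
by exists n => /=.
Qed.

Lemma ler_dist_normc {R : realType} (z w : R[i]) : `|normc z - normc w| <= normc (z - w).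
Proof.
have h a b : normc a - normc b <= normc (a - b) :> R.
  by rewrite lerBlDr (le_trans _ (ler_normcD _ _))// subrK.
by rewrite ler_norml h andbT lerNl opprB normc_distC h.
Qed.

(** The squared norm is kept as a plain integral, on which Fatou, Tonelli and Young act without
    roots; [L2n_le_fin] translates bounds. *)
Definition n2 {R : realType} d (T : measurableType d) (mu : {measure set T -> \bar R})
  (f : T -> R[i]) : \bar R := (\int[mu]_x (normc (f x) ^+ 2)%:E)%E.

Definition L2n {R : realType} d (T : measurableType d) (mu : {measure set T -> \bar R})
  (f : T -> R[i]) : \bar R := Lnorm mu 2%:E (fun x => (normc (f x))%:E).

Definition cL2 {R : realType} d (T : measurableType d) (mu : {measure set T -> \bar R})
  (f : T -> R[i]) : Prop := cmfun f /\ (L2n mu f < +oo)%E.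

Section L2.
Context {R : realType} d (T : measurableType d) (mu : {measure set T -> \bar R}).
Implicit Types (f g : T -> R[i]).
Local Open Scope ereal_scope.

Lemma n2_ge0 f : 0 <= n2 mu f.
Proof. by apply: integral_ge0 => x _; rewrite lee_fin sqr_ge0. Qed.

Lemma L2n_ge0 f : 0 <= L2n mu f. Proof. exact: Lnorm_ge0. Qed.

Lemma L2nE f : L2n mu f = n2 mu f `^ 2^-1.
Proof.
rewrite /L2n unlock /n2; congr (_ `^ _); apply: eq_integral => x _.
by rewrite abse_EFin poweR_EFin ger0_norm ?normc_ge0// powR_mulrn ?normc_ge0.
Qed.

Lemma cmfun_n2 f : cmfun f -> measurable_fun setT (fun x => (normc (f x) ^+ 2)%:E).
Proof. by move=> mf; apply/measurable_EFinP/measurable_funX; exact: cmfun_normc. Qed.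

Lemma L2n_le_fin f (c : R) : (0 <= c)%R -> (L2n mu f <= c%:E) = (n2 mu f <= (c ^+ 2)%:E).
Proof.
move=> c0; rewrite L2nE; have := n2_ge0 f; case: (n2 mu f) => [r||]//.
- rewrite poweR_EFin !lee_fin => r0; rewrite powR12_sqrt//.
  by rewrite -(ler_pXn2r (n := 2)) ?nnegrE ?sqrtr_ge0// sqr_sqrtr.
- by move=> _; rewrite poweRyr ?invr_eq0//= !leNgt !ltey.
Qed.

Lemma L2n_lty f : (L2n mu f < +oo) = (n2 mu f < +oo).
Proof.
rewrite L2nE; apply/idP/idP; last exact: poweR_lty.
by apply: lty_poweRy; rewrite invr_eq0.
Qed.

Lemma L2n_fin_num f : (L2n mu f < +oo) = (L2n mu f \is a fin_num).
Proof. by rewrite ge0_fin_numE// L2n_ge0. Qed.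

Lemma le_n2 f g : cmfun f -> cmfun g -> (forall x, normc (f x) <= normc (g x))%R ->
  n2 mu f <= n2 mu g.
Proof.
move=> mf mg fg; apply: ge0_le_integral => //.
- by move=> x _; rewrite lee_fin sqr_ge0.
- exact: cmfun_n2.
- exact: cmfun_n2.
- by move=> x _; rewrite lee_fin ler_pXn2r ?nnegrE ?normc_ge0.
Qed.

Lemma le_L2n_n2 f g : n2 mu f <= n2 mu g -> L2n mu f <= L2n mu g.
Proof.
by move=> fg; rewrite !L2nE; apply: gt0_ler_poweR; rewrite ?in_itv/= ?n2_ge0 ?leey
  ?invr_ge0.
Qed.

Lemma le_L2n f g : cmfun f -> cmfun g -> (forall x, normc (f x) <= normc (g x))%R ->
  L2n mu f <= L2n mu g.
Proof. by move=> *; apply: le_L2n_n2; exact: le_n2. Qed.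

Lemma eq_L2n_normc f g : (forall x, normc (f x) = normc (g x)) ->
  L2n mu f = L2n mu g.
Proof. by move=> fg; rewrite /L2n; apply: eq_Lnorm => x /=; rewrite fg. Qed.

Lemma ae_eq_n2 f g : cmfun f -> cmfun g -> {ae mu, forall x, f x = g x} ->
  n2 mu f = n2 mu g.
Proof.
move=> mf mg fg; apply: (ae_eq_int_normc (k := fun t => t ^+ 2)%R) => // x.
exact: sqr_ge0.
Qed.

Lemma ae_eq_L2n f g : cmfun f -> cmfun g -> {ae mu, forall x, f x = g x} ->
  L2n mu f = L2n mu g.
Proof. by move=> mf mg fg; rewrite !L2nE (ae_eq_n2 mf mg fg). Qed.

Lemma L2n_eq0_ae f : cmfun f -> L2n mu f = 0 -> {ae mu, forall x, f x = 0%R}.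
Proof.
move=> mf /Lnorm_eq0_eq0 => /(_ (cmfun_enormc mf)) h.
apply: filterS (h _) => //= x /(_ I) [] /eqP.
by rewrite normc_eq0 => /eqP.
Qed.

Lemma L2nD f g : cmfun f -> cmfun g ->
  L2n mu (fun x => f x + g x)%R <= L2n mu f + L2n mu g.
Proof.
move=> mf mg; have := @minkowski_EFin _ _ _ mu (fun x => normc (f x))
  (fun x => normc (g x)) 2 (cmfun_normc mf) (cmfun_normc mg) (ler1n _ 2).
apply: le_trans.
have mfg : cmfun (fun x => (normc (f x) + normc (g x))%:C)%R.
  by apply: cmfunR; apply: measurable_funD; exact: cmfun_normc.
apply: le_trans (@le_L2n _ (fun x => (normc (f x) + normc (g x))%:C)%R _ _ _) _ => //.
- exact: cmfunD.
- move=> x; rewrite normcR ger0_norm ?addr_ge0 ?normc_ge0//.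
  exact: ler_normcD.
- rewrite le_eqVlt; apply/orP; left; apply/eqP; apply: eq_Lnorm => x /=.
  by congr EFin; rewrite expr0n addr0 sqrtr_sqr ger0_norm ?addr_ge0 ?normc_ge0.
Qed.

Lemma L2nN f : L2n mu (fun x => - f x)%R = L2n mu f.
Proof. by apply: eq_L2n_normc => x; rewrite normc_opp. Qed.

Lemma L2n_distC f g : L2n mu (fun x => f x - g x)%R = L2n mu (fun x => g x - f x)%R.
Proof. by apply: eq_L2n_normc => x; rewrite normc_distC. Qed.

Lemma L2nB f g : cmfun f -> cmfun g ->
  L2n mu (fun x => f x - g x)%R <= L2n mu f + L2n mu g.
Proof. by move=> mf mg; rewrite -(L2nN g); apply: L2nD => //; exact: cmfunN. Qed.

Lemma L2nB3 f g h : cmfun f -> cmfun g -> cmfun h ->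
  L2n mu (fun x => f x - h x)%R <=
  L2n mu (fun x => f x - g x)%R + L2n mu (fun x => g x - h x)%R.
Proof.
move=> mf mg mh.
rewrite (_ : (fun x => f x - h x)%R = (fun x => (f x - g x) + (g x - h x))%R).
  by apply: L2nD; exact: cmfunB.
by apply/funext => x; rewrite addrA subrK.
Qed.

Lemma cL2D f g : cL2 mu f -> cL2 mu g -> cL2 mu (fun x => f x + g x)%R.
Proof.
move=> [mf fo] [mg go]; split; first exact: cmfunD.
by apply: le_lt_trans (L2nD mf mg) _; exact: lte_add_pinfty.
Qed.

Lemma cL2N f : cL2 mu f -> cL2 mu (fun x => - f x)%R.
Proof. by move=> [mf fo]; split; [exact: cmfunN|rewrite L2nN]. Qed.

Lemma cL2B f g : cL2 mu f -> cL2 mu g -> cL2 mu (fun x => f x - g x)%R.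
Proof. by move=> fL gL; apply: cL2D => //; exact: cL2N. Qed.

Lemma cL2_le f g : cmfun f -> cL2 mu g -> (forall x, normc (f x) <= normc (g x))%R ->
  cL2 mu f.
Proof. by move=> mf [mg goo] fg; split => //; apply: le_lt_trans goo; exact: le_L2n. Qed.

Lemma L2nZ (c : R[i]) f : cmfun f ->
  L2n mu (fun x => c * f x)%R = (normc c)%:E * L2n mu f.
Proof.
move=> mf; rewrite !L2nE /n2.
under eq_integral do rewrite Normc.normcM exprMn EFinM.
rewrite ge0_integralZl//.
- rewrite poweRM ?n2_ge0 ?lee_fin ?sqr_ge0// poweR_EFin -powR_mulrn ?normc_ge0//.
  by rewrite -powRrM mulfV ?powRr1 ?normc_ge0.
- exact: cmfun_n2.
- by move=> x _; rewrite lee_fin sqr_ge0.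
- by rewrite lee_fin sqr_ge0.
Qed.

Lemma cL2Z (c : R[i]) f : cL2 mu f -> cL2 mu (fun x => c * f x)%R.
Proof.
move=> [mf fo]; split; first by apply: cmfunM => //; exact: cmfun_cst.
by rewrite L2nZ// lte_mul_pinfty// ?lee_fin ?normc_ge0.
Qed.

Lemma L2n_CS f g : cmfun f -> cmfun g ->
  \int[mu]_x (normc (f x * g x)%R)%:E <= L2n mu f * L2n mu g.
Proof.
move=> mf mg; have := @hoelder _ _ _ mu (fun x => normc (f x))
  (fun x => normc (g x)) 2 2 (cmfun_normc mf) (cmfun_normc mg) (ltr0n _ 2) (ltr0n _ 2).
have -> : (2^-1 + 2^-1 = 1 :> R)%R by rewrite [RHS]splitr !div1r.
move=> /(_ erefl); apply: le_trans; rewrite Lnorm1 le_eqVlt; apply/orP; left.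
apply/eqP/eq_integral => x _ /=.
by rewrite Normc.normcM ger0_norm// mulr_ge0 ?normc_ge0.
Qed.

Lemma cL2M f g : cL2 mu f -> cL2 mu g -> cL1 mu (fun x => f x * g x)%R.
Proof.
move=> [mf fo] [mg go]; split; first exact: cmfunM.
apply: le_lt_trans (L2n_CS mf mg) _; apply: lte_mul_pinfty => //.
  exact: L2n_ge0.
by rewrite -L2n_fin_num.
Qed.

(** Lower semicontinuity of the norm under almost everywhere convergence, by Fatou applied to the
    squares. *)
Lemma L2n_fatou (u : nat -> T -> R[i]) (v : T -> R[i]) (c : R) :
  (0 <= c)%R -> (forall n, cmfun (u n)) -> cmfun v ->
  {ae mu, forall x, (normc (u n x - v x) @[n --> \oo] --> 0)%R} ->
  (forall n, L2n mu (u n) <= c%:E) -> L2n mu v <= c%:E.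
Proof.
move=> c0 mu_ mv uv uc; rewrite L2n_le_fin//.
apply: (@fatou_le _ _ _ _ (fun n x => (normc (u n x) ^+ 2)%:E)).
- by move=> n; exact: cmfun_n2.
- by move=> n x; rewrite lee_fin sqr_ge0.
- exact: cmfun_n2.
- by move=> x; rewrite lee_fin sqr_ge0.
- apply: filterS uv => x uvx; apply/cvg_EFin; first exact: nearW.
  have cu : (normc (u n x) @[n --> \oo] --> normc (v x))%R.
    apply/cvgrPdist_le => e e0; move/cvgr0Pnorm_le : uvx => /(_ e e0).
    apply: filterS => n; rewrite ger0_norm ?normc_ge0//; apply: le_trans.
    by rewrite distrC; exact: ler_dist_normc.
  exact: (cvgM cu cu).
- by move=> n; rewrite -L2n_le_fin.
Qed.

End L2.

(** The epsilon form needs no prior finiteness of the terms: the case [e = 1] already makes them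
    finite eventually. *)
Lemma ge0_cvge0P {R : realType} (u : (\bar R)^nat) : (forall n, 0 <= u n)%E ->
  (u @ \oo --> 0%E) <-> forall e : R, 0 < e -> \forall n \near \oo, (u n <= e%:E)%E.
Proof.
move=> u0; split=> [/fine_cvgP[uf uc] e e0|h].
  move/cvgr0Pnorm_le : uc => /(_ e e0) uc; near=> n.
  have un : u n \is a fin_num by near: n.
  rewrite -(fineK un) lee_fin; apply: le_trans (ler_norm _) _.
  by near: n.
have uf : \forall n \near \oo, u n \is a fin_num.
  apply: filterS (h 1 ltr01) => n un.
  by rewrite ge0_fin_numE// (le_lt_trans un)// ltry.
apply/fine_cvgP; split => //.
apply/cvgr0Pnorm_le => e e0; near=> n.
have un : u n \is a fin_num by near: n.
rewrite ger0_norm ?fine_ge0// -lee_fin fineK//.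
by near: n; exact: h.
Unshelve. all: by end_near. Qed.

Lemma cvg_geometric_increments {R : realType} (a : R^nat) (C : R) :
  (forall k, `|a k.+1 - a k| <= C * 2^-1 ^+ k) -> cvgn a.
Proof.
move=> aC.
have C0 : 0 <= C by have := aC 0%N; rewrite expr0 mulr1; apply: le_trans.
have h : cvgn (series (telescope a)).
  apply: normed_cvg; apply: (@series_le_cvg _ _ (geometric C 2^-1)) => //.
  - by move=> n /=; exact: normr_ge0.
  - by move=> n /=; apply: mulr_ge0 => //; apply: exprn_ge0; rewrite invr_ge0.
  - apply: cvgP; apply: cvg_geometric_series.
    by rewrite ger0_norm// invf_lt1// ltr1n.
have -> : a = (fun n => a 0%N + series (telescope a) n).
  by apply/funext => n; exact: eq_sum_telescope.
by apply: is_cvgD => //; exact: is_cvg_cst.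
Qed.

Definition L2cvg {R : realType} d (T : measurableType d) (mu : {measure set T -> \bar R})
  (u : nat -> T -> R[i]) (v : T -> R[i]) : Prop :=
  L2n mu (fun x => u n x - v x) @[n --> \oo] --> 0%E.

(** * Convergence in L2 *)

Section L2_convergence.
Context {R : realType} d (T : measurableType d) (mu : {measure set T -> \bar R}).
Implicit Types (f g : T -> R[i]) (u v : nat -> T -> R[i]).

Lemma L2cvgP u f : L2cvg mu u f <->
  forall e : R, 0 < e -> \forall n \near \oo, (L2n mu (fun x => (u n x - f x)%R) <= e%:E)%E.
Proof. by apply: ge0_cvge0P => n; exact: L2n_ge0. Qed.

(** Fatou applied to [u n - f], whose norms are eventually below any [e], bounds the norm of [g - f]
    by [e]. This is how pointwise computations identify L2 limits. *)
Lemma L2cvg_ae_unique u f g : (forall n, cmfun (u n)) -> cmfun f -> cmfun g ->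
  L2cvg mu u f -> {ae mu, forall x, normc (u n x - g x) @[n --> \oo] --> 0} ->
  {ae mu, forall x, f x = g x}.
Proof.
move=> mu_ mf mg /L2cvgP uf ug.
have h : (L2n mu (fun x => g x - f x)%R <= 0)%E.
  apply/lee_addgt0Pr => e e0; rewrite add0e.
  have [N _ hN] := uf e e0.
  (* The shift by [N] makes the bound hold at every index, as [L2n_fatou] requires. *)
  apply: (@L2n_fatou _ _ _ _ (fun n x => u (n + N)%N x - f x)) => //.
  - exact: ltW.
  - by move=> n; exact: cmfunB.
  - exact: cmfunB.
  - apply: filterS ug => x ugx.
    rewrite (_ : (fun n => _) = (fun n => normc (u (n + N)%N x - g x))).
      by rewrite (cvg_shiftn N (fun n => normc (u n x - g x))).
    by apply/funext => n; congr normc; ring.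
  - by move=> n; apply: hN => /=; rewrite leq_addl.
have {}h : L2n mu (fun x => g x - f x)%R = 0%E.
  by apply/eqP; rewrite eq_le h L2n_ge0.
have := L2n_eq0_ae (cmfunB mg mf) h.
by apply: filterS => x /eqP; rewrite subr_eq0 => /eqP.
Qed.

Lemma L2cvg_unique u f g : (forall n, cmfun (u n)) -> cmfun f -> cmfun g ->
  L2cvg mu u f -> L2cvg mu u g -> {ae mu, forall x, f x = g x}.
Proof.
move=> mu_ mf mg /L2cvgP uf /L2cvgP ug.
have h : (L2n mu (fun x => f x - g x)%R <= 0)%E.
  apply/lee_addgt0Pr => e e0; rewrite add0e.
  have e2 : 0 < e / 2 by rewrite divr_gt0.
  near \oo => n.
  apply: le_trans (L2nB3 mu mf (mu_ n) mg) _.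
  rewrite (splitr e) EFinD; apply: leeD.
    by rewrite L2n_distC; near: n; exact: uf.
  by near: n; exact: ug.
have {}h : L2n mu (fun x => f x - g x)%R = 0%E.
  by apply/eqP; rewrite eq_le h L2n_ge0.
have := L2n_eq0_ae (cmfunB mf mg) h.
by apply: filterS => x /eqP; rewrite subr_eq0 => /eqP.
Unshelve. all: by end_near. Qed.

Lemma L2cvg_le u f (c : \bar R) : (forall n, cmfun (u n)) -> cmfun f ->
  L2cvg mu u f -> (forall n, L2n mu (u n) <= c)%E -> (L2n mu f <= c)%E.
Proof.
move=> mu_ mf /L2cvgP uf uc; apply/lee_addgt0Pr => e e0.
near \oo => n.
have -> : f = (fun x => u n x - (u n x - f x)).
  by apply/funext => x; ring.
apply: le_trans (L2nB mu (mu_ n) (cmfunB (mu_ n) mf)) _.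
by apply: leeD => //; near: n; exact: uf.
Unshelve. all: by end_near. Qed.

Lemma L2cvg_cL2 u f : (forall n, cL2 mu (u n)) -> cmfun f -> L2cvg mu u f -> cL2 mu f.
Proof.
move=> uL mf /L2cvgP /(_ 1 ltr01)[N _ /(_ N (leqnn N)) uf]; split => //.
have -> : f = (fun x => u N x - (u N x - f x)).
  by apply/funext => x; ring.
have [mN No] := uL N.
apply: le_lt_trans (L2nB mu mN (cmfunB mN mf)) _.
by apply: lte_add_pinfty => //; apply: le_lt_trans uf _; rewrite ltry.
Qed.

Lemma L2cvg_cint u v f g : (forall n, cL2 mu (u n)) -> (forall n, cL2 mu (v n)) ->
  cL2 mu f -> cL2 mu g -> L2cvg mu u f -> L2cvg mu v g ->
  forall e : R, 0 < e -> \forall n \near \oo,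
    normc (cint mu (fun x => u n x * v n x) - cint mu (fun x => f x * g x)) <= e.
Proof.
move=> uL vL fL gL /L2cvgP uf /L2cvgP vg e e0.
have [mf fo] := fL; have [mg go] := gL.
have ff : L2n mu f \is a fin_num by rewrite -L2n_fin_num.
have gf : L2n mu g \is a fin_num by rewrite -L2n_fin_num.
pose F := fine (L2n mu f); pose G := fine (L2n mu g).
have F0 : 0 <= F by rewrite fine_ge0// L2n_ge0.
have G0 : 0 <= G by rewrite fine_ge0// L2n_ge0.
(* The error is at most [a * a + a * G + F * a]; having [a <= 1] makes it linear in [a], and the
   other entry of the minimum brings it below [e]. *)
pose a := Num.min 1 (e / (F + G + 1)).
have a0 : 0 < a by rewrite lt_min ltr01 divr_gt0// ltr_wpDl// addr_ge0.
near=> n.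
have [mun _] := uL n; have [mvn _] := vL n.
have du := cL2B (uL n) fL; have dv := cL2B (vL n) gL.
rewrite -cintB; [|exact: cL2M|exact: cL2M].
rewrite (@eq_cint _ _ _ _ _ (fun x => (u n x - f x) * (v n x - g x)
  + (u n x - f x) * g x + f x * (v n x - g x))); last by move=> x; ring.
have L1 := cL2M du dv; have L2 := cL2M du gL; have L3 := cL2M fL dv.
rewrite cintD//; last exact: cL1D.
rewrite cintD//.
have ha : (L2n mu (fun x => (u n x - f x)%R) <= a%:E)%E by near: n; exact: uf.
have hb : (L2n mu (fun x => (v n x - g x)%R) <= a%:E)%E by near: n; exact: vg.
have CS p q (A B : R) : cL2 mu p -> cL2 mu q -> (L2n mu p <= A%:E)%E ->
    (L2n mu q <= B%:E)%E -> normc (cint mu (fun x => p x * q x)) <= A * B.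
  move=> pL qL pA qB; rewrite -lee_fin EFinM.
  apply: le_trans (le_normc_cint (cL2M pL qL)) _.
  have [mp _] := pL; have [mq _] := qL.
  apply: le_trans (L2n_CS mu mp mq) _.
  by apply: lee_pmul => //; exact: L2n_ge0.
have h1 := CS _ _ _ _ du dv ha hb.
have h2 := CS _ _ a G du gL ha; have h3 := CS _ _ F a fL dv.
apply: le_trans (ler_normcD _ _) _.
apply: le_trans (lerD (ler_normcD _ _) (lexx _)) _.
apply: (@le_trans _ _ (a * a + a * G + F * a)).
  apply: lerD; first by apply: lerD => //; apply: h2; rewrite fineK.
  by apply: h3 => //; rewrite fineK.
apply: (@le_trans _ _ (a * (F + G + 1))).
  have : a * a <= a * 1 by rewrite ler_pM2l// ge_min lexx.
  by nra.
by rewrite -ler_pdivlMr ?ge_min ?lexx ?orbT// ltr_wpDl// addr_ge0.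
Unshelve. all: by end_near. Qed.

End L2_convergence.

(** * Completeness of L2 *)

Section completeness.
Context {R : realType} d (T : measurableType d) (mu : {measure set T -> \bar R}).

(** Increments that are small in norm are turned into pointwise geometric increments: if the
    weighted sum [A x] of their squares is finite, the increment at step [k] is at most
    [sqrt (A x) * 2^-k]. *)
Lemma L2_fast_subsequence_cvg (w : nat -> T -> R[i]) : (forall n, cmfun (w n)) ->
  (forall k, L2n mu (fun x => w k.+1 x - w k x)%R <= (2^-1 ^+ (2 * k).+1)%:E)%E ->
  exists2 f : T -> R[i], cmfun f &
    {ae mu, forall x, normc (w n x - f x) @[n --> \oo] --> 0}.
Proof.
move=> mw wk.
(* The weight [4 ^+ k] is affordable: the squared norm is at most [2^-(4k+2)], which leaves
   [2^-(2k+2) <= 2^-(k+1)], summing to [1]. *)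
pose a k x : \bar R := (4 ^+ k * normc (w k.+1 x - w k x) ^+ 2)%:E.
have a0 k x : (0 <= a k x)%E by rewrite lee_fin mulr_ge0 ?exprn_ge0 ?normc_ge0.
have ma k : measurable_fun setT (a k).
  apply/measurable_EFinP/measurable_funM; first exact: measurable_cst.
  by apply/measurable_funX/cmfun_normc; exact: cmfunB.
pose A x : \bar R := (\sum_(0 <= k <oo) a k x)%E.
have A0 x : (0 <= A x)%E by apply: nneseries_ge0.
have mA : measurable_fun setT A by exact: ge0_emeasurable_sum.
have iA : (\int[mu]_x A x <= 1)%E.
  rewrite integral_nneseries//.
  have <- : (\sum_(0 <= k <oo) (1 / (2 ^ (k + 1))%:R : R)%:E = 1)%E.
    have /cvg_lim := @cvg_geometric_eseries_half R 1 0.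
    by rewrite expr0 divr1 => <-.
  apply: lee_nneseries => [k _ _|k _]; first by apply: integral_ge0 => x _; exact: a0.
  have -> : (\int[mu]_x a k x)%E = ((4 ^+ k)%:E * n2 mu (fun x => w k.+1 x - w k x)%R)%E.
    rewrite -ge0_integralZl//; first exact: cmfun_n2 (cmfunB (mw _) (mw _)).
    by move=> x _; rewrite lee_fin sqr_ge0.
  have := wk k; rewrite L2n_le_fin ?exprn_ge0// => h.
  apply: le_trans (lee_wpmul2l _ h) _; first by rewrite lee_fin exprn_ge0.
  rewrite -EFinM lee_fin natrX mul1r -exprVn.
  have -> : (2^-1 : R) ^+ (2 * k).+1 ^+ 2 =
      2^-1 ^+ (2 * k) * (2^-1 ^+ (k + 1) * 2^-1 ^+ (k + 1)).
    by rewrite -!exprD -exprM; congr (_ ^+ _); lia.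
  rewrite !mulrA (_ : 4 ^+ k * 2^-1 ^+ (2 * k) = 1 :> R) ?mul1r; last first.
    by rewrite exprM -exprMn (_ : 4 * 2^-1 ^+ 2 = 1 :> R) ?expr1n//; field.
  by rewrite ler_piMr ?exprn_ge0 ?exprn_ile1 ?invf_le1 ?ler1n ?invr_ge0.
have Afin : {ae mu, forall x, A x \is a fin_num}.
  have : mu.-integrable setT A.
    apply/integrableP; split => //.
    under eq_integral do rewrite gee0_abs//.
    by apply: le_lt_trans iA _; rewrite ltry.
  by move=> /(integrable_ae measurableT); apply: filterS => x; exact.
pose D := [set x | (A x < +oo)%E].
have mD : measurable D.
  by rewrite -(setTI D); exact: emeasurable_fun_infty_o.
(* Cutting off outside the set where [A] is finite makes the sequence converge at every point, so
   that its limit is measurable. *)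
pose w' k x := (\1_D x : R)%:C * w k x.
have mw' k : cmfun (w' k).
  by apply: cmfunM => //; apply: cmfunR; exact: measurable_indic.
have E0 : (false%:R : R)%:C = 0 :> R[i] by [].
have E1 : (true%:R : R)%:C = 1 :> R[i] by [].
have incr x : exists C, forall k, normc (w' k.+1 x - w' k x) <= C * 2^-1 ^+ k.
  rewrite /w' indicE; have [xD|xD] := boolP (x \in D); last first.
    by exists 0 => k; rewrite E0 !mul0r subrr ?mul0r /= expr0n addr0 sqrtr0.
  exists (Num.sqrt (fine (A x))) => k; rewrite E1 !mul1r.
  have Ax : A x \is a fin_num by rewrite ge0_fin_numE//; move: xD; rewrite inE.
  have : (a k x <= A x)%E.
    apply: le_trans (nneseries_lim_ge k.+1 _) => //.
    by rewrite big_nat_recr//= leeDr// sume_ge0.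
  rewrite -(fineK Ax) lee_fin => h.
  rewrite -(ler_pXn2r (n := 2)) ?nnegrE ?normc_ge0 ?mulr_ge0 ?sqrtr_ge0 ?exprn_ge0//.
  have e4 : (2^-1 ^+ k) ^+ 2 = (4 ^+ k)^-1 :> R.
    by rewrite -exprM mulnC exprM -exprVn; congr (_ ^+ _); field.
  rewrite [leRHS]exprMn e4 sqr_sqrtr; last exact: fine_ge0 (A0 x).
  by rewrite ler_pdivlMr ?exprn_gt0// mulrC.
have cRe x : cvgn (fun k => Rec (w' k x)).
  have [C hC] := incr x; apply: (@cvg_geometric_increments _ _ C) => k.
  by apply: le_trans (hC k); rewrite -RecN -RecD le_Rec_normc.
have cIm x : cvgn (fun k => Imc (w' k x)).
  have [C hC] := incr x; apply: (@cvg_geometric_increments _ _ C) => k.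
  by apply: le_trans (hC k); rewrite -ImcN -ImcD le_Imc_normc.
pose f x := limn (fun k => Rec (w' k x)) +i* limn (fun k => Imc (w' k x)).
exists f.
  split.
    by apply: (@measurable_fun_cvg _ _ _ _ (fun k x => Rec (w' k x)));
      [move=> m; case: (mw' m)|move=> x _; exact: cRe].
  by apply: (@measurable_fun_cvg _ _ _ _ (fun k x => Imc (w' k x)));
      [move=> m; case: (mw' m)|move=> x _; exact: cIm].
apply: filterS Afin => x Ax.
have w'E k : w' k x = w k x.
  by rewrite /w' indicE mem_set ?E1 ?mul1r//; rewrite /D /= -ge0_fin_numE.
have h1 := cRe x; have h2 := cIm x.
have h : `|Rec (w' n x) - limn (fun k => Rec (w' k x))| +
         `|Imc (w' n x) - limn (fun k => Imc (w' k x))| @[n --> \oo] --> 0.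
  have c0 (r : R^nat) : cvgn r -> `|r n - limn r| @[n --> \oo] --> 0.
    move=> cr; have := cvg_norm (cvgB cr (@cvg_cst _ (limn r) _ \oo _)).
    by rewrite subrr normr0; exact.
  by rewrite -(addr0 0); apply: cvgD; [exact: (c0 _ h1)|exact: (c0 _ h2)].
apply: (squeeze_cvgr _ (cvg_cst 0) h); apply: nearW => n.
rewrite normc_ge0/= -w'E.
by apply: le_trans (normc_le_ReIm _) _; rewrite RecD ImcD RecN ImcN.
Qed.

Lemma L2_complete (u : nat -> T -> R[i]) : (forall n, cmfun (u n)) ->
  (forall e : R, 0 < e -> exists N, forall m n, (N <= m)%N -> (N <= n)%N ->
    (L2n mu (fun x => u m x - u n x)%R <= e%:E)%E) ->
  exists2 f : T -> R[i], cmfun f & L2cvg mu u f.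
Proof.
move=> mu_ uC.
have e0 k : 0 < 2^-1 ^+ (2 * k).+1 :> R by rewrite exprn_gt0// invr_gt0.
pose N k := sval (cid (uC _ (e0 k))).
have NP k m n : (N k <= m)%N -> (N k <= n)%N ->
    (L2n mu (fun x => u m x - u n x)%R <= (2^-1 ^+ (2 * k).+1)%:E)%E.
  exact: (svalP (cid (uC _ (e0 k)))).
(* Partial sums of [(N i).+1] give indices that increase strictly and stay above [N k]. *)
pose phi k := (\sum_(i < k.+1) (N i).+1)%N.
have phi_ge k : (N k <= phi k)%N.
  by rewrite /phi big_ord_recr /=; lia.
have phiS k : (phi k < phi k.+1)%N by rewrite /phi [in X in (_ < X)%N]big_ord_recr /=; lia.
have phi_id k : (k <= phi k)%N.
  by elim: k => // k ih; apply: leq_ltn_trans (phiS k).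
have [f mf wf] := @L2_fast_subsequence_cvg (fun k => u (phi k)) (fun k => mu_ _)
  (fun k => NP k _ _ (leq_trans (phi_ge k) (ltnW (phiS k))) (phi_ge k)).
exists f => //; apply/L2cvgP => e ep.
have [M hM] := uC e ep; exists M => // n /= Mn.
(* With [n] fixed, Fatou runs along the subsequence; its shift by [M] keeps both indices in the
   range where the Cauchy bound holds. *)
apply: (@L2n_fatou _ _ _ _ (fun k x => u n x - u (phi (k + M)%N) x)).
- exact: ltW.
- by move=> k; exact: cmfunB.
- exact: cmfunB.
- apply: filterS wf => x wfx.
  rewrite (_ : (fun k => _) = (fun k => normc (u (phi (k + M)%N) x - f x))).
    by rewrite (cvg_shiftn M (fun k => normc (u (phi k) x - f x))).
  by apply/funext => k; rewrite normc_distC; congr normc; ring.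
- by move=> k; apply: hM => //; apply: leq_trans (phi_id _); rewrite leq_addl.
Qed.

End completeness.

(** * Fubini and changes of variables in the plane *)

Section fubini.
Context {R : realType} d1 d2 (T1 : measurableType d1) (T2 : measurableType d2).
Context (m1 : {sigma_finite_measure set T1 -> \bar R}).
Context (m2 : {sigma_finite_measure set T2 -> \bar R}).
Local Open Scope ereal_scope.

(** Positive and negative parts reduce this to Tonelli, so that no slice has to be integrable; later
    kernels have integrable slices only almost everywhere. *)
Lemma measurable_integral_snd (f : T1 * T2 -> \bar R) : measurable_fun setT f ->
  measurable_fun setT (fun x => \int[m2]_y f (x, y)).
Proof.
move=> mf; rewrite (_ : (fun x => _) = (fun x =>
    \int[m2]_y (f^\+ (x, y)) - \int[m2]_y (f^\- (x, y)))).
  apply: emeasurable_funB.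
    by apply: (@measurable_fun_fubini_tonelli_F _ _ _ _ _ m2 f^\+) => //;
      exact: measurable_funepos.
  by apply: (@measurable_fun_fubini_tonelli_F _ _ _ _ _ m2 f^\-) => //;
    exact: measurable_funeneg.
by apply/funext => x; rewrite [LHS]integralE -[fun _ => f _]/(f \o pair x)
  funepos_comp funeneg_comp.
Qed.

Lemma cmfun_cint_snd (h : T1 * T2 -> R[i]) : cmfun h ->
  cmfun (fun x => cint m2 (fun y => h (x, y))).
Proof.
have mfine (f : T1 * T2 -> R) : measurable_fun setT f ->
    measurable_fun setT (fun x => fine (\int[m2]_y (f (x, y))%:E)).
  move=> mf; apply: (measurableT_comp (fine_measurable measurableT)) => //.
  by apply: (measurable_integral_snd (f := fun z => (f z)%:E)); exact/measurable_EFinP.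
by move=> [hr hi]; split; [exact: mfine hr|exact: mfine hi].
Qed.

(** [Rintegral] sends an infinite slice integral to [0]; this happens only on a null set, where it
    does not affect the outer integral. *)
Lemma Rfubini12 (f : T1 * T2 -> R) :
  (m1 \x m2).-integrable setT (fun z => (f z)%:E) ->
  (\int[m1]_x (\int[m2]_y f (x, y)) = \int[m1 \x m2]_z f z)%R.
Proof.
move=> fi; rewrite /Rintegral; congr fine.
rewrite -(integral12_prod_meas1 fi); apply: ae_eq_integral => //.
- apply: measurableT_comp => //; apply: (measurableT_comp (fine_measurable measurableT)).
  exact: measurable_fubini_F fi.
- exact: measurable_fubini_F fi.
- have := integrable_ae measurableT (integrable_fubini_F fi).
  by apply: filterS => x /(_ I) h _; rewrite fineK.
Qed.

Lemma Rfubini21 (f : T1 * T2 -> R) :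
  (m1 \x m2).-integrable setT (fun z => (f z)%:E) ->
  (\int[m2]_y (\int[m1]_x f (x, y)) = \int[m1 \x m2]_z f z)%R.
Proof.
move=> fi; rewrite /Rintegral; congr fine.
have mG := measurable_fubini_G fi.
rewrite -(integral21_prod_meas1 fi); apply: ae_eq_integral => //.
- by apply: measurableT_comp => //; exact: (measurableT_comp (fine_measurable measurableT)).
- have /integrableP[_ Goo] : m2.-integrable setT (fubini_G m1 (fun z => (f z)%:E)).
    apply/integrableP; split => //.
    have /integrableP[mf foo] := fi; apply: le_lt_trans foo.
    rewrite fubini_tonelli2//; last exact: measurableT_comp.
    apply: ge0_le_integral => //.
    + exact: measurableT_comp.
    + apply: (@measurable_fun_fubini_tonelli_G _ _ _ _ _ m1 (fun z => `|(f z)%:E|)) => //.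
      exact: measurableT_comp.
    + move=> y _; apply: le_abse_integral => //.
      exact: measurableT_comp mf (pair2_measurable _).
  have : m2.-integrable setT (fubini_G m1 (fun z => (f z)%:E)) by apply/integrableP.
  move=> /(integrable_ae measurableT).
  by apply: filterS => x /(_ I) h _; rewrite fineK.
Qed.

Lemma cfubini12 (h : T1 * T2 -> R[i]) : cL1 (m1 \x m2) h ->
  cint m1 (fun x => cint m2 (fun y => h (x, y))) = cint (m1 \x m2) h.
Proof.
move=> hL; rewrite /cint; congr (_ +i* _).
  exact: (@Rfubini12 (fun z => Rec (h z)) (cL1_Re hL)).
exact: (@Rfubini12 (fun z => Imc (h z)) (cL1_Im hL)).
Qed.

Lemma cfubini21 (h : T1 * T2 -> R[i]) : cL1 (m1 \x m2) h ->
  cint m2 (fun y => cint m1 (fun x => h (x, y))) = cint (m1 \x m2) h.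
Proof.
move=> hL; rewrite /cint; congr (_ +i* _).
  exact: (@Rfubini21 (fun z => Rec (h z)) (cL1_Re hL)).
exact: (@Rfubini21 (fun z => Imc (h z)) (cL1_Im hL)).
Qed.

Lemma cL1_prod (h : T1 * T2 -> R[i]) : cmfun h ->
  \int[m1]_x \int[m2]_y (normc (h (x, y)))%:E < +oo -> cL1 (m1 \x m2) h.
Proof.
move=> mh hoo; split => //; rewrite fubini_tonelli1//.
- exact: cmfun_enormc.
- by move=> z; rewrite lee_fin normc_ge0.
Qed.

(** A kernel bounded by [1] leaves the tensor product of two integrable functions absolutely
    integrable. With [k] a character this is the exchange behind the multiplication formula. *)
Lemma cint_swap_kernel (f : T1 -> R[i]) (g : T2 -> R[i]) (k : T1 * T2 -> R[i]) :
  cL1 m1 f -> cL1 m2 g -> cmfun k -> (forall z, normc (k z) <= 1)%R ->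
  cint m1 (fun x => cint m2 (fun y => f x * g y * k (x, y)))%R =
  cint m2 (fun y => cint m1 (fun x => f x * g y * k (x, y)))%R.
Proof.
move=> [mf fo] [mg go] mk k1.
pose h z := (f z.1 * g z.2 * k z)%R.
have mh : cmfun h.
  by apply: cmfunM => //; apply: cmfunM; [exact: cmfun_comp measurable_fst mf|
    exact: cmfun_comp measurable_snd mg].
have hL : cL1 (m1 \x m2) h.
  apply: cL1_prod => //.
  have mng : measurable_fun setT (fun y => (normc (g y))%:E) by exact: cmfun_enormc.
  have mnf : measurable_fun setT (fun y => (normc (f y))%:E) by exact: cmfun_enormc.
  have n0 (S : Type) (u : S -> R[i]) x : 0 <= (normc (u x))%:E by rewrite lee_fin normc_ge0.
  apply: (@le_lt_trans _ _ (\int[m1]_x ((normc (f x))%:E * \int[m2]_y (normc (g y))%:E))).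
    apply: ge0_le_integral => //.
    - by move=> x _; apply: integral_ge0.
    - apply: (@measurable_fun_fubini_tonelli_F _ _ _ _ _ m2 (fun z => (normc (h z))%:E)) => //.
      exact: cmfun_enormc.
    - by apply: emeasurable_funM => //; exact: measurable_cst.
    - move=> x _; rewrite -ge0_integralZl//.
      apply: ge0_le_integral => //.
      + exact: cmfun_enormc (cmfun_comp (pair1_measurable x) mh).
      + by apply: emeasurable_funM => //; exact: measurable_cst.
      + move=> y _; rewrite -EFinM lee_fin /h /= Normc.normcM Normc.normcM.
        by rewrite ler_piMr// mulr_ge0 ?normc_ge0.
  rewrite ge0_integralZr//; last by apply: integral_ge0.
  by apply: lte_mul_pinfty => //; [exact: integral_ge0|rewrite ge0_fin_numE// integral_ge0].
by rewrite (cfubini12 hL) -(cfubini21 hL).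
Qed.

End fubini.

(** * Measure-preserving changes of variables *)

Section change_of_variables.
Context {R : realType} d (T : measurableType d) (mu : {measure set T -> \bar R}).
Context (phi : T -> T) (mphi : measurable_fun setT phi).
Context (phiE : forall A, measurable A -> mu (phi @^-1` A) = mu A).
Local Open Scope ereal_scope.

Lemma ge0_integral_invariant (f : T -> \bar R) : measurable_fun setT f ->
  (forall x, 0 <= f x) -> \int[mu]_x f (phi x) = \int[mu]_x f x.
Proof.
move=> mf f0; have := ge0_integral_pushforward mphi mu measurableT mf.
rewrite preimage_setT => <- //.
by apply: eq_measure_integral => A mA _; rewrite -phiE.
Qed.

Lemma integral_invariant (f : T -> \bar R) : measurable_fun setT f ->
  \int[mu]_x f (phi x) = \int[mu]_x f x.
Proof.
move=> mf; rewrite [RHS]integralE [LHS]integralE -[fun _ => f _]/(f \o phi).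
rewrite funepos_comp funeneg_comp /comp.
by rewrite !ge0_integral_invariant//; [exact: measurable_funeneg|exact: measurable_funepos].
Qed.

Lemma cint_invariant (f : T -> R[i]) : cmfun f -> cint mu (fun x => f (phi x)) = cint mu f.
Proof.
move=> [fr fi]; rewrite /cint /Rintegral.
rewrite (integral_invariant (f := fun x => (Rec (f x))%:E)); last exact/measurable_EFinP.
by rewrite (integral_invariant (f := fun x => (Imc (f x))%:E)); last exact/measurable_EFinP.
Qed.

Lemma L2n_invariant (f : T -> R[i]) : cmfun f -> L2n mu (fun x => f (phi x)) = L2n mu f.
Proof.
move=> mf; rewrite !L2nE /n2.
rewrite (ge0_integral_invariant (f := fun x => (normc (f x) ^+ 2)%:E))//.
  exact: cmfun_n2.
by move=> x; rewrite lee_fin sqr_ge0.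
Qed.

Lemma cL1_invariant (f : T -> R[i]) : cL1 mu f -> cL1 mu (fun x => f (phi x)).
Proof.
move=> [mf fo]; split; first exact: cmfun_comp.
rewrite (ge0_integral_invariant (f := fun x => (normc (f x))%:E))//.
  exact: cmfun_enormc.
by move=> x; rewrite lee_fin normc_ge0.
Qed.

Lemma cL2_invariant (f : T -> R[i]) : cL2 mu f -> cL2 mu (fun x => f (phi x)).
Proof. by move=> [mf fo]; split; [exact: cmfun_comp|rewrite L2n_invariant]. Qed.

Lemma ae_invariant (P : T -> Prop) : {ae mu, forall x, P x} ->
  {ae mu, forall x, P (phi x)}.
Proof.
move=> [N [mN N0 hN]]; exists (phi @^-1` N); split.
- by rewrite -[_ @^-1` _]setTI; exact: mphi.
- by rewrite -N0; exact: phiE.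
- by move=> x /= hx; exact: hN.
Qed.

End change_of_variables.

Notation plane R := (measurableTypeR R * measurableTypeR R)%type.

(** * Lebesgue measure on the plane, its translations and reflections *)

Section plane.
Context {R : realType}.
Local Notation leb := (@lebesgue_measure R).
Local Open Scope ereal_scope.

Lemma leb2_rect (A B : set (measurableTypeR R)) : measurable A -> measurable B ->
  leb2 (A `*` B) = leb A * leb B.
Proof. by move=> mA mB; exact: product_measure1E. Qed.

(** The squares of [fourier_trunc], which serve also as a sigma-finite exhaustion. *)
Definition box (n : nat) : set (plane R) :=
  `[(- n%:R)%R, n%:R%R]%classic `*` `[(- n%:R)%R, n%:R%R]%classic.

Lemma measurable_box n : measurable (box n).
Proof. by apply: measurableX; exact: measurable_itv. Qed.

Lemma leb2_box_lty n : leb2 (box n) < +oo.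
Proof.
rewrite /box leb2_rect; [|exact: measurable_itv..].
by rewrite lebesgue_measure_itv/=; case: ifP => _; rewrite ?mul0e// -EFinD -EFinM ltry.
Qed.

Lemma leb2_sigma_finite : sigma_finite setT (@leb2 R).
Proof.
exists box; last by move=> n; split; [exact: measurable_box|exact: leb2_box_lty].
apply/seteqP; split => // x _.
pose m : R := Num.max `|(x.1 : R)|%R `|(x.2 : R)|%R.
have h : (m < (Num.bound m)%:R)%R by apply: archi_boundP; rewrite le_max normr_ge0.
exists (Num.bound m) => //.
by split; rewrite /= in_itv/= -ler_norml; apply: ltW; apply: le_lt_trans h;
  rewrite le_max lexx ?orbT.
Qed.

(** Fubini's theorem asks for a sigma-finite structure, which the type of [leb2] does not carry.
    Packing it onto the same function keeps the two measures convertible. *)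
Definition sleb2 : {sigma_finite_measure set (plane R) -> \bar R} :=
  let s := @Measure_isSigmaFinite.Build _ _ _ (@leb2 R) leb2_sigma_finite in
  HB.pack (Measure.sort (@leb2 R)) (Measure.class (@leb2 R)) s.

(** The translated measure gives half-open intervals their length, and this characterizes Lebesgue
    measure. *)
Lemma leb_shift (a : R) (A : set (measurableTypeR R)) : measurable A ->
  leb ((fun x => (x + a)%R) @^-1` A) = leb A.
Proof.
have mphi : measurable_fun setT (fun x : measurableTypeR R => (x + a)%R : measurableTypeR R).
  by apply: measurable_funD.
move=> mA; have := @lebesgue_measure_unique R
  (pushforward leb (fun x : measurableTypeR R => (x + a)%R : measurableTypeR R)).
rewrite /pushforward /= => /(_ mphi) h; rewrite [RHS]h//.
move=> _ [[b c] _ <-] /=.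
rewrite [X in _ = leb X](_ : _ = `](b - a)%R, (c - a)%R]%classic).
  rewrite !lebesgue_measure_itv/= !lte_fin ltrBrDr subrK.
  by case: ifP => // _; rewrite -!EFinD; congr EFin; ring.
by apply/seteqP; split=> x /=; rewrite !in_itv/= ltrBlDr lerBrDr.
Qed.

Lemma leb_opp (A : set (measurableTypeR R)) : measurable A ->
  leb (-%R @^-1` A) = leb A.
Proof. by move=> mA; exact: lebesgue_measureN. Qed.

Section product_maps.
Context (u v : measurableTypeR R -> measurableTypeR R).
Context (mu : measurable_fun setT u) (mv : measurable_fun setT v).
Context (uE : forall A, measurable A -> leb (u @^-1` A) = leb A).
Context (vE : forall A, measurable A -> leb (v @^-1` A) = leb A).

Lemma measurable_product_map :
  measurable_fun setT (fun x : plane R => (u x.1, v x.2) : plane R).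
Proof.
by apply: measurable_fun_pair; [exact: (measurableT_comp mu)|exact: (measurableT_comp mv)].
Qed.

(** Agreement on measurable rectangles determines the product measure. Reflection and translation of
    the plane both act coordinate by coordinate, so both follow from the line. *)
Lemma leb2_product_map (A : set (plane R)) : measurable A ->
  leb2 ((fun x : plane R => (u x.1, v x.2) : plane R) @^-1` A) = leb2 A.
Proof.
move=> mA.
have mp := measurable_product_map.
pose phi := (fun x : plane R => (u x.1, v x.2) : plane R).
apply/esym; apply: (@product_measure_unique _ _ _ _ R leb leb (pushforward leb2 phi)) => //.
move=> B C mB mC; rewrite /pushforward.
change (leb2 ((u @^-1` B) `*` (v @^-1` C)) = leb B * leb C).
rewrite leb2_rect; [by rewrite uE// vE| |].
  by rewrite -[_ @^-1` _]setTI; exact: mu.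
by rewrite -[_ @^-1` _]setTI; exact: mv.
Qed.

End product_maps.

Lemma measurable_plane_opp : measurable_fun setT (fun x : plane R => (- x)%R : plane R).
Proof. by apply: (@measurable_product_map -%R -%R). Qed.

Lemma leb2_opp (A : set (plane R)) : measurable A ->
  leb2 ((fun x : plane R => (- x)%R : plane R) @^-1` A) = leb2 A.
Proof. by apply: (@leb2_product_map -%R -%R) => //; exact: leb_opp. Qed.

Lemma measurable_plane_shift (a : plane R) :
  measurable_fun setT (fun x : plane R => (x + a)%R : plane R).
Proof.
by apply: (@measurable_product_map (fun t => t + a.1)%R (fun t => t + a.2)%R);
  apply: measurable_funD.
Qed.

Lemma leb2_shift (a : plane R) (A : set (plane R)) : measurable A ->
  leb2 ((fun x : plane R => (x + a)%R : plane R) @^-1` A) = leb2 A.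
Proof.
by apply: (@leb2_product_map (fun t => t + a.1)%R (fun t => t + a.2)%R);
  [apply: measurable_funD|apply: measurable_funD|exact: leb_shift|exact: leb_shift].
Qed.

Lemma measurable_plane_subr (a : plane R) :
  measurable_fun setT (fun x : plane R => (a - x)%R : plane R).
Proof.
rewrite (_ : (fun x => _) = (fun x => - x + a)%R); last by apply/funext => x; rewrite addrC.
exact: (measurableT_comp (measurable_plane_shift a) measurable_plane_opp).
Qed.

Lemma leb2_subr (a : plane R) (A : set (plane R)) : measurable A ->
  leb2 ((fun x : plane R => (a - x)%R : plane R) @^-1` A) = leb2 A.
Proof.
move=> mA; pose B := (fun x : plane R => (x + a)%R : plane R) @^-1` A.
have mB : measurable B by rewrite -[B]setTI; exact: measurable_plane_shift.
rewrite -[RHS](leb2_shift a mA) -[RHS](leb2_opp mB).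
by apply: (congr1 (fun E => leb2 E)); apply/funext => x /=; rewrite addrC.
Qed.

Lemma measurable_plane_sub2 :
  measurable_fun setT (fun z : plane R * plane R => (z.1 - z.2)%R : plane R).
Proof.
have m1 : measurable_fun setT (fun z : plane R * plane R => (z.1 : plane R)) by exact: measurable_fst.
have m2 : measurable_fun setT (fun z : plane R * plane R => (z.2 : plane R)) by exact: measurable_snd.
apply: (@measurable_fun_pair _ _ _ _ _ _ (fun z : plane R * plane R => z.1.1 - z.2.1)%R
  (fun z : plane R * plane R => z.1.2 - z.2.2)%R); apply: measurable_funB.
- exact: measurableT_comp measurable_fst m1.
- exact: measurableT_comp measurable_fst m2.
- exact: measurableT_comp measurable_snd m1.
- exact: measurableT_comp measurable_snd m2.
Qed.

End plane.

(** * Young's inequality *)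

(** The squared form, in the extended reals, is free of roots and survives infinite integrals. *)
Lemma ge0_cauchy_schwarz {R : realType} d (T : measurableType d)
    (mu : {measure set T -> \bar R}) (a b : T -> R) :
  measurable_fun setT a -> measurable_fun setT b ->
  (forall x, 0 <= a x) -> (forall x, 0 <= b x) ->
  ((\int[mu]_x (a x * b x)%:E) * (\int[mu]_x (a x * b x)%:E) <=
   (\int[mu]_x (a x ^+ 2)%:E) * (\int[mu]_x (b x ^+ 2)%:E))%E.
Proof.
move=> ma mb a0 b0.
have := L2n_CS mu (cmfunR ma) (cmfunR mb); rewrite !L2nE.
have nE (u : T -> R) : n2 mu (fun x => (u x)%:C) = (\int[mu]_x (u x ^+ 2)%:E)%E.
  by apply: eq_integral => x _; rewrite normcR real_normK ?num_real.
rewrite !nE (_ : (\int[mu]_x _ = \int[mu]_x (a x * b x)%:E)%E); last first.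
  by apply: eq_integral => x _; rewrite Normc.normcM !normcR !ger0_norm.
set A := (\int[mu]_x (a x ^+ 2)%:E)%E; set B := (\int[mu]_x (b x ^+ 2)%:E)%E.
have A0 : (0 <= A)%E by apply: integral_ge0 => x _; rewrite lee_fin sqr_ge0.
have B0 : (0 <= B)%E by apply: integral_ge0 => x _; rewrite lee_fin sqr_ge0.
have I0 : (0 <= \int[mu]_x (a x * b x)%:E)%E.
  by apply: integral_ge0 => x _; rewrite lee_fin mulr_ge0.
have sq (z : \bar R) : (0 <= z)%E -> (z `^ 2^-1 * z `^ 2^-1 = z)%E.
  case: z => [r|_|]//; last by rewrite poweRyr ?invr_eq0// mulyy.
  by rewrite poweR_EFin lee_fin => r0; rewrite powR12_sqrt// -EFinM -expr2 sqr_sqrtr.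
move=> h; have := lee_pmul I0 I0 h h.
by move=> /le_trans; apply; rewrite muleACA sq// sq.
Qed.

Section young.
Context {R : realType}.
Implicit Types (k f : plane R -> R) (h : plane R * plane R -> R[i]).
Local Open Scope ereal_scope.

Lemma tonelli2 (f : plane R * plane R -> \bar R) : measurable_fun setT f ->
  (forall z, 0 <= f z) ->
  \int[leb2]_x \int[leb2]_y f (x, y) = \int[leb2]_y \int[leb2]_x f (x, y).
Proof.
by move=> mf f0; exact: (@fubini_tonelli _ _ _ _ R sleb2 sleb2 f mf f0).
Qed.

Lemma measurable_int_snd (f : plane R * plane R -> \bar R) : measurable_fun setT f ->
  measurable_fun setT (fun x => \int[leb2]_y f (x, y)).
Proof. exact: (@measurable_integral_snd _ _ _ _ _ sleb2). Qed.

(** Cauchy-Schwarz for the splitting [k * f = sqrt k * (sqrt k * f)] bounds the square of the inner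
    integral by the mass of [k] times the integral of [k (x - y) * f y ^+ 2]. Tonelli and
    translation invariance then produce the second factor of the mass. *)
Lemma young_ge0 k f : measurable_fun setT k -> measurable_fun setT f ->
  (forall x, 0 <= k x)%R -> (forall x, 0 <= f x)%R ->
  \int[leb2]_x ((\int[leb2]_y (k (x - y) * f y)%:E) *
                (\int[leb2]_y (k (x - y) * f y)%:E)) <=
  (\int[leb2]_x (k x)%:E * \int[leb2]_x (k x)%:E) * \int[leb2]_x (f x ^+ 2)%:E.
Proof.
move=> mk mf k0 f0.
have mks : measurable_fun setT (fun z : plane R * plane R => k (z.1 - z.2)%R).
  exact: (measurableT_comp mk measurable_plane_sub2).
have mf2 : measurable_fun setT (fun z : plane R * plane R => f z.2).
  exact: (measurableT_comp mf measurable_snd).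
have mkx (x : plane R) : measurable_fun setT (fun y : plane R => k (x - y)%R).
  exact: (measurableT_comp mk (measurable_plane_subr x)).
set K := \int[leb2]_x (k x)%:E; set F := \int[leb2]_x (f x ^+ 2)%:E.
have K0 : 0 <= K by apply: integral_ge0 => x _; rewrite lee_fin.
have F0 : 0 <= F by apply: integral_ge0 => x _; rewrite lee_fin sqr_ge0.
have kx (x : plane R) : \int[leb2]_y (k (x - y)%R)%:E = K.
  apply: (ge0_integral_invariant (measurable_plane_subr x) (leb2_subr x)
    (f := fun y => (k y)%:E)) => //.
  exact/measurable_EFinP.
have mkf2 : measurable_fun setT
    (fun z : plane R * plane R => (k (z.1 - z.2)%R * f z.2 ^+ 2)%:E).
  by apply/measurable_EFinP/measurable_funM => //; exact: measurable_funX.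
have mI2 := measurable_int_snd mkf2.
have mI : measurable_fun setT (fun x : plane R => \int[leb2]_y (k (x - y) * f y)%:E).
  apply: (measurable_int_snd (f := fun z => (k (z.1 - z.2)%R * f z.2)%:E)).
  by apply/measurable_EFinP/measurable_funM.
have I0 (x : plane R) : 0 <= \int[leb2]_y (k (x - y) * f y)%:E.
  by apply: integral_ge0 => y _; rewrite lee_fin mulr_ge0.
have J0 (x : plane R) : 0 <= \int[leb2]_y (k (x - y) * f y ^+ 2)%:E.
  by apply: integral_ge0 => y _; rewrite lee_fin mulr_ge0// sqr_ge0.
apply: (@le_trans _ _ (\int[leb2]_x (K * \int[leb2]_y (k (x - y) * f y ^+ 2)%:E))).
  apply: ge0_le_integral; first exact: measurableT.
  - by move=> x _; rewrite mule_ge0.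
  - exact: emeasurable_funM.
  - by apply: emeasurable_funM => //; exact: measurable_cst.
  - move=> x _; rewrite -(kx x).
    have ms : measurable_fun setT (fun y : plane R => Num.sqrt (k (x - y)%R)).
      by apply: measurableT_comp (mkx x) => //; apply: continuous_measurable_fun;
        exact: sqrt_continuous.
    have := @ge0_cauchy_schwarz R _ _ leb2 (fun y : plane R => Num.sqrt (k (x - y)%R))
      (fun y : plane R => Num.sqrt (k (x - y)%R) * f y)%R ms (measurable_funM ms mf)
      (fun y => sqrtr_ge0 _) (fun y => mulr_ge0 (sqrtr_ge0 _) (f0 y)).
    under eq_integral do rewrite mulrA -expr2 sqr_sqrtr//.
    under [X in _ <= X * _]eq_integral do rewrite sqr_sqrtr//.
    by under [X in _ <= _ * X]eq_integral do rewrite exprMn sqr_sqrtr//.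
rewrite ge0_integralZl//.
rewrite -muleA; apply: lee_wpmul2l => //.
rewrite (tonelli2 mkf2); last by move=> z; rewrite lee_fin mulr_ge0// sqr_ge0.
rewrite le_eqVlt; apply/orP; left; apply/eqP.
rewrite /F -ge0_integralZl//; last 2 first.
- by apply/measurable_EFinP/measurable_funX.
- by move=> y _; rewrite lee_fin sqr_ge0.
apply: eq_integral => y _ /=.
under eq_integral do rewrite EFinM.
rewrite ge0_integralZr//; last by rewrite lee_fin sqr_ge0.
  congr (_ * _); apply: (ge0_integral_invariant (measurable_plane_shift (- y)%R)
    (leb2_shift (- y)%R) (f := fun y => (k y)%:E)) => //.
  exact/measurable_EFinP.
by apply/measurable_EFinP; exact: (measurableT_comp mk (measurable_plane_shift (- y)%R)).
by move=> x _; rewrite lee_fin.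
Qed.

(* The bound survives without integrability of the slices, because [cint] is
   then bounded by an infinite integral. *)
Lemma le_normc_cint_dom d (T : measurableType d) (mu : {measure set T -> \bar R})
    (u : T -> R[i]) (w : T -> R) : cmfun u -> measurable_fun setT w ->
  (forall x, normc (u x) <= w x)%R ->
  (normc (cint mu u))%:E <= \int[mu]_x (w x)%:E.
Proof.
move=> mu_ mw uw.
have le : \int[mu]_x (normc (u x))%:E <= \int[mu]_x (w x)%:E.
  apply: ge0_le_integral => //.
  - by move=> x _; rewrite lee_fin normc_ge0.
  - exact: cmfun_enormc.
  - exact/measurable_EFinP.
  - by move=> x _; rewrite lee_fin.
have [fo|] := ltP (\int[mu]_x (normc (u x))%:E) +oo.
  have uL : cL1 mu u by split.
  exact: le_trans (le_normc_cint uL) le.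
by move=> h; rewrite (le_trans _ (le_trans h le)) ?leey.
Qed.

Section kernel_operator.
Context (h : plane R * plane R -> R[i]) (k f : plane R -> R) (a b : R).
Context (mh : cmfun h) (mk : measurable_fun setT k) (mf : measurable_fun setT f).
Context (k0 : forall x, (0 <= k x)%R) (f0 : forall x, (0 <= f x)%R).
Context (hkf : forall x y, (normc (h (x, y)) <= k (x - y) * f y)%R).
Context (a0 : (0 <= a)%R) (b0 : (0 <= b)%R).
Context (ka : \int[leb2]_x (k x)%:E <= a%:E).
Context (fb : \int[leb2]_x (f x ^+ 2)%:E <= (b ^+ 2)%:E).

Let J (x : plane R) := \int[leb2]_y (k (x - y) * f y)%:E.

Let mJ : measurable_fun setT J.
Proof.
apply: (measurable_int_snd (f := fun z => (k (z.1 - z.2)%R * f z.2)%:E)).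
apply/measurable_EFinP/measurable_funM.
  exact: (measurableT_comp mk measurable_plane_sub2).
exact: (measurableT_comp mf measurable_snd).
Qed.

Let J0 (x : plane R) : 0 <= J x.
Proof. by apply: integral_ge0 => y _; rewrite lee_fin mulr_ge0. Qed.

Let mkf (x : plane R) : measurable_fun setT (fun y : plane R => k (x - y) * f y)%R.
Proof.
by apply: measurable_funM => //; exact: (measurableT_comp mk (measurable_plane_subr x)).
Qed.

Lemma young_integral_sqr : \int[leb2]_x (J x * J x) <= ((a * b) ^+ 2)%:E.
Proof.
apply: le_trans (young_ge0 mk mf k0 f0) _.
have K0 : 0 <= \int[leb2]_x (k x)%:E by apply: integral_ge0 => x _; rewrite lee_fin.
rewrite exprMn EFinM; apply: lee_pmul => //.
- by rewrite mule_ge0.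
- by apply: integral_ge0 => x _; rewrite lee_fin sqr_ge0.
- by rewrite expr2 EFinM; apply: lee_pmul.
Qed.

Lemma cmfun_kernel_operator : cmfun (fun x => cint leb2 (fun y => h (x, y))).
Proof. exact: (@cmfun_cint_snd _ _ _ _ _ sleb2). Qed.

(** The kernel [h] need not be a convolution: domination by one suffices, which is the situation of
    the commutator kernel. *)
Lemma young : L2n leb2 (fun x => cint leb2 (fun y => h (x, y))) <= (a * b)%:E.
Proof.
rewrite L2n_le_fin ?mulr_ge0//; apply: le_trans young_integral_sqr.
apply: ge0_le_integral => //.
- by move=> x _; rewrite lee_fin sqr_ge0.
- exact: cmfun_n2 cmfun_kernel_operator.
- exact: emeasurable_funM.
- move=> x _; rewrite expr2 EFinM.
  have hx : (normc (cint leb2 (fun y => h (x, y))))%:E <= J x.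
    apply: le_normc_cint_dom => //.
    exact: (cmfun_comp (pair1_measurable x) mh).
  by apply: lee_pmul => //; rewrite lee_fin normc_ge0.
Qed.

(** [J] has an integrable square, hence is finite almost everywhere; it majorizes the norms of the
    slices of [h]. *)
Lemma young_dom_ae : {ae leb2, forall x, J x < +oo}.
Proof.
have : leb2.-integrable setT (fun x => J x * J x).
  apply/integrableP; split; first exact: emeasurable_funM.
  under eq_integral do rewrite gee0_abs ?mule_ge0//.
  by apply: le_lt_trans young_integral_sqr _; rewrite ltry.
move=> /(integrable_ae measurableT); apply: filterS => x /(_ I).
by have := J0 x; case: (J x) => // r _ _; rewrite ltry.
Qed.

Lemma young_ae : {ae leb2, forall x, cL1 leb2 (fun y => h (x, y))}.
Proof.
apply: filterS young_dom_ae => x Ix.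
apply: (@cL1_le _ _ _ _ _ (fun y : plane R => (k (x - y) * f y)%:E)) => //.
- exact: (cmfun_comp (pair1_measurable x) mh).
- by move=> y; rewrite lee_fin.
- exact/measurable_EFinP.
Qed.

End kernel_operator.

End young.

(** * Poisson kernels *)

Section line_integrals.
Context {R : realType}.
Local Notation leb := (@lebesgue_measure R).

(** Evenness reduces the integral to the half line, so [F] has to be a primitive only where [|x|] is
    [x]. *)
Lemma even_integral (f F : R -> R) (l : R) : (forall x, 0 <= f x) -> continuous f ->
  (forall x, f (- x) = f x) -> (forall x : R, 0 <= x -> is_derive x 1 F (f x)) ->
  F x @[x --> +oo] --> l -> (\int[leb]_x (f x)%:E = (2 * (l - F 0))%:E)%E.
Proof.
move=> f0 cf fN F' Fl.
rewrite ge0_symfun_integralT//; last by move=> x /=; rewrite fN.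
rewrite -set_itvcy (@ge0_continuous_FTC2y _ f F 0 l) ?EFinM ?EFinB//.
- exact: continuous_subspaceT.
- by move=> x x0; have [] := F' x (ltW x0).
- apply: cvg_at_right_filter; apply: differentiable_continuous.
  by apply/derivable1_diffP; have [] := F' 0 (lexx _).
- move=> x; rewrite in_itv/= andbT => x0; rewrite derive1E.
  by have [_ ->] := F' x (ltW x0).
Qed.

Lemma integral_poisson (e : R) : 0 < e ->
  (\int[leb]_x (e / (e ^+ 2 + x ^+ 2))%:E = pi%:E)%E.
Proof.
move=> e0.
have d0 (x : R) : 0 < e ^+ 2 + x ^+ 2 by rewrite ltr_pwDl// ?exprn_gt0// sqr_ge0.
have h (x : R) : is_derive x 1 (fun y : R => y / e) (e^-1).
  have -> : (fun y : R => y / e) = (e^-1 *: id).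
    by apply/funext => y; rewrite /= mulrC.
  apply: is_derive_eq; exact: mulr1.
have dF (x : R) : 0 <= x -> is_derive x 1 (fun x => atan (x / e)) (e / (e ^+ 2 + x ^+ 2)).
  move=> _; have := @is_derive1_comp _ _ (fun y : R => y / e) x _ _ (is_derive1_atan (x / e)) (h x).
  move=> dF; apply: is_derive_eq.
  by have := d0 x => ?; field; rewrite !gt_eqF.
have cF : continuous (fun x : R => e / (e ^+ 2 + x ^+ 2)).
  move=> x; apply: cvgM; first exact: cvg_cst.
  apply: cvgV; first by rewrite gt_eqF.
  apply: cvgD; first exact: cvg_cst.
  exact: exprn_continuous.
have lF : atan (x / e) @[x --> +oo] --> pi / 2.
  apply: (cvg_comp _ _ _ (@cvgy_atan R)).
  by apply: gt0_cvgMly; rewrite ?invr_gt0.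
rewrite (even_integral _ cF _ dF lF).
- by rewrite mul0r atan0 subr0 mulrC divfK// pnatr_eq0.
- by move=> x; rewrite divr_ge0// ltW.
- by move=> x; rewrite sqrrN.
Qed.

Lemma is_derive_mull (c t : R) : is_derive t 1 (fun y : R => c * y) c.
Proof.
have -> : (fun y : R => c * y) = (c *: id) by [].
by apply: is_derive_eq; exact: mulr1.
Qed.

(** The summand [1] keeps the integrand nonnegative, as [even_integral] requires; its contribution
    [2 / e] is the case [x = 0] halved, and is subtracted later. *)
Lemma integral_exp_cos (e x : R) : 0 < e ->
  (\int[leb]_t (expR (- (e * `|t|)) * (1 + cos (x * t)))%:E =
   (2 * (e^-1 + e / (e ^+ 2 + x ^+ 2)))%:E)%E.
Proof.
move=> e0.
have D0 : 0 < e ^+ 2 + x ^+ 2 by rewrite ltr_pwDl// ?exprn_gt0// sqr_ge0.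
set D := _ + _ in D0 *.
have dE (t : R) : is_derive t 1 (fun t => expR (- e * t)) (- e * expR (- e * t)).
  have := @is_derive1_comp _ _ (fun y : R => - e * y) t _ _ (is_derive_expR _)
    (is_derive_mull (- e) t).
  by move=> h; apply: is_derive_eq; rewrite mulrC.
have dS (t : R) : is_derive t 1 (fun t => sin (x * t)) (x * cos (x * t)).
  have := @is_derive1_comp _ _ (fun y : R => x * y) t _ _ (is_derive_sin _)
    (is_derive_mull x t).
  by move=> h; apply: is_derive_eq; rewrite mulrC.
have dC (t : R) : is_derive t 1 (fun t => cos (x * t)) (- x * sin (x * t)).
  have := @is_derive1_comp _ _ (fun y : R => x * y) t _ _ (is_derive_cos _)
    (is_derive_mull x t).
  by move=> h; apply: is_derive_eq; rewrite mulrC mulrN mulNr.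
(* Times [exp (- e t)], this is the elementary primitive of [exp (- e t) * cos (x t)] plus that of
   [exp (- e t)]. *)
pose G : R -> R := (x / D) *: (fun t => sin (x * t)) - (e / D) *: (fun t => cos (x * t))
  - cst e^-1.
pose F : R -> R := (fun t => expR (- e * t)) * G.
have GE t : G t = (x / D) * sin (x * t) - (e / D) * cos (x * t) - e^-1 by [].
have dF (t : R) : 0 <= t -> is_derive t 1 F (expR (- (e * `|t|)) * (1 + cos (x * t))).
  move=> t0; rewrite /F /G; apply: is_derive_eq.
  rewrite -/G ger0_norm// mulNr.
  rewrite -[LHS]/(expR (- (e * t)) * ((x / D) * (x * cos (x * t)) -
    (e / D) * (- x * sin (x * t)) - 0) + G t * (- e * expR (- (e * t)))) GE.
  rewrite /D; field.
  by rewrite !gt_eqF.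
have lF : F x @[x --> +oo] --> 0.
  pose K := `|x / D| + `|e / D| + e^-1.
  have K0 : 0 <= K by rewrite !addr_ge0// invr_ge0 ltW.
  have cE : K * expR (- (e * t)) @[t --> +oo] --> 0.
    rewrite -(mulr0 K); apply: cvgM; first exact: cvg_cst.
    apply: (cvg_comp _ _ _ (@cvgr_expR R)).
    by apply: gt0_cvgMry.
  have FK t : `|F t| <= K * expR (- (e * t)).
    rewrite -[F t]/(expR (- e * t) * G t) normrM ger0_norm ?expR_ge0// mulNr mulrC.
    rewrite ler_wpM2r ?expR_ge0// GE.
    apply: le_trans (ler_normB _ _) _; apply: lerD; last by rewrite ger0_norm// invr_ge0 ltW.
    apply: le_trans (ler_normB _ _) _; apply: lerD; rewrite normrM ler_piMr//.
      by rewrite ler_norml sin_geN1 sin_le1.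
    by rewrite ler_norml cos_geN1 cos_le1.
  apply: norm_cvg0; apply: (squeeze_cvgr _ (cvg_cst 0) cE); apply: nearW => t.
  by rewrite normr_ge0 FK.
have cf : continuous (fun t : R => expR (- (e * `|t|)) * (1 + cos (x * t))).
  move=> t; apply: cvgM.
    apply: (cvg_comp (fun t : R => - (e * `|t|)) expR _ (@continuous_expR R _)).
    apply: cvgN; apply: cvgM; first exact: cvg_cst.
    exact: norm_continuous.
  apply: cvgD; first exact: cvg_cst.
  apply: (cvg_comp (fun t : R => x * t) cos _ (@continuous_cos R _)).
  by apply: cvgM; [exact: cvg_cst|exact: cvg_id].
rewrite (even_integral _ cf _ dF lF).
- congr (_%:E); rewrite -[F 0]/(expR (- e * 0) * G 0) GE !mulr0 sin0 cos0 expR0.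
  by rewrite /D; field; rewrite !gt_eqF.
- by move=> t; rewrite mulr_ge0 ?expR_ge0// -lerBlDl sub0r cos_geN1.
- by move=> t; rewrite normrN mulrN cosN.
Qed.

Lemma integral_poisson_itv (e a b x : R) : 0 < e -> a < b ->
  (\int[leb]_(y in `[a, b]) (e / (e ^+ 2 + (x + y) ^+ 2))%:E =
   (atan ((x + b) / e) - atan ((x + a) / e))%:E)%E.
Proof.
move=> e0 ab.
have d0 (y : R) : 0 < e ^+ 2 + (x + y) ^+ 2 by rewrite ltr_pwDl// ?exprn_gt0// sqr_ge0.
have h (y : R) : is_derive y 1 (fun y : R => (x + y) / e) (e^-1).
  have dm := is_derive_mull e^-1 y.
  have -> : (fun y : R => (x + y) / e) = cst (x / e) + (fun z : R => e^-1 * z).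
    by apply/funext => z; rewrite mulrDl [z / e]mulrC.
  by apply: is_derive_eq; rewrite add0r.
have dF (y : R) : is_derive y 1 (fun y => atan ((x + y) / e)) (e / (e ^+ 2 + (x + y) ^+ 2)).
  have := @is_derive1_comp _ _ (fun y : R => (x + y) / e) y _ _
    (is_derive1_atan ((x + y) / e)) (h y).
  move=> dF; apply: is_derive_eq.
  by have := d0 y => ?; field; rewrite !gt_eqF.
have cF : continuous (fun y : R => e / (e ^+ 2 + (x + y) ^+ 2)).
  move=> y; apply: cvgM; first exact: cvg_cst.
  apply: cvgV; first by rewrite gt_eqF.
  apply: cvgD; first exact: cvg_cst.
  apply: (cvg_comp (fun y => x + y) (fun z => z ^+ 2) _ (@exprn_continuous R 2 _)).
  by apply: cvgD; [exact: cvg_cst|exact: cvg_id].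
have cA : continuous (fun y : R => atan ((x + y) / e)).
  move=> y; apply: differentiable_continuous; apply/derivable1_diffP.
  by have [] := dF y.
rewrite (@continuous_FTC2 _ _ (fun y => atan ((x + y) / e)) a b ab).
- by rewrite EFinB.
- exact: continuous_subspaceT.
- split.
  + by move=> y _; have [] := dF y.
  + by apply: cvg_at_right_filter; exact: cA.
  + by apply: cvg_at_left_filter; exact: cA.
- by move=> y _; rewrite derive1E; have [_ ->] := dF y.
Qed.

(** The primitive is [- (1 + x)^(1 - s) / (s - 1)], its power spelled out as an exponential of a
    logarithm for the chain rule. *)
Lemma integral_decay_lty (s : R) : 1 < s ->
  (\int[leb]_x ((1 + `|x|) `^ (- s))%:E < +oo)%E.
Proof.
move=> s1.
have p0 (x : R) : 0 < 1 + `|x| by rewrite ltr_pwDl.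
have dF (x : R) : 0 <= x ->
    is_derive x 1 (fun x => - (s - 1)^-1 * expR (- (s - 1) * ln (1 + x))) ((1 + `|x|) `^ (- s)).
  move=> x0; have x1 : 0 < 1 + x by rewrite ltr_pwDl.
  have d1 : is_derive x 1 (fun y : R => 1 + y) 1.
    have -> : (fun y : R => 1 + y) = cst 1 + id by [].
    by apply: is_derive_eq; rewrite add0r.
  have d2 := @is_derive1_comp _ _ (fun y : R => 1 + y) x _ _ (is_derive1_ln x1) d1.
  have d3 := @is_derive1_comp _ _ (fun y : R => ln (1 + y)) x _ _
    (is_derive_mull (- (s - 1)) _) d2.
  have d4 := @is_derive1_comp _ _ (fun y : R => - (s - 1) * ln (1 + y)) x _ _
    (is_derive_expR _) d3.
  have d5 := @is_derive1_comp _ _ (fun y : R => expR (- (s - 1) * ln (1 + y))) x _ _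
    (is_derive_mull (- (s - 1)^-1) _) d4.
  apply: is_derive_eq; rewrite ger0_norm// /powR gt_eqF//.
  have -> : - s * ln (1 + x) = - (s - 1) * ln (1 + x) - ln (1 + x) by ring.
  rewrite expRD expRN lnK ?posrE//.
  by field; rewrite !gt_eqF// subr_gt0.
have lF : - (s - 1)^-1 * expR (- (s - 1) * ln (1 + x)) @[x --> +oo] --> - (s - 1)^-1 * 0.
  apply: cvgM; first exact: cvg_cst.
  under eq_fun do rewrite mulNr.
  apply: (cvg_comp _ _ _ (@cvgr_expR R)).
  apply: gt0_cvgMry; first by rewrite subr_gt0.
  apply/cvgryPge => A; near=> x.
  rewrite -[A]expRK ler_ln ?posrE ?expR_gt0//.
    by rewrite -lerBlDl; near: x; exact: nbhs_pinfty_ge.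
  by rewrite ltr_pwDl//; near: x; exact: nbhs_pinfty_ge.
have cf : continuous (fun x : R => (1 + `|x|) `^ (- s)).
  move=> x; rewrite (_ : (fun x => _) = (fun x => expR (- s * ln (1 + `|x|)))); last first.
    by apply/funext => y; rewrite /powR gt_eqF.
  apply: (cvg_comp (fun x : R => - s * ln (1 + `|x|)) expR _ (@continuous_expR R _)).
  apply: cvgM; first exact: cvg_cst.
  apply: (cvg_comp (fun x : R => 1 + `|x|) (@ln R) _ (continuous_ln (p0 x))).
  by apply: cvgD; [exact: cvg_cst|exact: norm_continuous].
rewrite (even_integral _ cf _ dF lF) ?ltry// => x; rewrite ?normrN//; exact: powR_ge0.
Unshelve. all: by end_near. Qed.

End line_integrals.

Section product_integrals.
Context {R : realType} d1 d2 (T1 : measurableType d1) (T2 : measurableType d2).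
Context (m1 : {sigma_finite_measure set T1 -> \bar R}).
Context (m2 : {sigma_finite_measure set T2 -> \bar R}).

Lemma ge0_integral_prod (a : T1 -> R) (b : T2 -> R) : measurable_fun setT a ->
  measurable_fun setT b -> (forall x, 0 <= a x) -> (forall x, 0 <= b x) ->
  (\int[m1 \x m2]_z (a z.1 * b z.2)%:E =
   (\int[m1]_x (a x)%:E) * (\int[m2]_y (b y)%:E))%E.
Proof.
move=> ma mb a0 b0; rewrite fubini_tonelli1; last 2 first.
- apply/measurable_EFinP/measurable_funM.
    exact: (measurableT_comp ma measurable_fst).
  exact: (measurableT_comp mb measurable_snd).
- by move=> z; rewrite lee_fin mulr_ge0.
have mb' : measurable_fun setT (fun y => (b y)%:E) by exact/measurable_EFinP.
have ma' : measurable_fun setT (fun y => (a y)%:E) by exact/measurable_EFinP.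
transitivity (\int[m1]_x ((a x)%:E * \int[m2]_y (b y)%:E))%E.
  apply: eq_integral => x _; rewrite /fubini_F /=.
  under eq_integral do rewrite EFinM.
  by rewrite ge0_integralZl ?lee_fin// => y _; rewrite lee_fin.
have B0 : (0 <= \int[m2]_y (b y)%:E)%E by apply: integral_ge0 => y _; rewrite lee_fin.
by rewrite ge0_integralZr// => x _; rewrite lee_fin.
Qed.

Lemma cL1_tensor (a : T1 -> R[i]) (b : T2 -> R[i]) : cL1 m1 a -> cL1 m2 b ->
  cL1 (m1 \x m2)%E (fun z => a z.1 * b z.2).
Proof.
move=> [ma ao] [mb bo]; split.
  by apply: cmfunM; [exact: (cmfun_comp measurable_fst ma)|exact: (cmfun_comp measurable_snd mb)].
under eq_integral do rewrite Normc.normcM.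
rewrite (ge0_integral_prod (a := fun x => normc (a x)) (b := fun x => normc (b x))).
- apply: lte_mul_pinfty => //.
    by apply: integral_ge0 => y _; rewrite lee_fin normc_ge0.
  by rewrite ge0_fin_numE// integral_ge0// => y _; rewrite lee_fin normc_ge0.
- exact: cmfun_normc.
- exact: cmfun_normc.
- by move=> x; exact: normc_ge0.
- by move=> x; exact: normc_ge0.
Qed.

Lemma cint_tensor (a : T1 -> R[i]) (b : T2 -> R[i]) : cL1 m1 a -> cL1 m2 b ->
  cint (m1 \x m2)%E (fun z => a z.1 * b z.2) = cint m1 a * cint m2 b.
Proof.
move=> aL bL; rewrite -(cfubini12 (cL1_tensor aL bL)) /=.
rewrite [RHS]mulrC -cintZ//; apply: eq_cint => x.
by rewrite cintZ// mulrC.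
Qed.

End product_integrals.

(** * The transform of the exponential weight on the line *)

Section exponential_weight.
Context {R : realType}.
Local Notation leb := (@lebesgue_measure R).
Implicit Types (e t x : R).

Definition expw e t : R := expR (- (e * `|t|)).
(** The factor [1 / pi] of the Poisson kernel is left out, so the mass is [pi]; it is restored in
    [K]. *)
Definition poissonk e x : R := e / (e ^+ 2 + x ^+ 2).

Lemma expw_ge0 e t : 0 <= expw e t. Proof. exact: expR_ge0. Qed.

Lemma expw_le1 e t : 0 <= e -> expw e t <= 1.
Proof. by move=> e0; rewrite /expw -expR0 ler_expR oppr_le0 mulr_ge0. Qed.

Lemma poissonk_ge0 e x : 0 <= e -> 0 <= poissonk e x.
Proof. by move=> e0; rewrite divr_ge0// addr_ge0// sqr_ge0. Qed.

Lemma measurable_expw e : measurable_fun (setT : set (measurableTypeR R)) (expw e).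
Proof.
apply: continuous_measurable_fun => t.
apply: (cvg_comp (fun t : R => - (e * `|t|)) expR _ (@continuous_expR R _)).
by apply: cvgN; apply: cvgM; [exact: cvg_cst|exact: norm_continuous].
Qed.

Lemma measurable_poissonk e : 0 < e ->
  measurable_fun (setT : set (measurableTypeR R)) (poissonk e).
Proof.
move=> e0; apply: continuous_measurable_fun => x; apply: cvgM; first exact: cvg_cst.
apply: cvgV; first by rewrite gt_eqF// ltr_pwDl// ?exprn_gt0// sqr_ge0.
by apply: cvgD; [exact: cvg_cst|exact: exprn_continuous].
Qed.

Lemma integral_expw e : 0 < e -> (\int[leb]_t (expw e t)%:E = (2 / e)%:E)%E.
Proof.
move=> e0; have := integral_exp_cos 0 e0.
under eq_integral do rewrite mul0r cos0 -[(1 + 1)%R]/(2%:R) mulrC EFinM.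
rewrite ge0_integralZl//; last by apply/measurable_EFinP; exact: measurable_expw.
rewrite expr0n addr0 EFinM => h.
have := congr1 (fun z => (2^-1)%:E * z)%E h.
rewrite !muleA -EFinM mulVf ?pnatr_eq0// !mul1e => ->.
by congr EFin; field; rewrite gt_eqF.
Qed.

Lemma cL1_expw_cis e x : 0 < e -> cL1 leb (fun t => (expw e t)%:C * cis (- (x * t))).
Proof.
move=> e0; have h : cL1 leb (fun t => (expw e t)%:C).
  split; first exact: cmfunR (measurable_expw e).
  under eq_integral do rewrite normcR ger0_norm ?expw_ge0//.
  by rewrite integral_expw// ltry.
apply: (cL1Mbounded (M := 1) h) => [|t]; last by rewrite normc_cis.
apply: (@cmfun_cis R _ (measurableTypeR R) (fun t => - (x * t))).
by apply: measurable_funN; apply: measurable_funM; [exact: measurable_cst|exact: measurable_id].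
Qed.

Lemma cint_expw_cis e x : 0 < e ->
  cint leb (fun t => (expw e t)%:C * cis (- (x * t))) = (2 * poissonk e x)%:C.
Proof.
move=> e0; have hL := cL1_expw_cis x e0.
have ReE t : Rec ((expw e t)%:C * cis (- (x * t))) = expw e t * cos (x * t).
  by rewrite RecM /= mul0r subr0 cosN.
have ImE t : Imc ((expw e t)%:C * cis (- (x * t))) = - (expw e t * sin (x * t)).
  by rewrite ImcM /= mul0r addr0 sinN mulrN.
have mE : measurable_fun setT (fun t => (expw e t)%:E).
  by apply/measurable_EFinP; exact: measurable_expw.
have iE : leb.-integrable setT (fun t => (expw e t)%:E).
  apply/integrableP; split => //.
  under eq_integral do rewrite gee0_abs ?lee_fin ?expw_ge0//.
  by rewrite integral_expw// ltry.
apply: complex_eq.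
  change (\int[leb]_t (Rec ((expw e t)%:C * cis (- (x * t)))) = 2 * poissonk e x).
  have iC : leb.-integrable setT (fun t => (expw e t * cos (x * t))%:E).
    by apply: eq_integrable (cL1_Re hL) => // t _; exact: (congr1 EFin (ReE t)).
  (* Subtracting the integral of the weight, [2 / e], isolates the cosine transform. *)
  have := integral_exp_cos x e0.
  under eq_integral do rewrite mulrDr mulr1 EFinD.
  rewrite integralD// -/(expw e) integral_expw//.
  rewrite (_ : (\int[leb]_x _)%R = \int[leb]_t (expw e t * cos (x * t))); last first.
    by apply: eq_Rintegral => t _; rewrite ReE.
  rewrite /Rintegral.
  have := integrable_fin_num measurableT iC.
  case: (\int[leb]_t _)%E => // r _ [h] /=.
  apply: (@addrI _ (2 / e)); rewrite h /poissonk.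
  by field; rewrite !gt_eqF// ltr_pwDl// ?exprn_gt0// sqr_ge0.
change (\int[leb]_t (Imc ((expw e t)%:C * cis (- (x * t)))) = 0).
have iI := cL1_Im hL.
have /measurable_int mI := iI.
(* The imaginary part is odd, so reflection equates its integral with its own negative. *)
have hN : (\int[leb]_t (Imc ((expw e t)%:C * cis (- (x * t))))%:E =
    - \int[leb]_t (Imc ((expw e t)%:C * cis (- (x * t))))%:E)%E.
  rewrite -[LHS](integral_invariant
    (phi := (-%R : measurableTypeR R -> measurableTypeR R)) _ leb_opp mI);
    last exact: oppr_measurable.
  rewrite -mulN1e -(integralZl _ iI)//.
  by apply: eq_integral => t _; rewrite !ImE /expw normrN mulrN sinN mulrN mulN1e -EFinN.
rewrite /Rintegral; have := integrable_fin_num measurableT iI.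
move: hN; case: (\int[leb]_t _)%E => // r [h] _ /=; lra.
Qed.

End exponential_weight.

(** * The Fourier transform on L1 *)

(** Defined at every point by an integral, whereas [fourier] is a choice within an almost everywhere
    class; [fourier_F1] compares them on L1 and L2 together. *)
Definition F1 {R : realType} (f : R * R -> R[i]) (xi : R * R) : R[i] :=
  ((2 * pi)^-1)%:C * cint leb2 (fun x => f x * cis (- dot x xi)).

Section L1_fourier.
Context {R : realType}.
Local Notation leb := (@lebesgue_measure R).
Implicit Types (f g : plane R -> R[i]) (x y xi : plane R).

Let c0 : R := (2 * pi)^-1.

Lemma dotC x y : dot x y = dot y x.
Proof. by rewrite /dot; ring. Qed.

Lemma dotNl x y : dot (- x) y = - dot x y.
Proof. by rewrite /dot /=; ring. Qed.

Lemma dotNr x y : dot x (- y) = - dot x y.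
Proof. by rewrite /dot /=; ring. Qed.

Lemma measurable_dot : measurable_fun setT (fun z : plane R * plane R => dot z.1 z.2).
Proof.
have m1 : measurable_fun setT (fun z : plane R * plane R => (z.1 : plane R)).
  exact: measurable_fst.
have m2 : measurable_fun setT (fun z : plane R * plane R => (z.2 : plane R)).
  exact: measurable_snd.
apply: measurable_funD; apply: measurable_funM.
- exact: measurableT_comp measurable_fst m1.
- exact: measurableT_comp measurable_fst m2.
- exact: measurableT_comp measurable_snd m1.
- exact: measurableT_comp measurable_snd m2.
Qed.

Lemma cmfun_cis_dot : cmfun (fun z : plane R * plane R => cis (- dot z.1 z.2)).
Proof. by apply: cmfun_cis; apply: measurable_funN; exact: measurable_dot. Qed.

Lemma cmfun_cis_dot2 xi : cmfun (fun x : plane R => cis (- dot x xi)).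
Proof. exact: (cmfun_comp (pair2_measurable xi) cmfun_cis_dot). Qed.

Lemma cL1_cis f xi : cL1 leb2 f -> cL1 leb2 (fun x => f x * cis (- dot x xi)).
Proof.
move=> fL; apply: (cL1Mbounded (M := 1) fL); first exact: cmfun_cis_dot2.
by move=> x; rewrite normc_cis.
Qed.

Lemma cmfun_F1 f : cmfun f -> cmfun (F1 f).
Proof.
move=> mf; apply: cmfunM; first exact: cmfun_cst.
apply: (@cmfun_cint_snd _ _ _ _ _ sleb2 (fun z => f z.2 * cis (- dot z.2 z.1))).
apply: cmfunM; first exact: (cmfun_comp measurable_snd mf).
by under eq_fun do rewrite dotC; exact: cmfun_cis_dot.
Qed.

Lemma c0_gt0 : 0 < c0.
Proof. by rewrite /c0 invr_gt0 mulr_gt0// pi_gt0. Qed.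

Lemma c0_ge0 : 0 <= c0. Proof. exact: ltW c0_gt0. Qed.

Lemma c0_neq0 : c0%:C != 0 :> R[i].
Proof.
apply/eqP => /(congr1 (@complex.Re R)) h.
by have := c0_gt0; rewrite (h : c0 = 0) ltxx.
Qed.

(** Integrability is requested of [u], where boundedness of the transforms gives it; dividing by [c]
    transfers it to [v]. *)
Lemma cint_scaled (c : R[i]) (u v : plane R -> R[i]) : c != 0 -> cL1 leb2 u ->
  (forall x, u x = c * v x) -> cint leb2 u = c * cint leb2 v.
Proof.
move=> c_neq0 uL uv; rewrite (@eq_cint _ _ _ _ v (fun x => c^-1 * u x)).
  by rewrite cintZ// mulrA divff// mul1r.
by move=> x; rewrite uv mulrA mulVf// mul1r.
Qed.

Lemma F1_bounded f : cL1 leb2 f -> exists M : R, forall xi, normc (F1 f xi) <= M.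
Proof.
move=> fL; exists (c0 * fine (\int[leb2]_x (normc (f x))%:E)) => xi.
rewrite Normc.normcM normcR ger0_norm ?c0_ge0// ler_wpM2l ?c0_ge0//.
rewrite -lee_fin fineK; last first.
  by rewrite ge0_fin_numE; [case: fL|apply: integral_ge0 => x _; rewrite lee_fin normc_ge0].
apply: le_trans (le_normc_cint (cL1_cis xi fL)) _.
by under eq_integral do rewrite Normc.normcM normc_cis mulr1.
Qed.

Lemma cint_F1_sym f g : cL1 leb2 f -> cL1 leb2 g ->
  cint leb2 (fun xi => F1 f xi * g xi) = cint leb2 (fun x => f x * F1 g x).
Proof.
move=> fL gL.
have := @cint_swap_kernel _ _ _ _ _ sleb2 sleb2 f g (fun z => cis (- dot z.1 z.2)) fL gL
  cmfun_cis_dot.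
have h1 z : normc (cis (- dot z.1 z.2) : R[i]) <= 1 by rewrite normc_cis.
move=> /(_ h1) h.
have e1 xi : F1 f xi * g xi = c0%:C *
    cint leb2 (fun x => f x * g xi * cis (- dot x xi)).
  rewrite /F1 -mulrA; congr (_ * _); rewrite mulrC -cintZ; last exact: cL1_cis.
  by apply: eq_cint => x; ring.
have e2 x : f x * F1 g x = c0%:C *
    cint leb2 (fun xi => f x * g xi * cis (- dot x xi)).
  rewrite /F1 mulrCA; congr (_ * _); rewrite -cintZ; last exact: cL1_cis.
  by apply: eq_cint => xi; rewrite dotC; ring.
have lL : cL1 leb2 (fun xi => F1 f xi * g xi).
  have [M hM] := F1_bounded fL.
  under eq_fun do rewrite mulrC; apply: (cL1Mbounded gL _ hM).
  by apply: cmfun_F1; case: fL.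
have rL : cL1 leb2 (fun x => f x * F1 g x).
  have [M hM] := F1_bounded gL.
  by apply: (cL1Mbounded fL _ hM); apply: cmfun_F1; case: gL.
by rewrite (cint_scaled c0_neq0 lL e1) (cint_scaled c0_neq0 rL e2) h.
Qed.

Lemma conjcM (z w : R[i]) : (z * w)^* = z^* * w^*.
Proof. by apply: complex_eq; rewrite ?(RecJ, ImcJ, RecM, ImcM); ring. Qed.

Lemma conjcR (a : R) : (a%:C)^* = a%:C.
Proof. by apply: complex_eq; rewrite ?RecJ ?ImcJ //= oppr0. Qed.

(** This turns [|F1 f|^2] into a product of two transforms, to which the multiplication formula
    applies. *)
Lemma F1J f xi : cL1 leb2 f -> (F1 f xi)^* = F1 (fun x => (f (- x))^*) xi.
Proof.
move=> fL; rewrite /F1 conjcM conjcR; congr (_ * _).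
rewrite -cintJ; last exact: cL1_cis.
rewrite -(cint_invariant measurable_plane_opp leb2_opp); last first.
  by apply: cmfunJ; case: (cL1_cis xi fL).
by apply: eq_cint => x; rewrite conjcM dotNl opprK -cisN.
Qed.

(** * Abel means of the inverse transform *)

Section abel.
Context (e : R) (e0 : 0 < e).

Definition W x : R := expw e x.1 * expw e x.2.
(** One factor [pi^-1] per coordinate gives the kernel unit mass. *)
Definition K x : R := pi ^-2 * (poissonk e x.1 * poissonk e x.2).

Lemma W_ge0 x : 0 <= W x. Proof. by rewrite mulr_ge0// expw_ge0. Qed.

Lemma W_le1 x : W x <= 1.
Proof. by rewrite /W mulr_ile1 ?expw_ge0 ?expw_le1// ltW. Qed.

Lemma K_ge0 x : 0 <= K x.
Proof. by rewrite mulr_ge0 ?invr_ge0 ?exprn_ge0 ?pi_ge0// mulr_ge0// poissonk_ge0// ltW. Qed.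

Lemma measurable_W : measurable_fun setT W.
Proof.
apply: measurable_funM.
  exact: (measurableT_comp (measurable_expw e) measurable_fst).
exact: (measurableT_comp (measurable_expw e) measurable_snd).
Qed.

Lemma measurable_K : measurable_fun setT K.
Proof.
apply: measurable_funM; first exact: measurable_cst.
apply: measurable_funM.
  exact: (measurableT_comp (measurable_poissonk e0) measurable_fst).
exact: (measurableT_comp (measurable_poissonk e0) measurable_snd).
Qed.

Lemma cL1_W : cL1 leb2 (fun x => (W x)%:C).
Proof.
split; first exact: cmfunR measurable_W.
under eq_integral do rewrite normcR ger0_norm ?W_ge0//.
rewrite (@ge0_integral_prod _ _ _ _ _ leb leb (expw e) (expw e)).
- by rewrite integral_expw// -EFinM ltry.
- exact: measurable_expw.
- exact: measurable_expw.
- by move=> x; exact: expw_ge0.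
- by move=> x; exact: expw_ge0.
Qed.

Lemma integral_K : (\int[leb2]_x (K x)%:E = 1)%E.
Proof.
under eq_integral do rewrite EFinM.
rewrite ge0_integralZl//; last 3 first.
- apply/measurable_EFinP/measurable_funM.
    exact: (measurableT_comp (measurable_poissonk e0) measurable_fst).
  exact: (measurableT_comp (measurable_poissonk e0) measurable_snd).
- by move=> x _; rewrite lee_fin mulr_ge0// poissonk_ge0// ltW.
- by rewrite lee_fin invr_ge0 exprn_ge0// pi_ge0.
rewrite (@ge0_integral_prod _ _ _ _ _ leb leb (poissonk e) (poissonk e)).
- rewrite integral_poisson// -!EFinM -expr2 mulVf// expf_neq0// gt_eqF// pi_gt0.
  by [].
- exact: measurable_poissonk.
- exact: measurable_poissonk.
- by move=> x; rewrite poissonk_ge0// ltW.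
- by move=> x; rewrite poissonk_ge0// ltW.
Qed.

(** The constants of the two transforms, [(2 * pi)^-2], meet the two factors [2] of [cint_expw_cis]
    and leave [pi ^-2]. The argument is [x + y] because both transforms go in the same direction,
    which reflects the variable. *)
Lemma F1_W_cis x y : c0%:C * F1 (fun xi => (W xi)%:C * cis (- dot x xi)) y = (K (x + y))%:C.
Proof.
rewrite /F1 (@eq_cint _ _ _ _ _ (fun xi : plane R =>
    ((expw e xi.1)%:C * cis (- ((x + y).1 * xi.1))) *
    ((expw e xi.2)%:C * cis (- ((x + y).2 * xi.2))))); last first.
  move=> xi; rewrite mulrACA -cisD -rmorphM -mulrA -cisD.
  by congr (_ * cis _); rewrite /dot /=; ring.
rewrite (@cint_tensor _ _ _ _ _ leb leb (fun t => (expw e t)%:C * cis (- ((x + y).1 * t)))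
  (fun t => (expw e t)%:C * cis (- ((x + y).2 * t)))); [|exact: cL1_expw_cis..].
rewrite !cint_expw_cis// -!rmorphM/=; congr (_ %:C).
rewrite /K /c0 /=; move: (@pi R) (pi_gt0 R) => p p0.
by field; rewrite gt_eqF.
Qed.

Lemma F1_abel f x : cL1 leb2 f ->
  F1 (fun xi => F1 f xi * (W xi)%:C) x = cint leb2 (fun y => f y * (K (x + y))%:C).
Proof.
move=> fL; rewrite {1}/F1.
have WL : cL1 leb2 (fun xi => (W xi)%:C * cis (- dot x xi)).
  by under eq_fun do rewrite dotC; apply: cL1_cis; exact: cL1_W.
rewrite (@eq_cint _ _ _ _ _ (fun xi => F1 f xi * ((W xi)%:C * cis (- dot x xi)))); last first.
  by move=> xi; rewrite dotC mulrA.
rewrite cint_F1_sym// -cintZ; last first.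
  have [M hM] := F1_bounded WL.
  by apply: (cL1Mbounded fL _ hM); apply: cmfun_F1; case: WL.
by apply: eq_cint => y; rewrite mulrCA F1_W_cis.
Qed.

End abel.

End L1_fourier.

(** * The Fourier transform on L2 *)

Lemma L2cvg_dominated {R : realType} d (T : measurableType d)
    (mu : {measure set T -> \bar R}) (u : nat -> T -> R[i]) (f : T -> R[i]) :
  (forall n, cmfun (u n)) -> cL2 mu f ->
  (forall n x, normc (u n x - f x) <= normc (f x)) ->
  (forall x, normc (u n x - f x) @[n --> \oo] --> 0) -> L2cvg mu u f.
Proof.
move=> mu_ [mf fo] uf ucvg.
have mn n : measurable_fun setT (fun x => (normc (u n x - f x) ^+ 2)%:E).
  by apply: cmfun_n2; exact: cmfunB.
have h0 : (n2 mu (fun x => u n x - f x)%R @[n --> \oo] --> 0)%E.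
  have [] := @dominated_convergence _ _ _ mu setT measurableT
    (fun n x => (normc (u n x - f x) ^+ 2)%:E) (cst 0%E) (fun x => (normc (f x) ^+ 2)%:E).
  - by [].
  - exact: measurable_cst.
  - apply/nearW => x _; apply/cvg_EFin; first exact: nearW.
    rewrite -(mulr0 (0 : R)); exact: (cvgM (ucvg x) (ucvg x)).
  - apply/integrableP; split; first exact: cmfun_n2.
    under eq_integral do rewrite gee0_abs ?lee_fin ?sqr_ge0//.
    by rewrite -L2n_lty.
  - apply/nearW => x n _; rewrite gee0_abs ?lee_fin ?sqr_ge0//.
    by rewrite ler_pXn2r ?nnegrE ?normc_ge0.
  - by move=> _ _; rewrite integral0.
apply/L2cvgP => e e0.
have e2 : 0 < e ^+ 2 by rewrite exprn_gt0.
have := (ge0_cvge0P (fun n => n2_ge0 mu (fun x => u n x - f x))).1 h0 _ e2.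
by apply: filterS => n; rewrite L2n_le_fin// ltW.
Qed.

(** * The contraction property on L1 and L2 together *)

Section contraction.
Context {R : realType}.
Implicit Types (f g : plane R -> R[i]).

(** The weight [W] makes the integral converge before [F1 f] is known to be square integrable. With
    [ft x] the conjugate of [f (- x)], the integrand is [F1 f] times [F1 ft * W]; the multiplication
    formula turns the integral into the pairing of [f] with the convolution of [K] and the conjugate
    of [f], and Young's inequality applies with mass [1]. *)
Lemma weighted_plancherel_le (e : R) f (b : R) : 0 < e -> cL1 leb2 f -> cL2 leb2 f ->
  L2n leb2 f = b%:E ->
  (\int[leb2]_xi (normc (F1 f xi) ^+ 2 * W e xi)%:E <= (b ^+ 2)%:E)%E.
Proof.
move=> e0 fL1 fL2 fb; have [mf _] := fL1.
have b0 : 0 <= b by rewrite -lee_fin -fb L2n_ge0.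
pose ft x := (f (- x))^*.
have ftL : cL1 leb2 ft.
  exact/cL1J/(cL1_invariant measurable_plane_opp leb2_opp).
pose g xi := F1 ft xi * (W e xi)%:C.
have gL : cL1 leb2 g.
  have [M hM] := F1_bounded ftL.
  rewrite /g; under eq_fun do rewrite mulrC; apply: (cL1Mbounded (cL1_W e0) _ hM).
  by apply: cmfun_F1; case: ftL.
have gE xi : F1 f xi * g xi = (normc (F1 f xi) ^+ 2 * W e xi)%:C.
  by rewrite /g -F1J// mulrA mulcJ -rmorphM.
pose h (z : plane R * plane R) : R[i] := (f z.2)^* * (K e (z.1 - z.2))%:C.
have mh : cmfun h.
  apply: cmfunM; first exact: cmfunJ (cmfun_comp measurable_snd mf).
  by apply: cmfunR; exact: (measurableT_comp (measurable_K e0) measurable_plane_sub2).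
have F1g x : F1 g x = cint leb2 (fun y => h (x, y)).
  rewrite /g F1_abel//.
  rewrite -(cint_invariant measurable_plane_opp leb2_opp); last first.
    apply: cmfunM; first by case: ftL.
    apply: cmfunR; apply: (measurableT_comp (measurable_K e0)).
    rewrite (_ : +%R x = (fun y => y + x)); last by apply/funext => y; rewrite addrC.
    exact: measurable_plane_shift.
  by apply: eq_cint => y; rewrite /ft opprK.
have nb : (\int[leb2]_x (normc (f x) ^+ 2)%:E <= (b ^+ 2)%:E)%E.
  by rewrite -[leLHS]/(n2 leb2 f) -L2n_le_fin// fb.
have k1 : (\int[leb2]_x (K e x)%:E <= 1%:E)%E by rewrite integral_K.
have hk x y : normc (h (x, y)) <= K e (x - y) * normc (f y).
  by rewrite /h /= Normc.normcM normcR normcJ ger0_norm ?K_ge0// mulrC.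
have G2 := young mh (measurable_K e0) (cmfun_normc mf) (K_ge0 e0)
  (fun x => normc_ge0 _) hk ler01 b0 k1 nb.
have mG := cmfun_kernel_operator mh.
have GL : cL2 leb2 (fun x => cint leb2 (fun y => h (x, y))).
  by split => //; apply: le_lt_trans G2 _; rewrite ltry.
have key : ((normc (cint leb2 (fun xi => F1 f xi * g xi)%R))%:E <= (b ^+ 2)%:E)%E.
  rewrite cint_F1_sym//.
  rewrite (@eq_cint _ _ _ _ _ (fun x => f x * cint leb2 (fun y => h (x, y)))); last first.
    by move=> x; rewrite F1g.
  apply: le_trans (le_normc_cint (cL2M fL2 GL)) _.
  apply: le_trans (L2n_CS leb2 mf mG) _.
  rewrite fb expr2 EFinM; apply: lee_wpmul2l; first by rewrite lee_fin.
  by rewrite -[b in leRHS]mul1r.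
have UL : cL1 leb2 (fun xi => F1 f xi * g xi).
  have [M hM] := F1_bounded fL1.
  under eq_fun do rewrite mulrC; apply: (cL1Mbounded gL _ hM).
  exact: cmfun_F1.
have UR : leb2.-integrable setT (fun xi => (normc (F1 f xi) ^+ 2 * W e xi)%:E).
  apply: eq_integrable (cL1_Re UL) => // xi _.
  by congr EFin; rewrite gE.
have kE : cint leb2 (fun xi => F1 f xi * g xi) =
    cint leb2 (fun xi => (normc (F1 f xi) ^+ 2 * W e xi)%:C) by exact: eq_cint.
apply: le_trans key; rewrite kE normc_RRe normcR.
rewrite /Rintegral ger0_norm ?fine_ge0 ?fineK//.
- exact: integrable_fin_num.
- apply: integral_ge0 => xi _; rewrite lee_fin mulr_ge0 ?sqr_ge0//; exact: W_ge0.
Qed.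

Lemma expw_cvg1 (t : R) : expw (harmonic n) t @[n --> \oo] --> (1 : R).
Proof.
rewrite -expR0; apply: (cvg_comp (fun n => - (harmonic n * `|t|)) expR _ (@continuous_expR R _)).
rewrite -oppr0; apply: cvgN; rewrite -[X in _ --> X](mul0r `|t|).
by apply: cvgM; [exact: cvg_harmonic|exact: cvg_cst].
Qed.

Lemma W_cvg1 (x : plane R) : W (harmonic n) x @[n --> \oo] --> (1 : R).
Proof. by rewrite -(mulr1 (1 : R)); exact: (cvgM (expw_cvg1 x.1) (expw_cvg1 x.2)). Qed.

(** The weights tend to [1] and Fatou removes them. Fatou yields an inequality only; equality is
    [fourier_isometry]. *)
Lemma F1_contraction f : cL1 leb2 f -> cL2 leb2 f -> (L2n leb2 (F1 f) <= L2n leb2 f)%E.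
Proof.
move=> fL1 fL2; have [mf fo] := fL2.
have ff : L2n leb2 f \is a fin_num by rewrite -L2n_fin_num.
have fb : L2n leb2 f = (fine (L2n leb2 f))%:E by rewrite fineK.
have b0 : 0 <= fine (L2n leb2 f) by rewrite fine_ge0// L2n_ge0.
rewrite fb L2n_le_fin// /n2.
apply: (@fatou_le _ _ _ _ (fun n (xi : plane R) => (normc (F1 f xi) ^+ 2 * W (harmonic n) xi)%:E)).
- move=> n; apply/measurable_EFinP/measurable_funM.
    by apply/measurable_funX/cmfun_normc; exact: cmfun_F1.
  exact: measurable_W.
- by move=> n xi; rewrite lee_fin mulr_ge0 ?sqr_ge0// W_ge0.
- by apply: cmfun_n2; exact: cmfun_F1.
- by move=> xi; rewrite lee_fin sqr_ge0.
- apply: nearW => xi; apply/cvg_EFin; first exact: nearW.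
  rewrite -[X in _ --> X]mulr1; apply: (cvgM (cvg_cst _)); exact: W_cvg1.
- by move=> n; apply: weighted_plancherel_le => //; exact: harmonic_gt0.
Qed.

End contraction.

Section L2_fourier.
Context {R : realType}.
Implicit Types (f g F : plane R -> R[i]) (n : nat).

Definition cut n f (x : plane R) : R[i] := (\1_(box n) x : R)%:C * f x.

Lemma box_near (x : plane R) : \forall n \near \oo, box n x.
Proof.
pose m : R := Num.max `|(x.1 : R)| `|(x.2 : R)|.
have h : m < (Num.bound m)%:R by apply: archi_boundP; rewrite le_max normr_ge0.
exists (Num.bound m) => // n /= mn.
have mn' : m <= n%:R by rewrite (le_trans (ltW h))// ler_nat.
by split; rewrite /= in_itv/= -ler_norml; apply: le_trans mn';
  rewrite le_max lexx ?orbT.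
Qed.

Lemma cutE_in n f x : box n x -> cut n f x = f x.
Proof. by move=> nx; rewrite /cut indicE mem_set// mul1r. Qed.

Lemma cutE_out n f x : ~ box n x -> cut n f x = 0.
Proof. by move=> nx; rewrite /cut indicE memNset// mul0r. Qed.

Lemma normc_cut_le n f x : normc (cut n f x) <= normc (f x).
Proof.
have [nx|nx] := pselect (box n x); first by rewrite cutE_in.
by rewrite cutE_out// (_ : normc 0 = 0) ?normc_ge0//; apply/eqP; rewrite normc_eq0.
Qed.

Lemma normc_cutB_le n f x : normc (cut n f x - f x) <= normc (f x).
Proof.
have [nx|nx] := pselect (box n x).
  by rewrite cutE_in// subrr (_ : normc 0 = 0) ?normc_ge0//; apply/eqP; rewrite normc_eq0.
by rewrite cutE_out// sub0r normc_opp.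
Qed.

Lemma cut_cvg f x : normc (cut n f x - f x) @[n --> \oo] --> 0.
Proof.
apply/cvgr0Pnorm_le => e e0; apply: filterS (box_near x) => n nx.
by rewrite cutE_in// subrr (_ : normc 0 = 0) ?normr0 ?ltW//; apply/eqP; rewrite normc_eq0.
Qed.

Lemma cmfun_indic_box n : cmfun (fun x : plane R => (\1_(box n) x : R)%:C).
Proof. by apply: cmfunR; apply: measurable_indic; exact: measurable_box. Qed.

Lemma cmfun_cut n f : cmfun f -> cmfun (cut n f).
Proof. by move=> mf; apply: cmfunM => //; exact: cmfun_indic_box. Qed.

Lemma cL2_cut n f : cL2 leb2 f -> cL2 leb2 (cut n f).
Proof.
move=> fL; apply: (cL2_le _ fL); first by apply: cmfun_cut; case: fL.
by move=> x; exact: normc_cut_le.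
Qed.

Lemma cL1_cut n f : cL2 leb2 f -> cL1 leb2 (cut n f).
Proof.
move=> fL; apply: cL2M => //; split; first exact: cmfun_indic_box.
rewrite L2n_lty /n2.
rewrite (_ : (\int[leb2]_x _ = \int[leb2]_x (\1_(box n) x)%:E)%E).
  rewrite integral_indic ?setIT//; [exact: leb2_box_lty|exact: measurable_box].
apply: eq_integral => x _; rewrite normcR indicE.
by case: (x \in _); rewrite ?normr1 ?normr0 ?expr1n// expr0n.
Qed.

Lemma L2cvg_cut f : cL2 leb2 f -> L2cvg leb2 (cut ^~ f) f.
Proof.
move=> fL; apply: L2cvg_dominated => //.
- by move=> n; apply: cmfun_cut; case: fL.
- by move=> n x; exact: normc_cutB_le.
- exact: cut_cvg.
Qed.

Lemma fourier_truncE f n : fourier_trunc f n = F1 (cut n f).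
Proof.
apply/funext => xi; rewrite /fourier_trunc /F1; congr (_ * _).
have E x : (fun x => f x * cis (- dot x xi)) x * (\1_(box n) x : R)%:C =
    cut n f x * cis (- dot x xi) by rewrite /cut; ring.
rewrite /cintegral /cint; congr (_ +i* _).
  rewrite Rintegral_mkcond; apply: eq_Rintegral => x _; rewrite -E patchE indicE.
  rewrite -[X in if x \in X then _ else _]/(box n).
  by case: (x \in _); rewrite ?mulr1// mulr0.
rewrite Rintegral_mkcond; apply: eq_Rintegral => x _; rewrite -E patchE indicE.
rewrite -[X in if x \in X then _ else _]/(box n).
by case: (x \in _); rewrite ?mulr1// mulr0.
Qed.

Lemma F1B f g xi : cL1 leb2 f -> cL1 leb2 g ->
  F1 (fun x => f x - g x) xi = F1 f xi - F1 g xi.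
Proof.
move=> fL gL; rewrite /F1 -mulrBr -cintB; [|exact: cL1_cis..].
by congr (_ * _); apply: eq_cint => x; ring.
Qed.

Lemma is_fourierP f F : is_fourier f F <->
  cL2 leb2 F /\ L2cvg leb2 (fun n => F1 (cut n f)) F.
Proof.
rewrite /is_fourier /L2cvg.
have -> : (fun n => L2norm (fun xi => F xi - fourier_trunc f n xi)) =
    (fun n => L2n leb2 (fun xi => F1 (cut n f) xi - F xi)).
  by apply/funext => n; rewrite fourier_truncE -[LHS]/(L2n leb2 _) L2n_distC.
by split.
Qed.

Lemma cL2_F1_cut f n : cL2 leb2 f -> cL2 leb2 (F1 (cut n f)).
Proof.
move=> fL; split; first by apply: cmfun_F1; apply: cmfun_cut; case: fL.
apply: le_lt_trans (F1_contraction (cL1_cut n fL) (cL2_cut n fL)) _.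
by case: (cL2_cut n fL).
Qed.

(** By linearity and contraction, the transforms of the truncations form a Cauchy sequence because
    the truncations do. *)
Lemma is_fourier_exists f : cL2 leb2 f -> exists F, is_fourier f F.
Proof.
move=> fL.
have m1 n : cmfun (F1 (cut n f)).
  by apply: cmfun_F1; apply: cmfun_cut; case: fL.
have [F mF hF] : exists2 F, cmfun F & L2cvg leb2 (fun n => F1 (cut n f)) F.
  apply: L2_complete => // e e0.
  have e2 : 0 < e / 2 by rewrite divr_gt0.
  have [N _ hN] := (L2cvgP _ _ _).1 (L2cvg_cut fL) _ e2.
  exists N => m n Nm Nn.
  have dL1 := cL1B (cL1_cut m fL) (cL1_cut n fL).
  have dL2 := cL2B (cL2_cut m fL) (cL2_cut n fL).
  rewrite (_ : (fun x => _) = F1 (fun x => cut m f x - cut n f x)); last first.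
    by apply/funext => x; rewrite F1B; [|exact: cL1_cut..].
  apply: le_trans (F1_contraction dL1 dL2) _.
  have [mf _] := fL.
  apply: le_trans (L2nB3 leb2 (cmfun_cut m mf) mf (cmfun_cut n mf)) _.
  rewrite (splitr e) EFinD; apply: leeD; first exact: hN.
  by rewrite L2n_distC; exact: hN.
exists F; apply/is_fourierP; split => //.
by apply: (L2cvg_cL2 _ mF hF) => n; exact: cL2_F1_cut.
Qed.

Lemma fourierP f : cL2 leb2 f -> is_fourier f (fourier f).
Proof. by move=> fL; apply: xgetPex; exact: is_fourier_exists. Qed.

Lemma fourier_cL2 f : cL2 leb2 f -> cL2 leb2 (fourier f).
Proof. by move=> /fourierP /is_fourierP[]. Qed.

Lemma fourier_cvg f : cL2 leb2 f -> L2cvg leb2 (fun n => F1 (cut n f)) (fourier f).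
Proof. by move=> /fourierP /is_fourierP[]. Qed.

(* Only measurability of [f] is assumed: the truncated transforms may be known
   to converge before [f] is known to be square integrable. *)
Lemma fourier_unique f F : cmfun f -> is_fourier f F ->
  {ae leb2, forall x, fourier f x = F x}.
Proof.
move=> mf fF; have /is_fourierP[[m1 _] h1] : is_fourier f (fourier f).
  by apply: xgetPex; exists F.
have /is_fourierP[[m2 _] h2] := fF.
by apply: (L2cvg_unique _ m1 m2 h1 h2) => n; apply: cmfun_F1; exact: cmfun_cut.
Qed.

Lemma fourier_contraction f : cL2 leb2 f -> (L2n leb2 (fourier f) <= L2n leb2 f)%E.
Proof.
move=> fL; have [mf _] := fL; have [mF _] := fourier_cL2 fL.
apply: (L2cvg_le _ mF (fourier_cvg fL)) => n; first exact: cmfun_F1 (cmfun_cut n mf).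
apply: le_trans (F1_contraction (cL1_cut n fL) (cL2_cut n fL)) _.
by apply: le_L2n => //; [exact: cmfun_cut|move=> x; exact: normc_cut_le].
Qed.

Lemma fourierB f g : cL2 leb2 f -> cL2 leb2 g ->
  {ae leb2, forall x, fourier (fun x => f x - g x) x = fourier f x - fourier g x}.
Proof.
move=> fL gL; have [mf _] := fL; have [mg _] := gL.
have FL := fourier_cL2 fL; have GL := fourier_cL2 gL.
have [mF _] := FL; have [mG _] := GL.
apply: fourier_unique; first exact: cmfunB.
apply/is_fourierP; split; first exact: cL2B.
have sub4 (a b c d : R[i]) : a - b - (c - d) = a - c - (b - d) by ring.
apply/L2cvgP => e e0; have e2 : 0 < e / 2 by rewrite divr_gt0.
have hf := (L2cvgP _ _ _).1 (fourier_cvg fL) _ e2.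
have hg := (L2cvgP _ _ _).1 (fourier_cvg gL) _ e2.
apply: filterS2 hf hg => n k1 k2.
rewrite [X in L2n _ X](_ : _ = (fun x => (F1 (cut n f) x - fourier f x) -
    (F1 (cut n g) x - fourier g x))); last first.
  apply/funext => x; rewrite (_ : cut n (fun y => f y - g y) = (fun x => cut n f x - cut n g x)).
    by rewrite F1B; [exact: sub4|exact: cL1_cut..].
  by apply/funext => y; rewrite /cut mulrBr.
have m1 := cmfun_F1 (cmfun_cut n mf); have m2 := cmfun_F1 (cmfun_cut n mg).
apply: le_trans (L2nB leb2 (cmfunB m1 mF) (cmfunB m2 mG)) _.
rewrite (splitr e) EFinD; apply: leeD.
  exact: k1.
exact: k2.
Qed.

Lemma fourier_L2cvg (u : nat -> plane R -> R[i]) f : (forall n, cL2 leb2 (u n)) ->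
  cL2 leb2 f -> L2cvg leb2 u f -> L2cvg leb2 (fun n => fourier (u n)) (fourier f).
Proof.
move=> uL fL /L2cvgP uf; apply/L2cvgP => e /uf; apply: filterS => n; apply: le_trans.
have dL := cL2B (uL n) fL; have [mu _] := fourier_cL2 (uL n).
have [mf _] := fourier_cL2 fL; have [md _] := fourier_cL2 dL.
rewrite -(ae_eq_L2n (mu := leb2) md (cmfunB mu mf) (fourierB (uL n) fL)).
exact: fourier_contraction.
Qed.

Lemma fourier_sym f g : cL2 leb2 f -> cL2 leb2 g ->
  cint leb2 (fun x => fourier f x * g x) = cint leb2 (fun x => f x * fourier g x).
Proof.
move=> fL gL; apply/eqP; rewrite -subr_eq0 -normc_eq0 eq_le normc_ge0 andbT.
apply/ler_addgt0Pr => e e0; rewrite add0r; have e2 : 0 < e / 2 by rewrite divr_gt0.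
have h1 := L2cvg_cint (fun n => cL2_F1_cut n fL) (fun n => cL2_cut n gL)
  (fourier_cL2 fL) gL (fourier_cvg fL) (L2cvg_cut gL) e2.
have h2 := L2cvg_cint (fun n => cL2_cut n fL) (fun n => cL2_F1_cut n gL)
  fL (fourier_cL2 gL) (L2cvg_cut fL) (fourier_cvg gL) e2.
near \oo => n.
have k1 : normc (cint leb2 (fun x => F1 (cut n f) x * cut n g x) -
  cint leb2 (fun x => fourier f x * g x)) <= e / 2 by near: n.
have k2 : normc (cint leb2 (fun x => cut n f x * F1 (cut n g) x) -
  cint leb2 (fun x => f x * fourier g x)) <= e / 2 by near: n.
move: k1; rewrite cint_F1_sym; [|exact: cL1_cut..].
move: k2; set a := cint leb2 (fun x => cut n f x * _); set b := cint _ _; set c := cint _ _.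
move=> k2 k1; rewrite (splitr e) (_ : c - b = (a - b) - (a - c)); last by ring.
by apply: le_trans (ler_normcB _ _) _; exact: lerD.
Unshelve. all: by end_near. Qed.

(** For integrable [f] the truncated transforms converge at every frequency, by dominated
    convergence; this limit must agree with the L2 limit. *)
Lemma fourier_F1 f : cL1 leb2 f -> cL2 leb2 f ->
  {ae leb2, forall x, fourier f x = F1 f x}.
Proof.
move=> fL1 fL2; have [mf _] := fL1; have [mF _] := fourier_cL2 fL2.
apply: (L2cvg_ae_unique _ mF (cmfun_F1 mf) (fourier_cvg fL2)).
  by move=> n; apply: cmfun_F1; exact: cmfun_cut.
apply: nearW => xi.
pose a n : \bar R := (\int[leb2]_x (normc (cut n f x - f x))%:E)%E.
have a0 : (a n @[n --> \oo] --> 0)%E.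
  have [] := @dominated_convergence _ _ _ leb2 setT measurableT
    (fun n x => (normc (cut n f x - f x))%:E) (cst 0%E) (fun x => (normc (f x))%:E).
  - by move=> n; apply: cmfun_enormc; apply: cmfunB => //; exact: cmfun_cut.
  - exact: measurable_cst.
  - by apply/nearW => x _; apply/cvg_EFin; [exact: nearW|exact: cut_cvg].
  - apply/integrableP; split; first exact: cmfun_enormc.
    under eq_integral do rewrite gee0_abs ?lee_fin ?normc_ge0//.
    by case: fL1.
  - apply/nearW => x n _; rewrite gee0_abs ?lee_fin ?normc_ge0//.
    exact: normc_cutB_le.
  - by move=> _ _; rewrite integral0.
have an n : (0 <= a n)%E by apply: integral_ge0 => x _; rewrite lee_fin normc_ge0.
apply/cvgr0Pnorm_le => e e0.
have c0 : (0 : R) < (2 * pi)^-1 by rewrite invr_gt0 mulr_gt0// pi_gt0.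
have ec0 : 0 < e / (2 * pi)^-1 by rewrite divr_gt0.
apply: filterS ((ge0_cvge0P an).1 a0 _ ec0) => n hn.
have cL := cL1_cut n fL2.
rewrite ger0_norm ?normc_ge0// -F1B// Normc.normcM normcR ger0_norm ?(ltW c0)//.
rewrite -ler_pdivlMl// mulrC -lee_fin; apply: le_trans hn.
have dL := cL1B cL fL1.
apply: le_trans (le_normc_cint (cL1_cis xi dL)) _.
by under eq_integral do rewrite Normc.normcM normc_cis mulr1.
Qed.

End L2_fourier.

(** * Fourier inversion *)

(** Dynkin induction on a constraint imposed through [phi]. With [phi] a projection it frees one
    side of a rectangle while [C] holds the other; with [phi] the identity it passes from rectangles
    to all measurable sets. *)
Lemma integral_eq0_pi_system {R : realType} d d' (S : measurableType d)
    (T : measurableType d') (mu : {measure set S -> \bar R}) (r : S -> \bar R)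
    (C : set S) (phi : S -> T) (G : set (set T)) :
  mu.-integrable setT r -> measurable C -> measurable_fun setT phi ->
  setI_closed G -> measurable = <<s G >> ->
  (\int[mu]_(x in C) r x = 0)%E ->
  (forall A, G A -> \int[mu]_(x in C `&` phi @^-1` A) r x = 0)%E ->
  forall A, measurable A -> (\int[mu]_(x in C `&` phi @^-1` A) r x = 0)%E.
Proof.
move=> ri mC mphi GI mG rC rG A mA.
have mpre B : measurable B -> measurable (C `&` phi @^-1` B).
  by move=> mB; apply: measurableI => //; rewrite -[_ @^-1` _]setTI; exact: mphi.
have rS D : measurable D -> mu.-integrable D r.
  by move=> mD; apply: integrableS ri.
apply: (@dynkin_induction _ _ G (fun A => (\int[mu]_(x in C `&` phi @^-1` A) r x = 0)%E)) => //.
- by rewrite preimage_setT setIT.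
- move=> B mB hB; have := rC.
  have CE : C = (C `&` phi @^-1` B) `|` (C `&` phi @^-1` (~` B)).
    by rewrite -setIUr preimage_setC setUv setIT.
  have mB' := measurableC mB.
  rewrite {1}CE integral_setU//.
  + by rewrite hB add0e.
  + exact: mpre.
  + exact: mpre.
  + by rewrite -CE; apply: (measurable_int mu); exact: rS.
  + by apply/disj_setPS => x [[_ h1] [_ h2]].
- move=> F mF tF hF.
  rewrite preimage_bigcup setI_bigcupr integral_bigcup//.
  + by rewrite eseries0.
  + move=> i j _ _ [x [[_ h1] [_ h2]]]; apply: tF => //; exists (phi x).
    by [].
  + by move=> k; exact: mpre.
  + by apply: rS; apply: bigcupT_measurable => k; exact: mpre.
- by rewrite -mG.
Qed.

(** * Functions determined by their integrals over rectangles *)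

Section rectangles.
Context {R : realType}.
Local Notation leb := (@lebesgue_measure R).
Local Open Scope ereal_scope.

Lemma integral_rect_eq0 (r : plane R -> \bar R) : leb2.-integrable setT r ->
  (exists n, forall x, ~ box n x -> r x = 0) ->
  (forall A B, ocitv A -> ocitv B -> \int[leb2]_(x in A `*` B) r x = 0) ->
  {ae leb2, forall x, r x = 0}.
Proof.
move=> ri [n rn] rAB.
(* One unit wider than the box: the half-open interval with ends [-n] and [n] would miss the edge at
   [-n]. *)
pose I : set (measurableTypeR R) := `](- n.+1%:R)%R, n.+1%:R%R]%classic.
have oI : ocitv I by exact: is_ocitv.
have mo (A : set (measurableTypeR R)) : ocitv A -> measurable A.
  by move=> oA; exact: sub_sigma_algebra.
have boxI x : box n x -> I x.1 /\ I x.2.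
  by move=> [/= h1 h2]; split; move: h1 h2; rewrite /I /= !in_itv/= => /andP[h1 h2] /andP[h3 h4];
    apply/andP; split; rewrite -?natr1; lra.
have mr : measurable_fun setT r by exact: (measurable_int leb2 ri).
(* The bounded support of [r] lets a strip replace a rectangle, which starts the Dynkin induction on
   the whole line. *)
have sub (C C' : set (plane R)) : measurable C -> measurable C' -> C `<=` C' ->
    (forall x, C' x -> box n x -> C x) -> \int[leb2]_(x in C) r x = \int[leb2]_(x in C') r x.
  move=> mC mC' CC' hC; rewrite -(setDUK CC') integral_setU//.
  - rewrite (_ : \int[leb2]_(x in C' `\` C) r x = 0) ?adde0//.
    apply: integral0_eq => x [C'x nCx]; apply: rn => bx; apply: nCx; exact: hC.
  - exact: measurableD.
  - by apply: measurable_funS mr.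
  - by apply/disj_setPS => x [? []].
have omeas : @measurable _ (measurableTypeR R) = <<s @ocitv R >> by [].
have prod1 (A : set (measurableTypeR R)) (B : set (measurableTypeR R)) :
    measurable A -> ocitv B -> \int[leb2]_(x in A `*` B) r x = 0.
  move=> mA oB; have mB := mo _ oB.
  have h := @integral_eq0_pi_system R _ _ (plane R) (measurableTypeR R) leb2 r (setT `*` B) fst
    (@ocitv R) ri (measurableX measurableT mB) measurable_fst (@ocitvI R) omeas.
  rewrite (_ : A `*` B = setT `*` B `&` fst @^-1` A).
    apply: h => //.
      rewrite -(sub (I `*` B)) ?rAB//; first exact: measurableX (mo _ oI) mB.
      - exact: measurableX measurableT mB.
      - by move=> x [].
      - by move=> x [_ ?] /boxI[].
    move=> A' oA'; rewrite -(rAB A' B oA' oB); congr (integral _ _ _).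
    by apply/seteqP; split => [x [[_ ?] ?]|x [? ?]].
  by apply/seteqP; split => [x [? ?]|x [[_ ?] ?]].
have prod2 (A : set (measurableTypeR R)) (B : set (measurableTypeR R)) :
    measurable A -> measurable B -> \int[leb2]_(x in A `*` B) r x = 0.
  move=> mA mB.
  have h := @integral_eq0_pi_system R _ _ (plane R) (measurableTypeR R) leb2 r (A `*` setT) snd
    (@ocitv R) ri (measurableX mA measurableT) measurable_snd (@ocitvI R) omeas.
  rewrite (_ : A `*` B = A `*` setT `&` snd @^-1` B).
    apply: h => //.
      rewrite -(sub (A `*` I)) ?prod1//; first exact: measurableX mA (mo _ oI).
      - exact: measurableX mA measurableT.
      - by move=> x [].
      - by move=> x [? _] /boxI[].
    move=> B' oB'; rewrite -(prod1 A B' mA oB'); congr (integral _ _ _).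
    by apply/seteqP; split => [x [[? _] ?]|x [? ?]].
  by apply/seteqP; split => [x [? ?]|x [[? _] ?]].
have all0 (A : set (plane R)) : measurable A -> \int[leb2]_(x in A) r x = 0.
  move=> mA.
  have h := @integral_eq0_pi_system R _ _ (plane R) (plane R) leb2 r setT id
    [set A `*` B | A in measurable & B in measurable] ri measurableT (@measurable_id _ _ setT).
  rewrite -(setTI A) -[A]preimage_id; apply: h => //.
  - move=> _ _ [A1 mA1 [B1 mB1 <-]] [A2 mA2 [B2 mB2 <-]].
    exists (A1 `&` A2); first exact: measurableI.
    by exists (B1 `&` B2); [exact: measurableI|rewrite setXI].
  - exact: measurable_prod_measurableType.
  - by rewrite -setXTT; exact: prod2.
  - by move=> _ [A1 mA1 [B1 mB1 <-]]; rewrite setTI; exact: prod2.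
have := @integral_ae_eq _ (plane R) R leb2 setT measurableT (cst 0) r ri (measurable_cst _).
move=> h; have {}h : ae_eq leb2 setT r (cst 0).
  by apply: h => E _ mE; rewrite all0// integral0.
by apply: filterS h => x /(_ Logic.I).
Qed.

End rectangles.

Section inversion.
Context {R : realType}.
Local Notation leb := (@lebesgue_measure R).
Implicit Types (f g : plane R -> R[i]).

Lemma ae_leb2S (P Q : plane R -> Prop) : (forall x, P x -> Q x) ->
  {ae leb2, forall x, P x} -> {ae leb2, forall x, Q x}.
Proof. by move=> PQ; apply: filterS. Qed.

Lemma ae_leb2S2 (P Q S : plane R -> Prop) : (forall x, P x -> Q x -> S x) ->
  {ae leb2, forall x, P x} -> {ae leb2, forall x, Q x} -> {ae leb2, forall x, S x}.
Proof. by move=> PQ; apply: filterS2. Qed.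

(** The equality is between functions: the truncated transforms coincide at every point, so [xget]
    chooses from the same set of limits. *)
Lemma fourier_ae_eq f g : cmfun f -> cmfun g -> {ae leb2, forall x, f x = g x} ->
  fourier f = fourier g.
Proof.
move=> mf mg fg.
have E n : F1 (cut n f) = F1 (cut n g).
  apply/funext => xi; rewrite /F1; congr (_ * _); apply: ae_eq_cint.
  - by apply: cmfunM; [exact: cmfun_cut|exact: cmfun_cis_dot2].
  - by apply: cmfunM; [exact: cmfun_cut|exact: cmfun_cis_dot2].
  - by apply: filterS fg => x fgx; rewrite /cut fgx.
apply: (congr1 (xget (fun=> 0))); apply/funext => F; apply/propext.
rewrite /= !is_fourierP.
by rewrite (_ : (fun n => F1 (cut n f)) = (fun n => F1 (cut n g)))//; apply/funext.
Qed.

(** The product form suits tensor integrals, and half-open sides match the generating family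
    [ocitv]. *)
Definition indic_rect (a b c d : R) (x : plane R) : R :=
  \1_(`]a, b]%classic) x.1 * \1_(`]c, d]%classic) x.2.

Lemma measurable_indic_oc (a b : R) :
  measurable_fun (setT : set (measurableTypeR R)) (\1_(`]a, b]%classic) : _ -> R).
Proof. exact: measurable_indic (measurable_itv _). Qed.

Lemma measurable_indic_rect (a b c d : R) : measurable_fun setT (indic_rect a b c d).
Proof.
apply: measurable_funM.
  exact: (measurableT_comp (measurable_indic_oc a b) measurable_fst).
exact: (measurableT_comp (measurable_indic_oc c d) measurable_snd).
Qed.

Lemma indic_rectE (a b c d : R) (x : plane R) :
  indic_rect a b c d x = \1_(`]a, b]%classic `*` `]c, d]%classic) x.
Proof.
rewrite /indic_rect !indicE -natrM mulnb; congr (_%:R).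
by rewrite in_setX.
Qed.

Lemma cL1_indic_rect (a b c d : R) : cL1 leb2 (fun x => (indic_rect a b c d x)%:C).
Proof.
split; first exact: cmfunR (measurable_indic_rect a b c d).
have mr : measurable (`]a, b]%classic `*` `]c, d]%classic : set (plane R)).
  by apply: measurableX; exact: measurable_itv.
rewrite (_ : (\int[leb2]_x _ = \int[leb2]_x (\1_(`]a, b]%classic `*` `]c, d]%classic) x)%:E)%E).
  rewrite integral_indic// setIT leb2_rect; [|exact: measurable_itv..].
  rewrite !lebesgue_measure_itv/=.
  by case: ifP => _; case: ifP => _; rewrite ?mul0e ?mule0 -?EFinB -?EFinM ltry.
apply: eq_integral => x _; rewrite normcR indic_rectE ger0_norm//.
Qed.

Lemma cL2_indic_rect (a b c d : R) : cL2 leb2 (fun x => (indic_rect a b c d x)%:C).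
Proof.
have [m h] := cL1_indic_rect a b c d; split => //.
rewrite L2n_lty /n2; apply: le_lt_trans h; rewrite le_eqVlt; apply/orP; left.
apply/eqP/eq_integral => x _; rewrite normcR indic_rectE indicE.
by case: (x \in _); rewrite ?normr1 ?expr1n// normr0 expr0n.
Qed.

Lemma poisson_indic (e a b x : R) : 0 < e -> a < b ->
  (\int[leb]_y (\1_(`]a, b]%classic) y * poissonk e (x + y))%:E =
   (atan ((x + b) / e) - atan ((x + a) / e))%:E)%E.
Proof.
move=> e0 ab; rewrite -(integral_poisson_itv x e0 ab).
have mp : measurable_fun (setT : set (measurableTypeR R)) (fun y => poissonk e (x + y)).
  apply: (measurableT_comp (measurable_poissonk e0)).
  by apply: measurable_funD; [exact: measurable_cst|exact: measurable_id].
rewrite -integral_itv_obnd_cbnd; last by apply/measurable_EFinP; apply: measurable_funS mp.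
rewrite [RHS]integral_mkcond; apply: eq_integral => y _.
by rewrite patchE indicE; case: (y \in _); rewrite ?mul1r ?mul0r.
Qed.

Lemma cvg_div_harmonic (r : R) : 0 < r -> r / harmonic n @[n --> \oo] --> +oo.
Proof.
have h : (harmonic n)^-1 @[n --> \oo] --> (+oo : set_system R).
  under eq_fun do rewrite invrK; apply/cvgryPge => A; near=> n.
  rewrite (le_trans (ler_norm A))// -natr1 ler_wpDr//.
  by near: n; exact: nbhs_infty_ger.
by move=> r0; exact: (cvg_comp _ _ h (gt0_cvgMry r0 (@cvg_id _ _))).
Unshelve. all: by end_near. Qed.

Lemma atan_harmonic_cvg (r : R) : r != 0 ->
  atan (r / harmonic n) @[n --> \oo] --> (if 0 < r then pi / 2 else - (pi / 2)).
Proof.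
move=> r0; case: ifPn => [rp|].
  exact: (cvg_comp _ _ (cvg_div_harmonic rp) (@cvgy_atan R)).
rewrite -leNgt le_eqVlt (negbTE r0)/= => rn.
rewrite (_ : (fun n => _) = (fun n => - atan (- r / harmonic n))).
  apply: cvgN; apply: (cvg_comp _ _ (@cvg_div_harmonic (- r) _) (@cvgy_atan R)).
  by rewrite oppr_gt0.
by apply/funext => n; rewrite mulNr atanN opprK.
Qed.

(** Away from the endpoints each arctangent tends to [pi / 2] or [- (pi / 2)]; the two signs differ
    exactly when [- x] lies between [a] and [b]. *)
Lemma poisson_indic_cvg (a b x : R) : a < b -> x != - a -> x != - b ->
  pi^-1 * (atan ((x + b) / harmonic n) - atan ((x + a) / harmonic n))
    @[n --> \oo] --> (\1_(`]a, b]%classic) (- x) : R).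
Proof.
move=> ab xa xb.
have ha : x + a != 0 by rewrite addr_eq0.
have hb : x + b != 0 by rewrite addr_eq0.
rewrite (_ : \1__ (- x) = pi^-1 * ((if 0 < x + b then pi / 2 else - (pi / 2)) -
    (if 0 < x + a then pi / 2 else - (pi / 2)))).
  exact: (cvgM (@cvg_cst _ (pi^-1 : R) _ \oo _)
    (cvgB (atan_harmonic_cvg hb) (atan_harmonic_cvg ha))).
have p0 := pi_gt0 R; move: (@pi R) p0 => p p0.
have [h1|h1] := ltP 0 (x + b); have [h2|h2] := ltP 0 (x + a).
- by rewrite subrr mulr0 indicE memNset//= in_itv/= => /andP[]; lra.
- rewrite indicE mem_set/=; first by field; rewrite gt_eqF.
  rewrite in_itv/=; apply/andP; split; last lra.
  by rewrite lt_neqAle; apply/andP; split; [apply: contra ha => /eqP ->; rewrite subrr|lra].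
- lra.
- by rewrite subrr mulr0 indicE memNset//= in_itv/= => /andP[]; lra.
Qed.

Lemma abel_indic_rect (e a b c d : R) (x : plane R) : 0 < e -> a < b -> c < d ->
  cint leb2 (fun y => (indic_rect a b c d y)%:C * (K e (x + y))%:C) =
  ((pi^-1 * (atan ((x.1 + b) / e) - atan ((x.1 + a) / e))) *
   (pi^-1 * (atan ((x.2 + d) / e) - atan ((x.2 + c) / e))))%:C.
Proof.
move=> e0 ab cd.
have mp (u v w : R) : measurable_fun (setT : set (measurableTypeR R))
    (fun y => \1_(`]u, v]%classic) y * poissonk e (w + y)).
  apply: measurable_funM; first exact: measurable_indic_oc.
  apply: (measurableT_comp (measurable_poissonk e0)).
  by apply: measurable_funD; [exact: measurable_cst|exact: measurable_id].
have p0 (u v w y : R) : 0 <= \1_(`]u, v]%classic) y * poissonk e (w + y).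
  by rewrite mulr_ge0// poissonk_ge0// ltW.
rewrite (@eq_cint _ _ _ _ _ (fun y : plane R => (pi ^-2 *
  ((\1_(`]a, b]%classic) y.1 * poissonk e (x.1 + y.1)) *
   (\1_(`]c, d]%classic) y.2 * poissonk e (x.2 + y.2))))%:C)); last first.
  by move=> y; rewrite -rmorphM /indic_rect /K /=; congr (_%:C); ring.
rewrite normc_RRe /Rintegral; congr (_%:C).
under eq_integral do rewrite EFinM.
rewrite ge0_integralZl//; last 3 first.
- apply/measurable_EFinP/measurable_funM.
    exact: (measurableT_comp (mp a b x.1) measurable_fst).
  exact: (measurableT_comp (mp c d x.2) measurable_snd).
- by move=> y _; rewrite lee_fin mulr_ge0.
- by rewrite lee_fin invr_ge0 exprn_ge0// pi_ge0.
rewrite (@ge0_integral_prod _ _ _ _ _ leb leb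
  (fun y => \1_(`]a, b]%classic) y * poissonk e (x.1 + y))
  (fun y => \1_(`]c, d]%classic) y * poissonk e (x.2 + y)))//.
by rewrite !poisson_indic//= expr2 invfM mulrACA.
Qed.

Lemma ae_coord_neq (u v : R) : {ae (@leb2 R), forall x : plane R, x.1 != u /\ x.2 != v}.
Proof.
have m1 (w : R) : measurable ([set w] : set (measurableTypeR R)) by exact: measurable_set1.
have z (w : R) : leb [set w] = 0%E by exact: lebesgue_measure_set1.
exists (([set u] `*` setT) `|` (setT `*` [set v])); split.
- by apply: measurableU; apply: measurableX.
- apply: (@null_set_setU _ _ _ leb2); [exact: measurableX..| |].
    by rewrite leb2_rect// z mul0e.
  by rewrite leb2_rect// z mule0.
- move=> x /= nx; have [xu|xu] := eqVneq x.1 u; [by left|right].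
  by split => //=; apply/eqP; apply: contrapT => xv; apply: nx; split => //; apply/negP.
Qed.

(** The weighted functions [u n] converge in L2 to [F1 q], hence their transforms converge in L2 to
    the double transform. Those transforms are explicit products of arctangent differences, which
    off four lines converge to the reflected indicator. *)
Lemma fourier_inv_rect (a b c d : R) : a < b -> c < d ->
  {ae leb2, forall x, fourier (fourier (fun y => (indic_rect a b c d y)%:C)) x =
    (indic_rect a b c d (- x))%:C}.
Proof.
move=> ab cd; pose q (y : plane R) : R[i] := (indic_rect a b c d y)%:C; rewrite -/q.
have qL1 : cL1 leb2 q := cL1_indic_rect a b c d.
have qL2 : cL2 leb2 q := cL2_indic_rect a b c d.
have [mq _] := qL1.
have mF := cmfun_F1 mq.
have FL2 : cL2 leb2 (F1 q).
  split => //; apply: le_lt_trans (F1_contraction qL1 qL2) _; by case: qL2.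
have -> : fourier (fourier q) = fourier (F1 q).
  by apply: fourier_ae_eq => //; [case: (fourier_cL2 qL2)|exact: fourier_F1].
pose u n xi := F1 q xi * (W (harmonic n) xi)%:C.
have mu_ n : cmfun (u n).
  by apply: cmfunM => //; apply: cmfunR; exact: measurable_W.
have uL1 n : cL1 leb2 (u n).
  have [M hM] := F1_bounded qL1.
  rewrite /u; under eq_fun do rewrite mulrC.
  by apply: (cL1Mbounded (cL1_W (harmonic_gt0 n)) mF hM).
have uE n xi : u n xi - F1 q xi = (W (harmonic n) xi - 1)%:C * F1 q xi.
  by rewrite /u rmorphB/= mulrBl mul1r mulrC.
have uL2 n : cL2 leb2 (u n).
  apply: (cL2_le _ FL2); first exact: mu_.
  move=> xi; rewrite Normc.normcM normcR ger0_norm ?W_ge0//.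
  by rewrite ler_piMr ?normc_ge0// W_le1 ?harmonic_gt0.
have uF : L2cvg leb2 u (F1 q).
  apply: (L2cvg_dominated _ FL2); first exact: mu_.
    move=> n xi; rewrite uE Normc.normcM normcR ler_piMl ?normc_ge0//.
    rewrite ler_norml lerBrDl subrr W_ge0/= lerBlDr.
    by rewrite (le_trans (W_le1 (harmonic_gt0 n) xi))// lerDl.
  move=> xi.
  have : `|W (harmonic n) xi - 1| * normc (F1 q xi) @[n --> \oo] -->
      `|1 - 1 : R| * normc (F1 q xi).
    apply: cvgM; last exact: cvg_cst.
    by apply: cvg_norm; apply: cvgB; [exact: W_cvg1|exact: cvg_cst].
  rewrite subrr normr0 mul0r; under eq_fun do rewrite -normcR -Normc.normcM -uE.
  by [].
have FF := fourier_L2cvg uL2 FL2 uF.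
have FF1 : L2cvg leb2 (fun n => F1 (u n)) (fourier (F1 q)).
  apply/L2cvgP => e /((L2cvgP _ _ _).1 FF); apply: filterS => n.
  have [m1 _] := fourier_cL2 (uL2 n); have [m2 _] := fourier_cL2 FL2.
  rewrite (ae_eq_L2n (mu := leb2) (cmfunB m1 m2) (cmfunB (cmfun_F1 (mu_ n)) m2)) => [//|].
  by apply: ae_leb2S (fourier_F1 (uL1 n) (uL2 n)) => x ->.
apply: (L2cvg_ae_unique _ _ _ FF1).
- by move=> n; exact: cmfun_F1 (mu_ n).
- by case: (fourier_cL2 FL2).
- exact: (cmfun_comp measurable_plane_opp mq).
apply: ae_leb2S2 (ae_coord_neq (- a) (- c)) (ae_coord_neq (- b) (- d)) => x [xa xc] [xb xd].
have E n : F1 (u n) x - (indic_rect a b c d (- x))%:C =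
    ((pi^-1 * (atan ((x.1 + b) / harmonic n) - atan ((x.1 + a) / harmonic n))) *
   (pi^-1 * (atan ((x.2 + d) / harmonic n) - atan ((x.2 + c) / harmonic n))) -
   indic_rect a b c d (- x))%:C.
  by rewrite rmorphB /u F1_abel ?harmonic_gt0// abel_indic_rect ?harmonic_gt0.
pose r n : R := (pi^-1 * (atan ((x.1 + b) / harmonic n) - atan ((x.1 + a) / harmonic n))) *
  (pi^-1 * (atan ((x.2 + d) / harmonic n) - atan ((x.2 + c) / harmonic n))).
have : `|r n - indic_rect a b c d (- x)| @[n --> \oo] -->
    `|indic_rect a b c d (- x) - indic_rect a b c d (- x)|.
  apply: cvg_norm; apply: cvgB; last exact: cvg_cst.
  by apply: cvgM; exact: poisson_indic_cvg.
rewrite subrr normr0; under eq_fun do rewrite -normcR -E.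
by [].
Qed.

End inversion.

Section inversion.
Context {R : realType}.
Local Notation leb := (@lebesgue_measure R).
Implicit Types (f g u : plane R -> R[i]).

Lemma L2_rect_Re_eq0 u : cL2 leb2 u ->
  (forall a b c d, a < b -> c < d ->
    cint leb2 (fun x => u x * (indic_rect a b c d x)%:C) = 0) ->
  {ae leb2, forall x, Rec (u x) = 0}.
Proof.
move=> uL uq; have [mu_ _] := uL.
have mo (A : set (measurableTypeR R)) : ocitv A -> measurable A.
  by move=> oA; exact: sub_sigma_algebra.
have ReE a b c d x : Rec (u x * (indic_rect a b c d x)%:C) = Rec (u x) * indic_rect a b c d x.
  by rewrite RecM /= mulr0 subr0.
have E a b c d x : ((fun x => (Rec (u x))%:E) \_ (`]a, b]%classic `*` `]c, d]%classic)) x =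
    (Rec (u x * (indic_rect a b c d x)%:C))%:E.
  rewrite ReE indic_rectE patchE indicE.
  by case: (x \in _); rewrite ?mulr1// mulr0.
have uL1 a b c d := cL2M uL (cL2_indic_rect a b c d).
have rect0 A B : ocitv A -> ocitv B -> (\int[leb2]_(x in A `*` B) (Rec (u x))%:E = 0)%E.
  move=> /ocitvP[->|[[a b] /= ab ->]]; first by rewrite set0X integral_set0.
  move=> /ocitvP[->|[[c d] /= cd ->]]; first by rewrite setX0 integral_set0.
  rewrite integral_mkcond; under eq_integral do rewrite E.
  have := congr1 (@complex.Re R) (uq a b c d ab cd).
  have := integrable_fin_num measurableT (cL1_Re (uL1 a b c d)).
  by rewrite /cint /= /Rintegral; case: (\int[leb2]_x _)%E => //= r _ ->.
(* Restriction to a square supplies integrability and bounded support; the vanishing over rectangles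
   is inherited because rectangles intersect in rectangles. *)
have step n : {ae leb2, forall x, box n x -> Rec (u x) = 0}.
  pose I : set (measurableTypeR R) := `](- n.+1%:R), n.+1%:R]%classic.
  have oI : ocitv I by exact: is_ocitv.
  have mII : measurable (I `*` I : set (plane R)) by apply: measurableX; exact: mo.
  have ri : leb2.-integrable setT ((fun x => (Rec (u x))%:E) \_ (I `*` I)).
    apply: eq_integrable (cL1_Re (uL1 (- n.+1%:R) n.+1%:R (- n.+1%:R) n.+1%:R)) => //.
    by move=> x _; rewrite E.
  have := integral_rect_eq0 ri.
  have h1 : exists m, forall x : plane R, ~ box m x ->
      ((fun x => (Rec (u x))%:E) \_ (I `*` I)) x = 0%E.
    exists n.+1 => x nx; rewrite patchE memNset// => -[/= h1 h2]; apply: nx.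
    move: h1 h2; rewrite /I /= !in_itv/= => /andP[h1 h2] /andP[h3 h4].
    by split; rewrite /= in_itv/= (ltW h1, ltW h3).
  have h2 A B : ocitv A -> ocitv B ->
      (\int[leb2]_(x in A `*` B) ((fun x => (Rec (u x))%:E) \_ (I `*` I)) x = 0)%E.
    move=> oA oB; rewrite -integral_mkcondr -setXI.
    by apply: rect0; exact: ocitvI.
  move=> /(_ h1 h2); apply: ae_leb2S => x; rewrite patchE => + bx.
  rewrite mem_set; first by case.
  move: bx => [/= g1 g2]; move: g1 g2; rewrite /I /= !in_itv/= => /andP[g1 g2] /andP[g3 g4].
  by split; rewrite -?natr1; apply/andP; split; lra.
have : {ae leb2, forall x, forall n, box n x -> Rec (u x) = 0} by apply/ae_foralln.
apply: ae_leb2S => x h.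
by have [N _ hN] := box_near x; exact: (h N (hN N (leqnn N))).
Qed.

Lemma L2_rect_eq0 u : cL2 leb2 u ->
  (forall a b c d, a < b -> c < d ->
    cint leb2 (fun x => u x * (indic_rect a b c d x)%:C) = 0) ->
  {ae leb2, forall x, u x = 0}.
Proof.
(* Multiplication by [-i] makes the imaginary part of [u] the real part of [v]. *)
move=> uL uq; pose v (x : plane R) : R[i] := (0 +i* (-1)) * u x.
have vL : cL2 leb2 v by exact: cL2Z.
have hv : {ae leb2, forall x, Rec (v x) = 0}.
  apply: L2_rect_Re_eq0 => // a b c d ab cd.
  rewrite (@eq_cint _ _ _ _ _ (fun x => (0 +i* (-1)) * (u x * (indic_rect a b c d x)%:C))).
    by rewrite cintZ ?uq ?mulr0//; apply: cL2M => //; exact: cL2_indic_rect.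
  by move=> x; rewrite mulrA.
apply: ae_leb2S2 (L2_rect_Re_eq0 uL uq) hv => x h1.
rewrite /v RecM /= mul0r mulN1r sub0r opprK => h2.
by apply: complex_eq.
Qed.

(** Two uses of [fourier_sym] move both transforms onto the indicator of a rectangle, where
    inversion is known; such indicators separate L2 functions. *)
Lemma fourier_inv f : cL2 leb2 f ->
  {ae leb2, forall x, fourier (fourier f) x = f (- x)}.
Proof.
move=> fL; have FL := fourier_cL2 fL; have FFL := fourier_cL2 FL.
have fNL : cL2 leb2 (fun x : plane R => f (- x)).
  exact: (cL2_invariant measurable_plane_opp leb2_opp).
have dL := cL2B FFL fNL.
have : {ae leb2, forall x, fourier (fourier f) x - f (- x) = 0}.
  apply: (L2_rect_eq0 dL) => a b c d ab cd.
  pose q (y : plane R) : R[i] := (indic_rect a b c d y)%:C.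
  have qL : cL2 leb2 q := cL2_indic_rect a b c d.
  have [mq _] := qL; have [mf _] := fL.
  have L1 := cL2M FFL qL; have L2 := cL2M fNL qL.
  transitivity (cint leb2 (fun x : plane R => fourier (fourier f) x * q x - f (- x) * q x)).
    by apply: eq_cint => x; rewrite mulrBl.
  rewrite (cintB L1 L2) (fourier_sym FL qL) (fourier_sym fL (fourier_cL2 qL)).
  apply/eqP; rewrite subr_eq0; apply/eqP.
  transitivity (cint leb2 (fun x => f x * q (- x))).
    apply: ae_eq_cint.
    - by apply: cmfunM => //; case: (fourier_cL2 (fourier_cL2 qL)).
    - by apply: cmfunM => //; exact: (cmfun_comp measurable_plane_opp mq).
    - by apply: ae_leb2S (fourier_inv_rect ab cd) => x ->.
  rewrite -(cint_invariant measurable_plane_opp leb2_opp).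
    by apply: eq_cint => x; rewrite opprK.
  by apply: cmfunM => //; exact: (cmfun_comp measurable_plane_opp mq).
apply: ae_leb2S => x /eqP; rewrite subr_eq0 => /eqP //.
Qed.

(* The inverse transform of [f] is the reflection of [fourier f]. *)
Lemma fourier_opp f : cL2 leb2 f ->
  {ae leb2, forall x, fourier (fun y => f (- y)) x = fourier f (- x)}.
Proof.
move=> fL; have [mf _] := fL; have FL := fourier_cL2 fL; have [mF _] := FL.
have bE n (x : plane R) : box n (- x) <-> box n x.
  by rewrite /box; split=> -[/= h1 h2]; split; move: h1 h2; rewrite /= !in_itv/= => /andP[h1 h2]
    /andP[h3 h4]; apply/andP; split; lra.
have cutN n x : cut n f (- x) = cut n (fun y => f (- y)) x.
  have [nx|nx] := pselect (box n x); first by rewrite !cutE_in//; apply/bE.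
  by rewrite !cutE_out// => /bE.
have E n x : F1 (cut n (fun y => f (- y))) x = F1 (cut n f) (- x).
  rewrite /F1; congr (_ * _); rewrite -(cint_invariant measurable_plane_opp leb2_opp).
    by apply: eq_cint => y; rewrite -cutN opprK dotNl dotNr.
  apply: cmfunM; last exact: cmfun_cis_dot2.
  by apply: cmfun_cut; exact: (cmfun_comp measurable_plane_opp mf).
apply: fourier_unique; first exact: (cmfun_comp measurable_plane_opp mf).
apply/is_fourierP; split; first exact: (cL2_invariant measurable_plane_opp leb2_opp).
apply/L2cvgP => e e0; have := (L2cvgP _ _ _).1 (fourier_cvg fL) e e0.
apply: filterS => n; rewrite -(L2n_invariant measurable_plane_opp leb2_opp); last first.
  by apply: cmfunB => //; apply: cmfun_F1; exact: cmfun_cut.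
by under eq_fun do rewrite -E.
Qed.

(** Contraction holds at both stages of the double transform, which by inversion has the norm of [f]
    again. *)
Lemma fourier_isometry f : cL2 leb2 f -> L2n leb2 (fourier f) = L2n leb2 f.
Proof.
move=> fL; apply/eqP; rewrite eq_le fourier_contraction//=.
have FL := fourier_cL2 fL; have [mf _] := fL.
rewrite -(L2n_invariant measurable_plane_opp leb2_opp mf).
rewrite -(ae_eq_L2n (mu := leb2) _ _ (fourier_inv fL)).
- exact: fourier_contraction.
- by case: (fourier_cL2 FL).
- exact: (cmfun_comp measurable_plane_opp mf).
Qed.

(** The preimage is the reflected transform. It guarantees that the choice made in [fmult] has a
    candidate. *)
Lemma fourier_surj f : cL2 leb2 f ->
  exists2 u, cL2 leb2 u & {ae leb2, forall x, fourier u x = f x}.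
Proof.
move=> fL; have FL := fourier_cL2 fL.
exists (fun x => fourier f (- x)).
  exact: (cL2_invariant measurable_plane_opp leb2_opp).
have := ae_invariant measurable_plane_opp leb2_opp (fourier_inv fL).
by apply: ae_leb2S2 (fourier_opp FL) => x -> ->; rewrite opprK.
Qed.

End inversion.

(** * Transforms of products *)

Section convolution.
Context {R : realType}.
Implicit Types (f g k : plane R -> R[i]).

Definition conv k f (xi : plane R) : R[i] := cint leb2 (fun eta => k (xi - eta) * f eta).

Definition L1n k : R := fine (\int[leb2]_x (normc (k x))%:E).

Lemma L1n_ge0 k : 0 <= L1n k.
Proof. by rewrite fine_ge0// integral_ge0// => x _; rewrite lee_fin normc_ge0. Qed.

Lemma L1nE k : cL1 leb2 k -> (\int[leb2]_x (normc (k x))%:E <= (L1n k)%:E)%E.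
Proof.
move=> [_ ko]; rewrite fineK// ge0_fin_numE// integral_ge0// => x _.
by rewrite lee_fin normc_ge0.
Qed.

Lemma fine_L2nE f : cL2 leb2 f -> L2n leb2 f = (fine (L2n leb2 f))%:E.
Proof. by move=> [_ fo]; rewrite fineK// -L2n_fin_num. Qed.

Lemma int_sqr_L2n f : cL2 leb2 f ->
  (\int[leb2]_x (normc (f x) ^+ 2)%:E <= (fine (L2n leb2 f) ^+ 2)%:E)%E.
Proof.
move=> fL; rewrite -[leLHS]/(n2 leb2 f) -L2n_le_fin ?fine_ge0 ?L2n_ge0//.
by rewrite -fine_L2nE.
Qed.

Lemma cmfun_conv_kernel k f : cmfun k -> cmfun f ->
  cmfun (fun z : plane R * plane R => k (z.1 - z.2) * f z.2).
Proof.
move=> mk mf; apply: cmfunM; last exact: (cmfun_comp measurable_snd mf).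
exact: (cmfun_comp measurable_plane_sub2 mk).
Qed.

Lemma conv_kernel_le k f (x y : plane R) :
  normc ((fun z : plane R * plane R => k (z.1 - z.2) * f z.2) (x, y)) <=
  normc (k (x - y)) * normc (f y).
Proof. by rewrite /= Normc.normcM. Qed.

Lemma cmfun_conv k f : cmfun k -> cmfun f -> cmfun (conv k f).
Proof. by move=> mk mf; exact: (cmfun_kernel_operator (cmfun_conv_kernel mk mf)). Qed.

Lemma L2n_conv_le k f (b : R) : cL1 leb2 k -> cmfun f -> 0 <= b ->
  (L2n leb2 f <= b%:E)%E -> (L2n leb2 (conv k f) <= (L1n k * b)%:E)%E.
Proof.
move=> kL mf b0 fb; have [mk _] := kL.
apply: (young (cmfun_conv_kernel mk mf) (cmfun_normc mk) (cmfun_normc mf)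
  (fun x => normc_ge0 _) (fun x => normc_ge0 _) (conv_kernel_le k f) (L1n_ge0 k) b0 (L1nE kL)).
by rewrite -[leLHS]/(n2 leb2 f) -L2n_le_fin.
Qed.

Lemma cL2_conv k f : cL1 leb2 k -> cL2 leb2 f -> cL2 leb2 (conv k f).
Proof.
move=> kL fL; have [mk _] := kL; have [mf _] := fL; split; first exact: cmfun_conv.
apply: (@le_lt_trans _ _ ((L1n k * fine (L2n leb2 f))%:E)); last by rewrite ltry.
by apply: L2n_conv_le => //; rewrite ?fine_ge0 ?L2n_ge0// -fine_L2nE.
Qed.

Lemma conv_ae k f : cL1 leb2 k -> cL2 leb2 f ->
  {ae leb2, forall xi, cL1 leb2 (fun eta : plane R => k (xi - eta) * f eta)}.
Proof.
move=> kL fL; have [mk _] := kL; have [mf _] := fL.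
have := (young_ae (cmfun_conv_kernel mk mf) (cmfun_normc mk) (cmfun_normc mf)
  (fun x => normc_ge0 _) (fun x => normc_ge0 _) (conv_kernel_le k f) (L1nE kL)
  (int_sqr_L2n fL)).
by apply: ae_leb2S => xi.
Qed.

Let c0 : R := (2 * pi)^-1.

Lemma F1_opp f xi : cmfun f -> F1 f (- xi) = F1 (fun x : plane R => f (- x)) xi.
Proof.
move=> mf; rewrite /F1; congr (_ * _).
rewrite -(cint_invariant measurable_plane_opp leb2_opp).
  by apply: eq_cint => x; rewrite dotNl dotNr opprK.
by apply: cmfunM => //; exact: cmfun_cis_dot2.
Qed.

Lemma F1_cis f (xi zeta : plane R) : cL1 leb2 f ->
  F1 (fun x => f x * cis (- dot x xi)) zeta = F1 f (zeta + xi).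
Proof.
move=> fL; rewrite /F1; congr (_ * _); apply: eq_cint => x.
by rewrite -mulrA -cisD; congr (_ * cis _); rewrite /dot /=; ring.
Qed.

Lemma cL1_shift_mul k f (xi : plane R) (M : R) : cL1 leb2 k -> cmfun f ->
  (forall x, normc (f x) <= M) -> cL1 leb2 (fun eta : plane R => k (xi - eta) * f eta).
Proof.
move=> kL mf fM; apply: (cL1Mbounded _ mf fM).
exact: (cL1_invariant (measurable_plane_subr xi) (leb2_subr xi)).
Qed.

(** Multiplying [f] by a character shifts its transform, so the multiplication formula for the
    modulated [f] and the reflected [k] is already the convolution. *)
Lemma F1_mul_F1 f k xi : cL1 leb2 f -> cL1 leb2 k ->
  F1 (fun x => f x * F1 k (- x)) xi = c0%:C * conv k (F1 f) xi.
Proof.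
move=> fL kL; have [mk _] := kL; have [mf _] := fL.
have kNL := cL1_invariant measurable_plane_opp leb2_opp kL.
rewrite {1}/F1; congr (_ * _).
transitivity (cint leb2 (fun x => (f x * cis (- dot x xi)) * F1 (fun y : plane R => k (- y)) x)).
  by apply: eq_cint => x; rewrite F1_opp//; ring.
rewrite -(cint_F1_sym (cL1_cis xi fL) kNL).
rewrite -(cint_invariant (measurable_plane_shift (- xi)) (leb2_shift (- xi))).
  by apply: eq_cint => x; rewrite F1_cis// subrK opprB mulrC.
apply: cmfunM; last exact: (cmfun_comp measurable_plane_opp mk).
by apply: cmfun_F1; case: (cL1_cis xi fL).
Qed.

Lemma F1_ae_eq f g xi : cmfun f -> cmfun g -> {ae leb2, forall x, f x = g x} ->
  F1 f xi = F1 g xi.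
Proof.
move=> mf mg fg; rewrite /F1; congr (_ * _); apply: ae_eq_cint.
- by apply: cmfunM => //; exact: cmfun_cis_dot2.
- by apply: cmfunM => //; exact: cmfun_cis_dot2.
- by apply: ae_leb2S fg => x ->.
Qed.

Lemma fourier_inv_F1 g : cL2 leb2 g -> cL1 leb2 (fourier g) ->
  {ae leb2, forall x, g x = F1 (fourier g) (- x)}.
Proof.
move=> gL GL1; have GL2 := fourier_cL2 gL.
have h := ae_leb2S2 (fun x (e1 : fourier (fourier g) x = F1 (fourier g) x)
  (e2 : fourier (fourier g) x = g (- x)) => etrans (esym e1) e2) (fourier_F1 GL1 GL2)
  (fourier_inv gL).
have := ae_invariant measurable_plane_opp leb2_opp h.
by apply: ae_leb2S => x ->; rewrite opprK.
Qed.

(** As [fourier g] is integrable, [g] is almost everywhere an absolutely convergent inverse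
    transform, and [F1_mul_F1] gives the identity at each truncation of [f]. Young's inequality
    carries it to the limit. *)
Lemma fourierM f g : cL2 leb2 f -> cL2 leb2 g -> cL1 leb2 (fourier g) ->
  {ae leb2, forall xi, fourier (fun x => f x * g x) xi =
    c0%:C * conv (fourier g) (fourier f) xi}.
Proof.
move=> fL gL; set G := fourier g => GL1; have GL2 : cL2 leb2 G := fourier_cL2 gL.
have [mf _] := fL; have [mg _] := gL; have [mG _] := GL1.
have FL := fourier_cL2 fL; have [mF _] := FL.
have c0_ge : 0 <= c0 by rewrite invr_ge0 mulr_ge0// pi_ge0.
apply: fourier_unique; first exact: cmfunM.
apply/is_fourierP; split; first by apply: cL2Z; exact: cL2_conv.
have E n xi : F1 (cut n (fun x => f x * g x)) xi = c0%:C * conv G (F1 (cut n f)) xi.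
  rewrite -F1_mul_F1//; last exact: cL1_cut.
  apply: F1_ae_eq; first by apply: cmfun_cut; exact: cmfunM.
    apply: cmfunM; first exact: cmfun_cut.
    exact: (cmfun_comp measurable_plane_opp (cmfun_F1 mG)).
  by apply: ae_leb2S (fourier_inv_F1 gL GL1) => x gx; rewrite /cut gx mulrA.
apply/L2cvgP => e e0.
(* The added [1] keeps the divisor positive even when [fourier g] has zero L1 norm. *)
pose M := c0 * L1n G + 1.
have M0 : 0 < M by rewrite ltr_wpDl// mulr_ge0// L1n_ge0.
have := (L2cvgP _ _ _).1 (fourier_cvg fL) _ (divr_gt0 e0 M0).
apply: filterS => n hn.
have m1 := cmfun_F1 (cmfun_cut n mf).
pose D (xi : plane R) := F1 (cut n f) xi - fourier f xi.
have mD : cmfun D by exact: cmfunB.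
have aeE : {ae leb2, forall xi, F1 (cut n (fun x => f x * g x)) xi -
    c0%:C * conv G (fourier f) xi = c0%:C * conv G D xi}.
  apply: ae_leb2S (conv_ae GL1 FL) => xi hxi.
  rewrite E -mulrBr /conv -cintB//.
    by congr (_ * _); apply: eq_cint => x; rewrite mulrBr.
  have [B hB] := F1_bounded (cL1_cut n fL).
  exact: (cL1_shift_mul xi GL1 m1 hB).
have mC u : cmfun u -> cmfun (fun xi => c0%:C * conv G u xi).
  by move=> mu_; apply: cmfunM; [exact: cmfun_cst|exact: cmfun_conv].
rewrite (ae_eq_L2n _ (mC _ mD) aeE); last first.
  apply: cmfunB; last exact: mC.
  by apply: cmfun_F1; apply: cmfun_cut; exact: cmfunM.
rewrite L2nZ; last exact: cmfun_conv.
rewrite normcR ger0_norm//.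
have h := L2n_conv_le GL1 mD (ltW (divr_gt0 e0 M0)) hn.
have h2 : (c0%:E * L2n leb2 (conv G D) <= c0%:E * (L1n G * (e / M))%:E)%E.
  by apply: lee_wpmul2l => //; rewrite lee_fin.
have aux (a b c d : R) : a * (b * (c / d)) = c * (a * b / d) by ring.
apply: (le_trans h2); rewrite -EFinM lee_fin aux.
by rewrite ler_piMr ?(ltW e0)// ler_pdivrMr// mul1r /M lerDl.
Qed.

End convolution.

(** * Estimates of the symbol *)

Section powers_of_logarithms.
Context {R : realType}.
Implicit Types (x y z r s t mu d : R).

Lemma le_powR mu x y : 0 <= mu -> 0 <= x -> x <= y -> x `^ mu <= y `^ mu.
Proof.
by move=> mu0 x0 xy; apply: ge0_ler_powR; rewrite ?nnegrE// (le_trans x0).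
Qed.

Lemma powR_ge1 mu t : 0 <= mu -> 1 <= t -> 1 <= t `^ mu.
Proof. by move=> mu0 t1; rewrite -(powRr0 t) ler_powR. Qed.

(** Comparison with the largest summand covers convex and concave powers at once. *)
Lemma powRD3_le mu x y z : 0 <= mu -> 0 <= x -> 0 <= y -> 0 <= z ->
  (x + y + z) `^ mu <= 3 `^ mu * (x `^ mu + y `^ mu + z `^ mu).
Proof.
move=> mu0 x0 y0 z0; pose m := Num.max x (Num.max y z).
have m0 : 0 <= m by rewrite le_max x0.
have xm : x <= m by rewrite le_max lexx.
have ym : y <= m by rewrite !le_max lexx orbT.
have zm : z <= m by rewrite !le_max lexx !orbT.
apply: (@le_trans _ _ ((3 * m) `^ mu)).
  by apply: le_powR => //; [rewrite !addr_ge0|lra].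
rewrite powRM// ler_wpM2l ?powR_ge0//.
have := powR_ge0 x mu; have := powR_ge0 y mu; have := powR_ge0 z mu.
rewrite /m /Order.max; case: ifP => _; first by case: ifP => _; lra.
lra.
Qed.

(* Bernoulli's inequality for an integer exponent above [mu]. *)
Lemma powR_sub_le mu (N : nat) x y : (0 < N)%N -> 0 <= mu -> mu <= N%:R ->
    0 < y -> 0 <= x -> x <= y ->
  y `^ mu - x `^ mu <= N%:R * y `^ mu * ((y - x) / y).
Proof.
move=> N0 mu0 muN y0 x0 xy.
pose q := x / y.
have q0 : 0 <= q by rewrite divr_ge0// ltW.
have q1 : q <= 1 by rewrite ler_pdivrMr// mul1r.
have xE : x = q * y by rewrite /q divfK// gt_eqF.
have -> : (y - x) / y = 1 - q by rewrite /q mulrBl divff// gt_eqF.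
rewrite xE powRM// ?(ltW y0)//.
suff h : 1 - q `^ mu <= N%:R * (1 - q).
  have := powR_ge0 y mu; nra.
have bern : 1 - q ^+ N <= N%:R * (1 - q).
  elim: (N) => [|n ih]; first by rewrite expr0 subrr mul0r.
  rewrite exprS -natr1.
  have : 0 <= q ^+ n by rewrite exprn_ge0.
  have : q ^+ n <= 1 by rewrite exprn_ile1.
  nra.
apply: le_trans bern; rewrite lerB//.
move: q0; rewrite le_eqVlt => /predU1P[<-|q0].
  by rewrite expr0n gtn_eqF// powR_ge0.
by rewrite -powR_mulrn ?(ltW q0)//; apply: ger_powR; rewrite ?q0.
Qed.

Lemma ln_powR_le mu d : 0 <= mu -> 0 < d ->
  exists2 C : R, 0 <= C & forall t, 1 <= t -> ln t `^ mu <= C * t `^ d.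
Proof.
move=> mu0 d0; move: mu0; rewrite le_eqVlt => /predU1P[<-|mu0].
  by exists 1 => // t t1; rewrite powRr0 mul1r powR_ge1// ltW.
(* The inequality [ln t <= t^e / e], raised to the power [mu], produces exactly the exponent [d]. *)
pose e := d / mu; have e0 : 0 < e by rewrite divr_gt0.
exists (e^-1 `^ mu) => [|t t1]; first exact: powR_ge0.
have t0 : 0 < t by rewrite (lt_le_trans ltr01).
have te0 : 0 < t `^ e by rewrite powR_gt0.
have h : ln t <= e^-1 * t `^ e.
  rewrite ler_pdivlMl// -ln_powR.
  have h : -1 < t `^ e - 1 by lra.
  have := le_ln1Dx h; rewrite addrC subrK; lra.
apply: (@le_trans _ _ ((e^-1 * t `^ e) `^ mu)).
  by apply: le_powR => //; [exact: ltW|exact: ln_ge0].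
rewrite powRM ?invr_ge0 ?(ltW e0) ?(ltW te0)// -powRrM.
by rewrite /e divfK// gt_eqF.
Qed.

Lemma ln_ge_frac y : 0 <= y -> y / (1 + y) <= ln (1 + y).
Proof.
move=> y0; have y1 : 0 < 1 + y by rewrite ltr_pwDl.
have i0 : 0 < (1 + y)^-1 by rewrite invr_gt0.
have h : -1 < (1 + y)^-1 - 1 by lra.
have := le_ln1Dx h; rewrite [1 + _]addrC subrK lnV ?posrE//.
have -> : y / (1 + y) = 1 - (1 + y)^-1 by field; rewrite gt_eqF.
lra.
Qed.

Definition lnw mu r : R := ln (1 + r ^+ 2) `^ mu.

Lemma lnw_ge0 mu r : 0 <= lnw mu r. Proof. exact: powR_ge0. Qed.

(** A finite-difference form of [r * w' <= C * w], which holds even though the derivative of [w] may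
    blow up at the origin when [mu] is small. The factor [r] comes from the derivative symbol. *)
Lemma lnw_increment mu : 0 <= mu -> exists2 C : R, 0 <= C &
  forall r s, 0 <= r -> r <= s -> r * (lnw mu s - lnw mu r) <= C * (s - r) * lnw mu s.
Proof.
move=> mu0; pose N := (Num.bound mu).+1.
have muN : mu <= N%:R.
  by rewrite -natr1 ler_wpDr// ltW//; exact: archi_boundP.
have N1 : 1 <= N%:R :> R by rewrite ler1n.
exists (3 * N%:R) => [|r s r0 rs]; first by rewrite mulr_ge0.
have s0 := le_trans r0 rs.
have ws := lnw_ge0 mu s; have wr := lnw_ge0 mu r.
(* For [s > 2 * r] the factor [r] is already at most [s - r], and no increment estimate is
   needed. *)
have [s2|s2] := leP s (2 * r); last first.
  apply: (@le_trans _ _ ((s - r) * lnw mu s)); first by nra.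
  rewrite -mulrA; have : 0 <= (s - r) * lnw mu s by rewrite mulr_ge0// subr_ge0.
  set p := (s - r) * _; nra.
move: r0; rewrite le_eqVlt => /predU1P[r0|r0].
  by rewrite -r0 mul0r mulr_ge0// mulr_ge0 ?mulr_ge0 ?subr_ge0// r0.
have sgt : 0 < s by rewrite (lt_le_trans r0).
pose a := ln (1 + r ^+ 2); pose b := ln (1 + s ^+ 2).
have r2 : 0 <= r ^+ 2 by rewrite sqr_ge0.
have s2' : 0 <= s ^+ 2 by rewrite sqr_ge0.
have r1 : 0 < 1 + r ^+ 2 by rewrite ltr_pwDl.
have s1 : 0 < 1 + s ^+ 2 by rewrite ltr_pwDl.
have rs2 : r ^+ 2 <= s ^+ 2 by rewrite ler_pXn2r ?nnegrE// ltW.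
have a0 : 0 <= a by rewrite ln_ge0// lerDl.
have ab : a <= b by rewrite ler_ln ?posrE// lerD2l.
have b0 : 0 < b by rewrite ln_gt0// ltrDl exprn_gt0.
(* Bernoulli leaves the relative increment [(b - a) / b] of the logarithm: [h2] bounds the numerator
   and [h3] bounds [b] below, which controls the quotient near the origin. *)
have h1 := powR_sub_le (ltn0Sn _) mu0 muN b0 a0 ab.
have h2 : (b - a) * (1 + r ^+ 2) <= (s - r) * (s + r).
  have q0 : 0 < (1 + s ^+ 2) / (1 + r ^+ 2) by rewrite divr_gt0.
  have h : -1 < (1 + s ^+ 2) / (1 + r ^+ 2) - 1 by lra.
  have := le_ln1Dx h; rewrite [1 + (_ - 1)]addrC subrK ln_div ?posrE// -/a -/b.
  have -> : (1 + s ^+ 2) / (1 + r ^+ 2) - 1 = (s - r) * (s + r) / (1 + r ^+ 2).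
    by field; rewrite gt_eqF.
  by rewrite ler_pdivlMr.
have h3 : r ^+ 2 <= b * (1 + r ^+ 2).
  rewrite -ler_pdivrMr//; apply: le_trans ab; exact: ln_ge_frac.
(* The constant [3] comes from [s + r <= 3 * r], valid in the range [s <= 2 * r]. *)
have h4 : r * ((b - a) / b) <= 3 * (s - r).
  rewrite mulrA ler_pdivrMr// -(ler_pM2r r1).
  have : r * ((s - r) * (s + r)) <= 3 * (s - r) * r ^+ 2.
    have : 0 <= (s - r) * r by rewrite mulr_ge0 ?subr_ge0// ltW.
    nra.
  have : 3 * (s - r) * r ^+ 2 <= 3 * (s - r) * (b * (1 + r ^+ 2)).
    by rewrite ler_wpM2l// mulr_ge0// subr_ge0.
  nra.
rewrite -/(lnw mu s) -/(lnw mu r) in h1.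
apply: (@le_trans _ _ (r * (N%:R * lnw mu s * ((b - a) / b)))).
  by rewrite ler_wpM2l ?(ltW r0).
have : 0 <= N%:R * lnw mu s by rewrite mulr_ge0.
set c := N%:R * lnw mu s => c0.
rewrite (_ : 3 * N%:R * (s - r) * lnw mu s = c * (3 * (s - r))); last by rewrite /c; ring.
by rewrite mulrCA ler_wpM2l.
Qed.

End powers_of_logarithms.

(** * The symbol and its weights on the plane *)

Section symbol.
Context {R : realType}.
Implicit Types (mu d e : R) (x y z xi eta : plane R).

(** The square of the Japanese bracket, whence the halved exponents below. *)
Definition jap x : R := 1 + dot x x.
Definition enorm x : R := Num.sqrt (dot x x).
Definition lnj mu x : R := ln (jap x) `^ mu.

Lemma dot_ge0 x : 0 <= dot x x.
Proof. by rewrite /dot addr_ge0// -expr2 sqr_ge0. Qed.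

Lemma jap_ge1 x : 1 <= jap x. Proof. by rewrite lerDl dot_ge0. Qed.
Lemma jap_gt0 x : 0 < jap x. Proof. exact: lt_le_trans ltr01 (jap_ge1 x). Qed.

Lemma enorm_ge0 x : 0 <= enorm x. Proof. exact: sqrtr_ge0. Qed.

Lemma enormE x : enorm x = normc (x.1 +i* x.2).
Proof. by rewrite /enorm /dot /= -!expr2. Qed.

Lemma enorm_sqr x : enorm x ^+ 2 = dot x x.
Proof. by rewrite sqr_sqrtr// dot_ge0. Qed.

Lemma enorm_dist x y : `|enorm x - enorm y| <= enorm (x - y).
Proof. by rewrite !enormE; exact: ler_dist_normc. Qed.

Lemma enorm_distC x y : enorm (x - y) = enorm (y - x).
Proof. by rewrite -opprB /enorm dotNl dotNr opprK. Qed.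

Lemma coord_le_enorm (j : 'I_2) x : `|coord j x| <= enorm x.
Proof.
rewrite enormE /coord; case: ifP => _; first exact: (le_Rec_normc (x.1 +i* x.2)).
exact: (le_Imc_normc (x.1 +i* x.2)).
Qed.

Lemma coordB (j : 'I_2) x y : coord j (x - y) = coord j x - coord j y.
Proof. by rewrite /coord; case: ifP. Qed.

Lemma enorm_le_jap x : enorm x <= jap x `^ 2^-1.
Proof.
by rewrite powR12_sqrt ?(ltW (jap_gt0 x))// ler_wsqrtr// lerDr.
Qed.

Lemma lnj_ge0 mu x : 0 <= lnj mu x. Proof. exact: powR_ge0. Qed.

Lemma lnjE mu x : lnj mu x = lnw mu (enorm x).
Proof. by rewrite /lnw enorm_sqr. Qed.

Lemma normc_symbol mu j x :
  normc (lnpow_deriv_symbol mu j x) = lnj mu x * `|coord j x|.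
Proof.
rewrite /lnpow_deriv_symbol Normc.normcM normcR ger0_norm ?powR_ge0//.
by congr (_ * _); rewrite /= expr0n add0r sqrtr_sqr.
Qed.

Lemma normc_symbolB mu j x y :
  normc (lnpow_deriv_symbol mu j x - lnpow_deriv_symbol mu j y) =
  `|lnj mu x * coord j x - lnj mu y * coord j y|.
Proof.
rewrite (_ : _ - _ = 0 +i* (lnj mu x * coord j x - lnj mu y * coord j y)).
  by rewrite /= expr0n add0r sqrtr_sqr.
rewrite /lnpow_deriv_symbol -/(jap x) -/(jap y) -/(lnj mu x) -/(lnj mu y).
by apply: complex_eq; rewrite ?(RecD, ImcD, RecN, ImcN, RecM, ImcM) /=; ring.
Qed.

(** The bound is symmetric, so [x] may be taken as the longer vector. The difference then splits
    into [lnj mu x] times the increment of the coordinate, and a coordinate of the shorter vector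
    times the increment of the logarithm, which is the case of [lnw_increment]. *)
Lemma symbol_difference_local mu : 0 <= mu -> exists2 C : R, 0 <= C &
  forall j x y, normc (lnpow_deriv_symbol mu j x - lnpow_deriv_symbol mu j y) <=
    C * enorm (x - y) * (lnj mu x + lnj mu y).
Proof.
move=> mu0; have [C C0 hC] := @lnw_increment R mu mu0.
exists (1 + C) => [|j x y]; first by rewrite addr_ge0.
rewrite normc_symbolB.
wlog : x y / enorm y <= enorm x.
  move=> h; have [xy|/ltW xy] := leP (enorm y) (enorm x); first exact: h.
  by have := h _ _ xy; rewrite distrC enorm_distC (addrC (lnj mu y)).
move=> yx.
have hx := lnj_ge0 mu x; have hy := lnj_ge0 mu y.
have e0 := enorm_ge0 (x - y).
have dxy : enorm x - enorm y <= enorm (x - y).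
  by apply: le_trans (enorm_dist x y); exact: ler_norm.
have h1 : `|lnj mu x * coord j x - lnj mu y * coord j y| <=
    lnj mu x * enorm (x - y) + enorm y * (lnj mu x - lnj mu y).
  rewrite (_ : _ - _ = lnj mu x * coord j (x - y) + coord j y * (lnj mu x - lnj mu y)); last first.
    by rewrite coordB; ring.
  apply: le_trans (ler_normD _ _) _; rewrite !normrM; apply: lerD.
    by rewrite ger0_norm// ler_wpM2l// coord_le_enorm.
  have m : 0 <= lnj mu x - lnj mu y.
    rewrite subr_ge0; apply: le_powR => //; first by rewrite ln_ge0// jap_ge1.
    rewrite ler_ln ?posrE ?jap_gt0// lerD2l -!enorm_sqr.
    by rewrite ler_pXn2r ?nnegrE ?enorm_ge0.
  by rewrite (ger0_norm m) ler_wpM2r// coord_le_enorm.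
apply: le_trans h1 _.
have h2 := hC _ _ (enorm_ge0 y) yx; rewrite -!lnjE in h2.
have h3 : C * (enorm x - enorm y) * lnj mu x <= C * enorm (x - y) * lnj mu x.
  by rewrite ler_wpM2r// ler_wpM2l.
have h4 : 0 <= (1 + C) * enorm (x - y) * lnj mu y by rewrite !mulr_ge0// addr_ge0.
nra.
Qed.

Lemma dotD_le x y : dot x x <= 2 * (dot y y + dot (x - y) (x - y)).
Proof.
rewrite /dot /=; have := sqr_ge0 (x.1 - 2 * y.1); have := sqr_ge0 (x.2 - 2 * y.2).
rewrite !expr2; nra.
Qed.

(** The logarithm turns the product inequality [jap x <= 2 * jap y * jap (x - y)] into a sum; the
    term in [x - y] is absorbed by an arbitrarily small power. *)
Lemma lnj_peetre mu e : 0 <= mu -> 0 < e -> exists2 C : R, 0 <= C &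
  forall x y, lnj mu x <= C * (1 + lnj mu y) * jap (x - y) `^ e.
Proof.
move=> mu0 e0; have [B B0 hB] := @ln_powR_le R mu e mu0 e0.
pose l2 : R := ln 2; have l20 : 0 <= l2 by rewrite ln_ge0// ler1n.
exists (3 `^ mu * (l2 `^ mu + 1 + B)) => [|x y].
  by rewrite mulr_ge0 ?powR_ge0// !addr_ge0// powR_ge0.
have y0 := jap_gt0 y; have z0 := jap_gt0 (x - y).
have Ly : 0 <= ln (jap y) by rewrite ln_ge0// jap_ge1.
have Lz : 0 <= ln (jap (x - y)) by rewrite ln_ge0// jap_ge1.
have h1 : ln (jap x) <= l2 + ln (jap y) + ln (jap (x - y)).
  rewrite /l2 -lnM ?posrE// -lnM ?posrE ?mulr_gt0//.
  rewrite ler_ln ?posrE ?jap_gt0 ?mulr_gt0//.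
  have := dotD_le x y; have := dot_ge0 y; have := dot_ge0 (x - y).
  rewrite /jap; nra.
have h2 : lnj mu x <= 3 `^ mu * (l2 `^ mu + lnj mu y + lnj mu (x - y)).
  apply: le_trans (powRD3_le mu0 l20 Ly Lz); apply: le_powR => //.
  by rewrite ln_ge0// jap_ge1.
have h3 : lnj mu (x - y) <= B * jap (x - y) `^ e by apply: hB; exact: jap_ge1.
have t1 : 1 <= jap (x - y) `^ e by apply: powR_ge1; [exact: ltW|exact: jap_ge1].
apply: le_trans h2 _; rewrite -!mulrA ler_wpM2l ?powR_ge0//.
have Y := lnj_ge0 mu y; have L := powR_ge0 l2 mu.
apply: (@le_trans _ _ (l2 `^ mu + lnj mu y + B * jap (x - y) `^ e)); first by rewrite lerD2l.
set t := jap (x - y) `^ e in t1 *; set a := l2 `^ mu in L *; set b := lnj mu y in Y *.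
have -> : (a + 1 + B) * ((1 + b) * t) = a * t + b * t + B * t + t + a * b * t + B * b * t by ring.
have : a <= a * t by rewrite ler_peMr.
have : b <= b * t by rewrite ler_peMr.
have : 0 <= a * b * t by rewrite !mulr_ge0// (le_trans ler01).
have : 0 <= B * b * t by rewrite !mulr_ge0// (le_trans ler01).
lra.
Qed.

(** Of the exponent [(1 + e) / 2], one half pays for [enorm (x - y)] and [e / 2] for moving the
    weight from [x] to [y], where the transform of [f] is evaluated. *)
Lemma symbol_difference mu e : 0 <= mu -> 0 < e -> exists2 C : R, 0 <= C &
  forall j x y, normc (lnpow_deriv_symbol mu j x - lnpow_deriv_symbol mu j y) <=
    C * jap (x - y) `^ ((1 + e) / 2) * (1 + lnj mu y).
Proof.
move=> mu0 e0; have [C C0 hC] := symbol_difference_local mu0.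
have e2 : 0 < e / 2 by rewrite divr_gt0.
have [B B0 hB] := lnj_peetre mu0 e2.
exists (C * (B + 1)) => [|j x y]; first by rewrite mulr_ge0// addr_ge0.
apply: le_trans (hC j x y) _.
have z0 := jap_gt0 (x - y).
have -> : jap (x - y) `^ ((1 + e) / 2) = jap (x - y) `^ 2^-1 * jap (x - y) `^ (e / 2).
  rewrite -powRD; last by apply/implyP => _; rewrite gt_eqF.
  by congr (_ `^ _); field.
have h1 := enorm_le_jap (x - y).
have Y := lnj_ge0 mu y; have X := lnj_ge0 mu x.
have h2 : lnj mu x + lnj mu y <= (B + 1) * (1 + lnj mu y) * jap (x - y) `^ (e / 2).
  have t1 : 1 <= jap (x - y) `^ (e / 2).
    by apply: powR_ge1; [exact: ltW|exact: jap_ge1].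
  have := hB x y; set t := _ `^ _ in t1 *.
  have : lnj mu y <= (1 + lnj mu y) * t by nra.
  nra.
rewrite -!mulrA ler_wpM2l//.
apply: (@le_trans _ _ (jap (x - y) `^ 2^-1 * (lnj mu x + lnj mu y))).
  by rewrite ler_wpM2r// addr_ge0.
rewrite [leRHS]mulrCA ler_wpM2l ?powR_ge0//.
by rewrite [X in (B + 1) * X]mulrC mulrA.
Qed.

(** A crude bound suffices here: it lets two derivatives of a test function absorb the symbol. *)
Lemma symbol_growth mu : 0 <= mu -> exists2 C : R, 0 <= C &
  forall j x, normc (lnpow_deriv_symbol mu j x) <= C * jap x.
Proof.
move=> mu0; have h2 : (0 : R) < 2^-1 by rewrite invr_gt0.
have [B B0 hB] := @ln_powR_le R mu 2^-1 mu0 h2.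
exists B => // j x; rewrite normc_symbol.
have J := jap_gt0 x.
have -> : B * jap x = (B * jap x `^ 2^-1) * jap x `^ 2^-1.
  rewrite -mulrA -powRD; last by apply/implyP => _; rewrite gt_eqF.
  by rewrite -[X in _ `^ X](_ : 1 = _) ?powRr1 ?(ltW J)//; field.
apply: ler_pM => //; first exact: lnj_ge0.
- by apply: hB; exact: jap_ge1.
- exact: le_trans (coord_le_enorm j x) (enorm_le_jap x).
Qed.

Lemma lnj_split mu d : 0 <= mu -> 0 < d -> exists2 C : R, 0 <= C &
  forall a x, 1 <= a -> lnj mu x <= C * (1 + ln a `^ mu) * (1 + dot x x `^ (d / 2) / a).
Proof.
move=> mu0 d0; have [B B0 hB] := @ln_powR_le R mu 1 mu0 ltr01.
(* [k] recovers the logarithm of the squared length from that of its power [p]. *)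
pose k := 2 / d; have k0 : 0 < k by rewrite divr_gt0.
exists (3 `^ mu * (1 + k `^ mu + k `^ mu * B)) => [|a x a1].
  by rewrite mulr_ge0 ?powR_ge0// !addr_ge0// ?mulr_ge0 ?powR_ge0.
have a0 : 0 < a by rewrite (lt_le_trans ltr01).
have la : 0 <= ln a by rewrite ln_ge0.
set p := dot x x `^ (d / 2).
have p0 : 0 <= p by exact: powR_ge0.
have pa : 0 <= p / a by rewrite divr_ge0// ltW.
have t1 : 1 <= 1 + p / a by rewrite lerDl.
have lt0 : 0 <= ln (1 + p / a) by rewrite ln_ge0.
have D0 := dot_ge0 x.
have h1 : ln (jap x) <= 1 + k * ln a + k * ln (1 + p / a).
  have ln2 : ln (2 : R) <= 1.
    have := @le_ln1Dx R 1 _; rewrite -[1 + 1]/(2%:R) => h; apply: h.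
    by rewrite (lt_trans _ ltr01)// oppr_lt0.
  have r0 : 0 <= k * ln a + k * ln (1 + p / a) by rewrite addr_ge0// mulr_ge0// ltW.
  have [d1|d1] := leP (dot x x) 1.
    have : ln (jap x) <= ln 2 by rewrite ler_ln ?posrE ?jap_gt0// /jap; lra.
    lra.
  have dp : 0 < dot x x by rewrite (lt_trans ltr01).
  have pp : 0 < p by rewrite powR_gt0.
  have : ln (jap x) <= ln (2 * dot x x).
    by rewrite ler_ln ?posrE ?jap_gt0 ?mulr_gt0// /jap; lra.
  rewrite lnM ?posrE// => hh.
  have lp : ln p = d / 2 * ln (dot x x) by rewrite ln_powR.
  have lp2 : ln (dot x x) = k * ln p.
    by rewrite lp /k; field; rewrite gt_eqF.
  (* This is [p <= a + p = a * (1 + p / a)] in logarithms. *)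
  have lpa : ln p <= ln a + ln (1 + p / a).
    rewrite -lnM ?posrE ?(lt_le_trans ltr01 t1)// ler_ln ?posrE//.
      by rewrite mulrDr mulr1 mulrC divfK ?gt_eqF// lerDr ltW.
    by rewrite mulr_gt0 ?(lt_le_trans ltr01 t1).
  have : k * ln p <= k * ln a + k * ln (1 + p / a) by rewrite -mulrDr ler_pM2l.
  lra.
have h2 : lnj mu x <= 3 `^ mu * (1 + k `^ mu * ln a `^ mu + k `^ mu * ln (1 + p / a) `^ mu).
  have := @powRD3_le R mu 1 (k * ln a) (k * ln (1 + p / a)) mu0 ler01.
  rewrite (powRM mu (ltW k0) la) (powRM mu (ltW k0) lt0) [1 `^ mu](congr1 (@^~ mu) (powR1 R)) => h.
  apply: le_trans (h _ _); [|by rewrite mulr_ge0 ?(ltW k0)..].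
  by apply: le_powR => //; rewrite ln_ge0// jap_ge1.
have h3 := hB _ t1; rewrite powRr1 ?(le_trans ler01)// in h3.
apply: le_trans h2 _; rewrite -!mulrA ler_wpM2l ?powR_ge0//.
have K := powR_ge0 k mu; have A := powR_ge0 (ln a) mu.
set t := 1 + p / a in h3 t1 *; set A' := ln a `^ mu in A *; set K' := k `^ mu in K *.
apply: (@le_trans _ _ (1 + K' * A' + K' * (B * t))).
  by rewrite lerD2l ler_wpM2l.
have -> : (1 + K' + K' * B) * ((1 + A') * t) =
  t + K' * A' * t + K' * (B * t) + A' * t + K' * t + K' * B * A' * t by ring.
have T : 0 <= t by rewrite (le_trans ler01).
have : K' * A' <= K' * A' * t by rewrite ler_peMr// mulr_ge0.
have : 0 <= A' * t by rewrite mulr_ge0.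
have : 0 <= K' * t by rewrite mulr_ge0.
have : 0 <= K' * B * A' * t by rewrite !mulr_ge0.
lra.
Qed.

Lemma measurable_coord1 : measurable_fun setT (fun x : plane R => x.1 : R).
Proof. exact: (@measurable_fst _ _ (measurableTypeR R) (measurableTypeR R)). Qed.

Lemma measurable_coord2 : measurable_fun setT (fun x : plane R => x.2 : R).
Proof. exact: (@measurable_snd _ _ (measurableTypeR R) (measurableTypeR R)). Qed.

Lemma measurable_dot_self : measurable_fun setT (fun x : plane R => dot x x).
Proof.
apply: measurable_funD; apply: measurable_funM;
  by [exact: measurable_coord1|exact: measurable_coord2].
Qed.

Lemma measurable_jap : measurable_fun setT jap.
Proof. by apply: measurable_funD; [exact: measurable_cst|exact: measurable_dot_self]. Qed.

Lemma measurable_jap_powR e : measurable_fun setT (fun x => jap x `^ e).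
Proof. exact: (measurableT_comp (measurable_powR e) measurable_jap). Qed.

Lemma measurable_lnj mu : measurable_fun setT (lnj mu).
Proof.
apply: (measurableT_comp (measurable_powR mu)).
exact: (measurableT_comp (@measurable_ln R) measurable_jap).
Qed.

Lemma cmfun_symbol mu j : cmfun (lnpow_deriv_symbol mu j : plane R -> R[i]).
Proof.
apply: cmfunM; first exact: (cmfunR (measurable_lnj mu)).
split; first exact: measurable_cst.
rewrite /coord /=; case: (j == ord0); [exact: measurable_coord1|exact: measurable_coord2].
Qed.

(** The inequality [(1 + |x_1|) * (1 + |x_2|) <= 2 * jap x] reduces the plane to a product of two
    convergent line integrals. *)
Lemma integral_jap_lty e : 0 < e -> (\int[leb2]_x (jap x `^ (- (1 + e)))%:E < +oo)%E.
Proof.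
move=> e0; pose s := 1 + e; have s1 : 1 < s by rewrite ltrDl.
pose w (t : R) : R := (1 + `|t|) `^ (- s).
have w0 t : 0 <= w t by exact: powR_ge0.
have mw : measurable_fun (setT : set (measurableTypeR R)) w.
  apply: (measurableT_comp (measurable_powR (- s))).
  by apply: measurable_funD; [exact: measurable_cst|exact: normr_measurable].
have fw := integral_decay_lty s1.
apply: (@le_lt_trans _ _ (\int[leb2]_x ((2 `^ s) * (w x.1 * w x.2))%:E)%E).
  apply: ge0_le_integral => //.
  - by move=> x _; rewrite lee_fin powR_ge0.
  - by apply/measurable_EFinP; exact: measurable_jap_powR.
  - apply/measurable_EFinP/measurable_funM; first exact: measurable_cst.
    apply: measurable_funM.
      exact: (measurableT_comp mw measurable_fst).
    exact: (measurableT_comp mw measurable_snd).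
  - move=> x _; rewrite lee_fin.
    have p1 : 0 < 1 + `|x.1| by rewrite ltr_pwDl.
    have p2 : 0 < 1 + `|x.2| by rewrite ltr_pwDl.
    have J := jap_gt0 x.
    rewrite /w -powRM ?(ltW p1) ?(ltW p2)// powRN powRN.
    rewrite -/s ler_pdivlMr ?powR_gt0 ?mulr_gt0// mulrC ler_pdivrMr ?powR_gt0//.
    rewrite -powRM ?(ltW J)//; apply: le_powR; [by lra|by rewrite mulr_ge0 ?ltW|].
    rewrite /jap /dot -!expr2 -(real_normK (num_real x.1)) -(real_normK (num_real x.2)).
    have := sqr_ge0 (`|x.1| - 1); have := sqr_ge0 (`|x.2| - 1).
    have := sqr_ge0 (`|x.1| - `|x.2|); rewrite !expr2; nra.
under eq_integral do rewrite EFinM.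
rewrite ge0_integralZl//; last 2 first.
- apply/measurable_EFinP/measurable_funM.
    exact: (measurableT_comp mw measurable_fst).
  exact: (measurableT_comp mw measurable_snd).
- by move=> x _; rewrite lee_fin mulr_ge0.
rewrite (@ge0_integral_prod _ _ _ _ _ lebesgue_measure lebesgue_measure w w)//.
have I0 : (0 <= \int[lebesgue_measure]_x (w x)%:E)%E.
  by apply: integral_ge0 => x _; rewrite lee_fin.
have If : (\int[lebesgue_measure]_x (w x)%:E)%E \is a fin_num by rewrite ge0_fin_numE.
by rewrite -(fineK If) -!EFinM ltry.
Qed.

End symbol.

(** * The commutator *)

Section pairing.
Context {R : realType}.
Implicit Types (U V : plane R -> R[i]) (k f : plane R -> R) (h : plane R * plane R -> R[i]).

Lemma cint_RE d (T : measurableType d) (mu : {measure set T -> \bar R}) (w : T -> R) :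
  measurable_fun setT w -> (forall x, 0 <= w x) -> (\int[mu]_x (w x)%:E < +oo)%E ->
  (\int[mu]_x (w x)%:E)%E = (normc (cint mu (fun x => (w x)%:C)))%:E.
Proof.
move=> mw w0 wf; rewrite normc_RRe normcR.
have I0 : (0 <= \int[mu]_x (w x)%:E)%E by apply: integral_ge0 => x _; rewrite lee_fin.
rewrite /Rintegral ger0_norm ?fine_ge0// fineK//.
by rewrite ge0_fin_numE.
Qed.

(** Young's inequality puts the inner integral of the majorant in L2, and Cauchy-Schwarz against [U]
    gives absolute convergence over the square of the plane, hence Fubini. *)
Lemma cL1_pairing U h k f (a b : R) : cL2 leb2 U -> cmfun h ->
  measurable_fun setT k -> measurable_fun setT f ->
  (forall x, 0 <= k x) -> (forall x, 0 <= f x) ->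
  (forall x y : plane R, normc (h (x, y)) <= k (x - y) * f y) -> 0 <= a -> 0 <= b ->
  (\int[leb2]_x (k x)%:E <= a%:E)%E -> (\int[leb2]_x (f x ^+ 2)%:E <= (b ^+ 2)%:E)%E ->
  cL1 (@sleb2 R \x @sleb2 R)%E (fun z : plane R * plane R => U z.1 * h z).
Proof.
move=> UL mh mk mf k0 f0 hkf a0 b0 ka fb; have [mU _] := UL.
have mU1 : cmfun (fun z : plane R * plane R => U z.1).
  exact: (cmfun_comp measurable_fst mU).
apply: (@cL1_prod R _ _ _ _ (@sleb2 R) (@sleb2 R)); first exact: cmfunM.
pose w (z : plane R * plane R) : R := k (z.1 - z.2) * f z.2.
have mw : measurable_fun setT w.
  apply: measurable_funM; first exact: (measurableT_comp mk measurable_plane_sub2).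
  exact: (measurableT_comp mf measurable_snd).
have w0 z : 0 <= w z by exact: mulr_ge0.
(* The nonnegative majorant is viewed as complex valued so that [young] and [young_ae] apply to
   it. *)
have mW : cmfun (fun z => (w z)%:C) by exact: cmfunR.
have wkf (x y : plane R) : normc (w (x, y))%:C <= k (x - y) * f y by rewrite normcR ger0_norm.
have WL : cL2 leb2 (fun x => cint leb2 (fun y => (w (x, y))%:C)).
  split; first exact: (cmfun_kernel_operator mW).
  exact: le_lt_trans (young mW mk mf k0 f0 wkf a0 b0 ka fb) (ltry _).
have [_] := cL2M UL WL; apply: le_lt_trans.
have mw1 x : measurable_fun setT (fun y => w (x, y)).
  exact: (measurableT_comp mw (pair1_measurable x)).
apply: (@le_trans _ _ (\int[leb2]_x ((normc (U x))%:E * \int[leb2]_y (w (x, y))%:E))%E).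
  have mE : measurable_fun setT (fun x => \int[leb2]_y (w (x, y))%:E)%E.
    by apply: (measurable_int_snd (f := fun z => (w z)%:E)); exact/measurable_EFinP.
  have mn : measurable_fun setT (fun z : plane R * plane R => (normc (U z.1 * h z))%:E).
    by apply: cmfun_enormc; exact: cmfunM.
  apply: ge0_le_integral; first exact: measurableT.
  - by move=> x _; apply: integral_ge0 => y _; rewrite lee_fin normc_ge0.
  - exact: (measurable_int_snd mn).
  - by apply: emeasurable_funM => //; exact: cmfun_enormc.
  - move=> x _; rewrite -ge0_integralZl//; first last.
    + by rewrite lee_fin normc_ge0.
    + by move=> y _; rewrite lee_fin.
    + exact/measurable_EFinP.
    apply: ge0_le_integral; first exact: measurableT.
    + by move=> y _; rewrite lee_fin normc_ge0.
    + exact: (measurableT_comp mn (pair1_measurable x)).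
    + by apply/measurable_EFinP/measurable_funM => //; exact: measurable_cst.
    + by move=> y _; rewrite -EFinM lee_fin /= Normc.normcM ler_wpM2l ?normc_ge0.
rewrite le_eqVlt; apply/orP; left; apply/eqP; apply: ae_eq_integral => //.
- apply: emeasurable_funM; first exact: cmfun_enormc.
  by apply: (measurable_int_snd (f := fun z => (w z)%:E)); exact/measurable_EFinP.
- by case: WL => mWc _; exact: (cmfun_enormc (cmfunM mU mWc)).
- apply: (ae_leb2S _ (young_ae mW mk mf k0 f0 wkf ka fb)) => x [_ hx] _.
  rewrite Normc.normcM EFinM; congr (_ * _)%E; apply: cint_RE => //.
  by move: hx; under eq_integral do rewrite normcR ger0_norm//.
Qed.

Lemma cint_pairing U h k f (a b : R) : cL2 leb2 U -> cmfun h ->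
  measurable_fun setT k -> measurable_fun setT f ->
  (forall x, 0 <= k x) -> (forall x, 0 <= f x) ->
  (forall x y : plane R, normc (h (x, y)) <= k (x - y) * f y) -> 0 <= a -> 0 <= b ->
  (\int[leb2]_x (k x)%:E <= a%:E)%E -> (\int[leb2]_x (f x ^+ 2)%:E <= (b ^+ 2)%:E)%E ->
  cint leb2 (fun x => U x * cint leb2 (fun y => h (x, y))) =
  cint (@sleb2 R \x @sleb2 R)%E (fun z : plane R * plane R => U z.1 * h z).
Proof.
move=> UL mh mk mf k0 f0 hkf a0 b0 ka fb; have [mU _] := UL.
have PL := cL1_pairing UL mh mk mf k0 f0 hkf a0 b0 ka fb; have [mP _] := PL.
rewrite -(@cfubini12 _ _ _ _ _ (@sleb2 R) (@sleb2 R) _ PL).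
apply: ae_eq_cint.
- by apply: (cmfunM mU); exact: (cmfun_cint_snd (@sleb2 R) mh).
- exact: (cmfun_cint_snd (@sleb2 R) mP).
- apply: (ae_leb2S _ (young_ae mh mk mf k0 f0 hkf ka fb)) => x hx.
  by rewrite -(cintZ (U x) hx).
Qed.

(** [V] will be [m * F] up to a constant, which may fail to be square integrable; absolute
    convergence is therefore a hypothesis rather than a consequence of [cL1_pairing]. *)
Lemma cint_pairing_snd V (q : plane R * plane R -> R[i]) : cmfun V -> cmfun q ->
  cL1 (@sleb2 R \x @sleb2 R)%E (fun z : plane R * plane R => V z.2 * q z) ->
  {ae leb2, forall y, cL1 leb2 (fun x => q (x, y))} ->
  cint leb2 (fun y => V y * cint leb2 (fun x => q (x, y))) =
  cint (@sleb2 R \x @sleb2 R)%E (fun z : plane R * plane R => V z.2 * q z).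
Proof.
move=> mV mq PL qL; have [mP _] := PL.
have msw (h : plane R * plane R -> R[i]) : cmfun h ->
    cmfun (fun y => cint leb2 (fun x => h (x, y))).
  move=> mh; apply: (@cmfun_cint_snd _ _ _ _ _ (@sleb2 R) (fun z => h (z.2, z.1))).
  exact: (cmfun_comp (@measurable_swap _ _ _ _) mh).
rewrite -(@cfubini21 _ _ _ _ _ (@sleb2 R) (@sleb2 R) _ PL).
apply: ae_eq_cint.
- exact: (cmfunM mV (msw _ mq)).
- exact: (msw _ mP).
- by apply: (ae_leb2S _ qL) => y hy; rewrite -(cintZ (V y) hy).
Qed.

Definition commutator_kernel (m G F : plane R -> R[i]) (z : plane R * plane R) : R[i] :=
  (m z.1 - m z.2) * (G (z.1 - z.2) * F z.2).

Lemma cmfun_commutator_kernel m G F : cmfun m -> cmfun G -> cmfun F ->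
  cmfun (commutator_kernel m G F).
Proof.
move=> mm mG mF; apply: cmfunM; last exact: cmfun_conv_kernel.
by apply: cmfunB; [exact: (cmfun_comp measurable_fst mm)|exact: (cmfun_comp measurable_snd mm)].
Qed.

(** Both terms become double integrals of the same product, one weighted by [m] at the output
    variable and one by [m] at the input variable; their difference carries the commutator
    kernel. *)
Lemma commutator_pairing (c : R[i]) m G F Phi (k w : plane R -> R) (a b : R) :
  cmfun m -> cL1 leb2 G -> cL2 leb2 F -> cL2 leb2 Phi ->
  cL2 leb2 (fun x => m x * Phi x) ->
  measurable_fun setT k -> measurable_fun setT w ->
  (forall x, 0 <= k x) -> (forall x, 0 <= w x) ->
  (forall x y : plane R, normc (m x - m y) <= k (x - y) * w y) ->
  0 <= a -> 0 <= b ->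
  (\int[leb2]_x (k x * normc (G x))%:E <= a%:E)%E ->
  (\int[leb2]_x ((w x * normc (F x)) ^+ 2)%:E <= (b ^+ 2)%:E)%E ->
  cint leb2 (fun x => m x * (c * conv G F x) * Phi x) -
  cint leb2 (fun y => m y * F y * (c * conv (fun x => G (- x)) Phi y)) =
  cint leb2 (fun x => c * cint leb2 (fun y => commutator_kernel m G F (x, y)) * Phi x).
Proof.
move=> mm GL FL PL mPL mk mw k0 w0 hm a0 b0 ka wb.
have [mG _] := GL; have [mF _] := FL; have [mP _] := PL.
have nG := cmfun_normc mG; have nF := cmfun_normc mF.
have mh := cmfun_commutator_kernel mm mG mF.
have mq := cmfun_conv_kernel mG mF.
pose q (z : plane R * plane R) := G (z.1 - z.2) * F z.2.
have kk0 x : 0 <= k x * normc (G x) by rewrite mulr_ge0// normc_ge0.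
have ww0 x : 0 <= w x * normc (F x) by rewrite mulr_ge0// normc_ge0.
have mkk : measurable_fun setT (fun x => k x * normc (G x)) by exact: measurable_funM.
have mww : measurable_fun setT (fun x => w x * normc (F x)) by exact: measurable_funM.
have hb (x y : plane R) : normc (commutator_kernel m G F (x, y)) <=
    (k (x - y) * normc (G (x - y))) * (w y * normc (F y)).
  rewrite /commutator_kernel /= !Normc.normcM mulrACA ler_wpM2r//.
  by rewrite mulr_ge0// normc_ge0.
have UL1 : cL2 leb2 (fun x => c * (m x * Phi x)) by exact: cL2Z.
have UL3 : cL2 leb2 (fun x => c * Phi x) by exact: cL2Z.
have fG := L1nE GL; have fF := int_sqr_L2n FL.
have nG0 x : 0 <= normc (G x) by exact: normc_ge0.
have nF0 x : 0 <= normc (F x) by exact: normc_ge0.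
have fF0 : 0 <= fine (L2n leb2 F) by rewrite fine_ge0// L2n_ge0.
have P1 := cL1_pairing UL1 mq nG nF nG0 nF0 (conv_kernel_le G F) (L1n_ge0 G) fF0 fG fF.
have E1 := cint_pairing UL1 mq nG nF nG0 nF0 (conv_kernel_le G F) (L1n_ge0 G) fF0 fG fF.
have P3 := cL1_pairing UL3 mh mkk mww kk0 ww0 hb a0 b0 ka wb.
have E3 := cint_pairing UL3 mh mkk mww kk0 ww0 hb a0 b0 ka wb.
pose r (z : plane R * plane R) := G (z.1 - z.2) * Phi z.1.
have mr : cmfun r.
  apply: cmfunM; first exact: (cmfun_comp measurable_plane_sub2 mG).
  exact: (cmfun_comp measurable_fst mP).
have mV : cmfun (fun y => c * (m y * F y)).
  by apply: cmfunM; [exact: cmfun_cst|exact: cmfunM].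
have PB := cL1B P1 P3.
(* Absolute convergence of the second double integral is obtained by subtraction: its integrand is
   that of [P1] minus that of [P3]. *)
have P2 : cL1 (@sleb2 R \x @sleb2 R)%E
    (fun z : plane R * plane R => c * (m z.2 * F z.2) * r z).
  have -> : (fun z : plane R * plane R => c * (m z.2 * F z.2) * r z) =
    (fun z => c * (m z.1 * Phi z.1) * q z - c * Phi z.1 * commutator_kernel m G F z).
    by apply/funext => z; rewrite /r /q /commutator_kernel; ring.
  exact: PB.
have GoL : cL1 leb2 (fun x => G (- x)).
  exact: (cL1_invariant measurable_plane_opp leb2_opp GL).
have rL : {ae leb2, forall y, cL1 leb2 (fun x => r (x, y))}.
  apply: (ae_leb2S _ (conv_ae GoL PL)) => y.
  by under eq_fun do rewrite opprB.
have E2 := cint_pairing_snd mV mr P2 rL.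
transitivity (cint (@sleb2 R \x @sleb2 R)%E
    (fun z : plane R * plane R => c * (m z.1 * Phi z.1) * q z) -
  cint (@sleb2 R \x @sleb2 R)%E
    (fun z : plane R * plane R => c * (m z.2 * F z.2) * r z)).
  congr (_ - _).
    by rewrite -[RHS]E1; apply: eq_cint => x; rewrite /conv; ring.
  rewrite -E2; apply: eq_cint => y; rewrite /conv /r.
  under eq_cint do rewrite opprB.
  by ring.
transitivity (cint (@sleb2 R \x @sleb2 R)%E
    (fun z : plane R * plane R => c * Phi z.1 * commutator_kernel m G F z)).
  rewrite -(cintB P1 P2); apply: eq_cint => z.
  by rewrite /r /q /commutator_kernel; ring.
by rewrite -E3; apply: eq_cint => x; ring.
Qed.

End pairing.

(** * Sobolev norms on the Fourier side and weighted bounds *)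

Section estimate.
Context {R : realType}.
Implicit Types (f g m : plane R -> R[i]).

(** Surjectivity makes the choice in [fmult] satisfy its specification, and the isometry evaluates
    its norm. *)
Lemma L2norm_fmult m f : fmult_dom m f ->
  L2norm (fmult m f) = L2n leb2 (fun xi : plane R => m xi * fourier f xi).
Proof.
move=> [_ mfL].
have mfL2 : cL2 leb2 (fun xi : plane R => m xi * fourier f xi) by exact: mfL.
have [u uL uE] := fourier_surj mfL2.
have : [set u | is_L2 u /\ {ae leb2, forall xi, fourier u xi = m xi * fourier f xi}]
    (fmult m f).
  by apply: (xgetPex (fun=> 0)); exists u; split; [exact: uL|exact: uE].
move=> [vL vE].
have vL2 : cL2 leb2 (fmult m f : plane R -> R[i]) by exact: vL.
have [mF _] := fourier_cL2 vL2; have [mmf _] := mfL2.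
transitivity (L2n leb2 (fourier (fmult m f) : plane R -> R[i])).
  by rewrite (fourier_isometry vL2).
exact: (ae_eq_L2n mF mmf vE).
Qed.

(** An integrable transform makes [g] bounded almost everywhere. *)
Lemma cL2_mul_fourier_cL1 f g : cL2 leb2 f -> cL2 leb2 g -> cL1 leb2 (fourier g) ->
  cL2 leb2 (fun x => f x * g x).
Proof.
move=> fL gL GL; have [mf _] := fL; have [mg _] := gL; have [mG _] := GL.
have [M hM] := F1_bounded GL.
have mF1 := cmfun_comp measurable_plane_opp (cmfun_F1 mG).
have [mp pf] : cL2 leb2 (fun x => f x * F1 (fourier g) (- x)).
  apply: (@cL2_le _ _ _ _ _ (fun x => M%:C * f x)).
  - exact: cmfunM.
  - exact: cL2Z.
  - move=> x; rewrite [leLHS]Normc.normcM [leRHS]Normc.normcM mulrC ler_wpM2r ?normc_ge0// normcR.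
    by apply: le_trans (ler_norm M); exact: (hM (- x)).
split; first exact: cmfunM.
rewrite (ae_eq_L2n (cmfunM mf mg) mp)//.
by apply: (ae_leb2S _ (fourier_inv_F1 gL GL)) => x ->.
Qed.

Lemma bessel_symbolE s (x : plane R) : bessel_symbol s x = (jap x `^ (s / 2))%:C.
Proof. by []. Qed.

Lemma weighted_fourier_L1 (e : R) : 0 < e -> exists2 B : R, 0 <= B &
  forall g, in_H (2 + 3 * e) g ->
    (\int[leb2]_x (jap x `^ ((1 + e) / 2) * normc (fourier g x))%:E <=
     B%:E * L2n leb2 (fun x : plane R => (bessel_symbol (2 + 3 * e) x * fourier g x)%R))%E.
Proof.
(* Cauchy-Schwarz factors the weight as [jap^s] times the Bessel symbol, since
   [(1 + e) / 2 = s + (2 + 3 * e) / 2]; the square of [jap^s] is [jap^-(1 + 2 * e)], which is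
   integrable. *)
move=> e0; pose s : R := - (1 + 2 * e) / 2.
have mu_ : cmfun (fun x : plane R => (jap x `^ s)%:C) by apply: cmfunR; exact: measurable_jap_powR.
have uf : (L2n leb2 (fun x : plane R => (jap x `^ s)%:C) < +oo)%E.
  rewrite L2n_lty /n2.
  have e2 : 0 < 2 * e by rewrite mulr_gt0.
  apply: le_lt_trans (integral_jap_lty e2).
  rewrite le_eqVlt; apply/orP; left; apply/eqP; apply: eq_integral => x _.
  rewrite normcR ger0_norm ?powR_ge0// -powR_mulrn ?powR_ge0// -powRrM.
  by congr (_ `^ _)%:E; rewrite /s; field.
have u0 := L2n_ge0 leb2 (fun x : plane R => (jap x `^ s)%:C).
exists (fine (L2n leb2 (fun x : plane R => (jap x `^ s)%:C))); first exact: fine_ge0.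
move=> g [gL bgL].
have GL2 : cL2 leb2 (fourier g : plane R -> R[i]) by apply: fourier_cL2; exact: gL.
have [mG _] := GL2; have [mbg _] := (bgL : cL2 leb2 (fun x : plane R => _)).
rewrite fineK -?L2n_fin_num//.
apply: le_trans (L2n_CS leb2 mu_ mbg).
rewrite le_eqVlt; apply/orP; left; apply/eqP; apply: eq_integral => x _.
rewrite bessel_symbolE !Normc.normcM !normcR !ger0_norm ?powR_ge0//.
congr EFin; rewrite mulrA; congr (_ * _); rewrite -powRD.
  by congr (_ `^ _); rewrite /s; field.
by apply/implyP => _; rewrite gt_eqF// jap_gt0.
Qed.

Lemma lnj_fourier_le mu d : 0 <= mu -> 0 < d -> exists2 D : R, 0 <= D &
  forall (F : plane R -> R[i]) (N H : R), cL2 leb2 F ->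
    cL2 leb2 (fun x : plane R => riesz_symbol d x * F x) -> 0 < N -> 0 <= H ->
    (L2n leb2 F <= N%:E)%E ->
    (L2n leb2 (fun x : plane R => (riesz_symbol d x * F x)%R) <= H%:E)%E ->
    (\int[leb2]_x (((1 + lnj mu x) * normc (F x)) ^+ 2)%:E <=
      ((D * (1 + ln (1 + H / N) `^ mu) * N) ^+ 2)%:E)%E.
Proof.
move=> mu0 d0; have [D D0 hD] := lnj_split mu0 d0.
(* [1 + D] absorbs the summand [1] of the weight; [2] counts the two contributions of size [N]
   below. *)
exists ((1 + D) * 2) => [|F N H FL rL N0 H0 FN rH]; first by rewrite mulr_ge0// addr_ge0.
have [mF _] := FL; have [mr _] := rL.
pose a := 1 + H / N; have HN0 : 0 <= H / N by rewrite divr_ge0// ltW.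
have a1 : 1 <= a by rewrite lerDl.
have a0 : 0 < a by exact: lt_le_trans a1.
set L := ln a `^ mu; have L0 : 0 <= L by exact: powR_ge0.
pose c := (1 + D) * (1 + L); have c_ge : 0 <= c by rewrite mulr_ge0// addr_ge0.
pose v (x : plane R) := (1 + lnj mu x)%:C * F x.
pose u (x : plane R) := c%:C * (F x + (a^-1)%:C * (riesz_symbol d x * F x)).
have mw : cmfun (fun x : plane R => (1 + lnj mu x)%:C).
  by apply: cmfunR; apply: measurable_funD; [exact: measurable_cst|exact: measurable_lnj].
have mv : cmfun v by exact: cmfunM.
have mr1 : cmfun (fun x : plane R => (a^-1)%:C * (riesz_symbol d x * F x)).
  by apply: cmfunM; [exact: cmfun_cst|].
have mu1 : cmfun (fun x : plane R => F x + (a^-1)%:C * (riesz_symbol d x * F x)).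
  exact: cmfunD.
have mu2 : cmfun u by apply: cmfunM; [exact: cmfun_cst|].
have vu x : normc (v x) <= normc (u x).
  rewrite /v /u /riesz_symbol.
  set p := dot x x `^ (d / 2); have p0 : 0 <= p by exact: powR_ge0.
  have l0 := lnj_ge0 mu x.
  rewrite (_ : F x + _ = (1 + p / a)%:C * F x); last first.
    by rewrite rmorphD rmorphM rmorph1; ring.
  rewrite mulrA -rmorphM [leLHS]Normc.normcM [leRHS]Normc.normcM !normcR.
  rewrite ler_wpM2r ?normc_ge0//.
  have pa : 0 <= p / a by rewrite divr_ge0// ltW.
  rewrite !ger0_norm ?mulr_ge0 ?addr_ge0//.
  have := hD a x a1; rewrite -/p -/L => h.
  have e1 : 1 <= (1 + L) * (1 + p / a).
    by rewrite mulr_ege1// lerDl.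
  rewrite /c -mulrA mulrDl mul1r; apply: lerD => //; by rewrite mulrA.
have c2 : 0 <= (1 + D) * 2 * (1 + L) * N by rewrite !mulr_ge0 ?addr_ge0// ltW.
suff : (L2n leb2 v <= ((1 + D) * 2 * (1 + L) * N)%:E)%E.
  rewrite (L2n_le_fin _ _ c2) /n2; apply: le_trans.
  rewrite le_eqVlt; apply/orP; left; apply/eqP; apply: eq_integral => x _.
  rewrite /v [in RHS]Normc.normcM normcR ger0_norm// addr_ge0//; exact: lnj_ge0.
apply: le_trans (le_L2n _ mv mu2 vu) _.
rewrite /u L2nZ// normcR (ger0_norm c_ge).
(* The choice [a = 1 + H / N] gives [H / a <= N], which balances the two terms. *)
have h : (L2n leb2 (fun x : plane R => (F x + (a^-1)%:C * (riesz_symbol d x * F x))%R)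
    <= (N + N)%:E)%E.
  apply: le_trans (L2nD _ mF mr1) _; rewrite EFinD; apply: leeD => //.
  rewrite L2nZ// normcR ger0_norm ?invr_ge0 ?(ltW a0)//.
  apply: (@le_trans _ _ ((a^-1)%:E * H%:E)%E).
    by apply: lee_wpmul2l => //; rewrite lee_fin invr_ge0 ltW.
  rewrite -EFinM lee_fin mulrC ler_pdivrMr// /a mulrDr mulr1 mulrC divfK ?gt_eqF//.
  by rewrite lerDr ltW.
apply: (@le_trans _ _ (c%:E * (N + N)%:E)%E).
  by apply: lee_wpmul2l => //; rewrite lee_fin.
by rewrite -EFinM lee_fin /c le_eqVlt; apply/orP; left; apply/eqP; ring.
Qed.

End estimate.

(** * Fourier representation of the weak commutator *)

Section commutator.
Context {R : realType}.
Implicit Types (f g phi : plane R -> R[i]).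
Let c0 : R := (2 * pi)^-1.

Lemma cL2_test_function phi : test_function phi -> cL2 leb2 phi.
Proof. by move=> /(_ 0%N)[h _]; exact: h. Qed.

Lemma cL2_fourier_opp phi : cL2 leb2 phi -> cL2 leb2 (fun x => fourier phi (- x)).
Proof.
by move=> h; exact: (cL2_invariant measurable_plane_opp leb2_opp (fourier_cL2 h)).
Qed.

Lemma cL2_symbol_test_function mu j phi : 0 <= mu -> test_function phi ->
  cL2 leb2 (fun x : plane R => lnpow_deriv_symbol mu j x * fourier phi (- x)).
Proof.
move=> mu0 tphi; have [C C0 hC] := symbol_growth mu0.
have [mP _] := cL2_fourier_opp (cL2_test_function tphi).
(* Order two matches [symbol_growth]: the Bessel symbol of order [2] is [jap]. *)
have [_ bL] := tphi 2%N.
have bL2 : cL2 leb2 (fun x : plane R => bessel_symbol 2%:R x * fourier phi x) by exact: bL.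
have bo := cL2_invariant measurable_plane_opp leb2_opp bL2.
apply: (cL2_le _ (cL2Z C%:C bo)).
  by apply: cmfunM => //; exact: cmfun_symbol.
move=> x; rewrite mulrA bessel_symbolE [leLHS]Normc.normcM [leRHS]Normc.normcM.
rewrite ler_wpM2r ?normc_ge0// divff// (_ : jap (- x) = jap x); last first.
  by rewrite /jap dotNl dotNr opprK.
have J := ltW (jap_gt0 x).
rewrite powRr1// -rmorphM normcR ger0_norm ?mulr_ge0//; exact: hC.
Qed.

Lemma fourier_mul_opp g phi : cL2 leb2 g -> cL1 leb2 (fourier g) -> cL2 leb2 phi ->
  {ae leb2, forall x, fourier (fun y => g y * phi y) (- x) =
    c0%:C * conv (fun y => fourier g (- y)) (fun y => fourier phi (- y)) x}.
Proof.
move=> gL GL pL; have [mG _] := GL; have [mP _] := fourier_cL2 pL.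
have E := ae_invariant measurable_plane_opp leb2_opp (fourierM pL gL GL).
apply: (ae_leb2S _ E) => x.
rewrite (_ : (fun y => g y * phi y) = (fun y => phi y * g y)); last first.
  by apply/funext => y; rewrite mulrC.
move=> ->; congr (_ * _); rewrite /conv.
have mk : cmfun (fun y : plane R => fourier g (- x - y) * fourier phi y).
  apply: cmfunM => //; exact: (cmfun_comp (measurable_plane_subr (- x)) mG).
rewrite -(cint_invariant measurable_plane_opp leb2_opp mk).
by apply: eq_cint => y; rewrite opprB opprK addrC.
Qed.

(** The reflected transform of [H] is its inverse transform, so this moves a function given on the
    Fourier side to the physical side of the pairing. *)
Lemma cint_fourier_opp (H : plane R -> R[i]) phi : cL2 leb2 H -> cL2 leb2 phi ->
  cint leb2 (fun x => fourier H (- x) * phi x) =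
  cint leb2 (fun x => H x * fourier phi (- x)).
Proof.
move=> HL pL; have [mH _] := HL; have [mp _] := pL; have [mF _] := fourier_cL2 HL.
have poL := cL2_invariant measurable_plane_opp leb2_opp pL.
have mo := cmfun_comp measurable_plane_opp mp.
have mFo := cmfun_comp measurable_plane_opp mF.
have [mP _] := cL2_fourier_opp pL; have [mPo _] := fourier_cL2 poL.
transitivity (cint leb2 (fun x => fourier H x * phi (- x))).
  rewrite -(cint_invariant measurable_plane_opp leb2_opp (cmfunM mF mo)).
  by apply: eq_cint => x; rewrite opprK.
rewrite (fourier_sym HL poL); apply: ae_eq_cint; [exact: cmfunM|exact: cmfunM|].
by apply: (ae_leb2S _ (fourier_opp pL)) => x ->.
Qed.

Lemma commutator_distrE (m f g phi : plane R -> R[i]) (k w : plane R -> R) (a b : R) :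
  cmfun m -> cL2 leb2 f -> cL2 leb2 g -> cL1 leb2 (fourier g) -> cL2 leb2 phi ->
  cL2 leb2 (fun x => m x * fourier phi (- x)) ->
  measurable_fun setT k -> measurable_fun setT w ->
  (forall x, 0 <= k x) -> (forall x, 0 <= w x) ->
  (forall x y : plane R, normc (m x - m y) <= k (x - y) * w y) -> 0 <= a -> 0 <= b ->
  (\int[leb2]_x (k x * normc (fourier g x))%:E <= a%:E)%E ->
  (\int[leb2]_x ((w x * normc (fourier f x)) ^+ 2)%:E <= (b ^+ 2)%:E)%E ->
  commutator_distr m g f phi =
  cint leb2 (fun x => c0%:C * cint leb2 (fun y =>
    commutator_kernel m (fourier g) (fourier f) (x, y)) * fourier phi (- x)).
Proof.
move=> mm fL gL GL pL mpL mk mw k0 w0 hm a0 b0 ka wb.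
have FL := fourier_cL2 fL; have [mF _] := FL; have [mG _] := GL.
have PL := cL2_fourier_opp pL; have [mP _] := PL.
have [mfg _] := fourier_cL2 (cL2_mul_fourier_cL1 fL gL GL).
have mGo := cmfun_comp measurable_plane_opp mG.
have gpL : cL2 leb2 (fun x => g x * phi x).
  rewrite (_ : (fun y => g y * phi y) = (fun y => phi y * g y)).
    exact: (cL2_mul_fourier_cL1 pL gL GL).
  by apply/funext => y; rewrite mulrC.
have [mgp _] := cL2_fourier_opp gpL.
have mc u : cmfun u -> cmfun (fun x : plane R => c0%:C * u x).
  by move=> mu_; apply: cmfunM; [exact: cmfun_cst|].
rewrite -(commutator_pairing c0%:C mm GL FL PL mpL mk mw k0 w0 hm a0 b0 ka wb).
rewrite /commutator_distr; congr (_ - _).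
- apply: (@ae_eq_cint R _ _ leb2
    (fun x => m x * fourier (fun x => f x * g x) x * fourier phi (- x))).
  + exact: (cmfunM (cmfunM mm mfg) mP).
  + exact: (cmfunM (cmfunM mm (mc _ (cmfun_conv mG mF))) mP).
  + by apply: (ae_leb2S _ (fourierM fL gL GL)) => x ->.
- apply: (@ae_eq_cint R _ _ leb2
    (fun x => m x * fourier f x * fourier (fun x => g x * phi x) (- x))).
  + exact: (cmfunM (cmfunM mm mF) mgp).
  + exact: (cmfunM (cmfunM mm mF) (mc _ (cmfun_conv mGo mP))).
  + by apply: (ae_leb2S _ (fourier_mul_opp gL GL pL)) => x ->.
Qed.

End commutator.

Theorem proposition1p4 (R : realType) (mu : R) (hmu : 0 <= mu)
    (delta : R) (hdelta : 0 < delta) (eps : R) (heps : 0 < eps) :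
  exists C : R, forall (j : 'I_2) (f g : R * R -> R[i]),
    is_L2 f -> ~ {ae leb2, forall x, f x = 0} ->
    in_dotH delta f -> in_H (2 + 3 * eps) g ->
    exists h : R * R -> R[i],
      distr_is_L2 (commutator_distr (lnpow_deriv_symbol mu j) g f) h /\
      (L2norm h <=
        (C * (1 + ln (1 + fine (dotH_norm delta f) / fine (L2norm f)) `^ mu))%:E
        * L2norm f * H_norm (2 + 3 * eps) g)%E.
Proof.
have [C C0 hC] := symbol_difference hmu heps.
have [D D0 hD] := lnj_fourier_le hmu hdelta.
have [B B0 hB] := weighted_fourier_L1 heps.
set c : R := (2 * pi)^-1; have c_ge : 0 <= c by rewrite invr_ge0 mulr_ge0// pi_ge0.
(* [c] comes from the transform of a product, [C] from the symbol, [B] from Cauchy-Schwarz on [g],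
   [D] from the logarithmic weight on [f]; none depends on [j], [f] or [g]. *)
exists (c * (C * B * D)) => j f g fL0 fne fH gH.
have fL : cL2 leb2 (f : plane R -> R[i]) by exact: fL0.
have [_ rL0] := fH; have [gL0 bL0] := gH.
have gL : cL2 leb2 (g : plane R -> R[i]) by exact: gL0.
have rL : cL2 leb2 (fun x : plane R => riesz_symbol delta x * fourier f x) by exact: rL0.
have bL : cL2 leb2 (fun x : plane R => bessel_symbol (2 + 3 * eps) x * fourier g x).
  exact: bL0.
have FL := fourier_cL2 fL; have [mF _] := FL; have [mG _] := fourier_cL2 gL.
have dotHE : dotH_norm delta f =
  L2n leb2 (fun x : plane R => riesz_symbol delta x * fourier f x) := L2norm_fmult fH.
have HnE : H_norm (2 + 3 * eps) g =
  L2n leb2 (fun x : plane R => bessel_symbol (2 + 3 * eps) x * fourier g x) := L2norm_fmult gH.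
have L2E (u : R * R -> R[i]) : L2norm u = L2n leb2 (u : plane R -> R[i]) by [].
rewrite dotHE HnE (L2E f).
set N := fine (L2n leb2 (f : plane R -> R[i])).
set Hd := fine (L2n leb2 (fun x : plane R => riesz_symbol delta x * fourier f x)).
set S := fine (L2n leb2 (fun x : plane R => bessel_symbol (2 + 3 * eps) x * fourier g x)).
have NE : L2n leb2 (f : plane R -> R[i]) = N%:E by exact: fine_L2nE.
have HE := fine_L2nE rL; have SE := fine_L2nE bL; rewrite -/Hd in HE; rewrite -/S in SE.
(* This is where [f] being nonzero enters: [lnj_fourier_le] divides by [N]. *)
have N0 : 0 < N.
  rewrite lt_neqAle fine_ge0 ?L2n_ge0// andbT eq_sym; apply/eqP => N0.
  by apply: fne; have [mf _] := fL; apply: (L2n_eq0_ae mf); rewrite NE N0.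
have Hd0 : 0 <= Hd by rewrite fine_ge0// L2n_ge0.
have S0 : 0 <= S by rewrite fine_ge0// L2n_ge0.
have FN : (L2n leb2 (fourier f : plane R -> R[i]) <= N%:E)%E.
  rewrite (fourier_isometry fL) NE; exact: lexx.
have rN : (L2n leb2 (fun x : plane R => (riesz_symbol delta x * fourier f x)%R) <= Hd%:E)%E.
  rewrite HE; exact: lexx.
have wb := hD _ _ _ FL rL N0 Hd0 FN rN.
set b := _ * N in wb.
set l := 1 + ln (1 + Hd / N) `^ mu in b wb *.
have l0 : 0 <= l by rewrite addr_ge0// powR_ge0.
have b0 : 0 <= b by rewrite !mulr_ge0// ltW.
have kb1 := hB g gH; rewrite SE -EFinM in kb1.
pose q (x : plane R) := jap x `^ ((1 + eps) / 2).
have q0 x : 0 <= q x by exact: powR_ge0.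
have mq : measurable_fun setT q by exact: measurable_jap_powR.
have q1 x : 1 <= q x.
  by apply: powR_ge1; [rewrite divr_ge0// addr_ge0// ltW|exact: jap_ge1].
have nG := cmfun_normc mG.
(* The weight [q] is at least [1], so the weighted bound makes [fourier g] integrable. *)
have GL : cL1 leb2 (fourier g : plane R -> R[i]).
  apply: (@cL1_le _ _ _ _ _ (fun x : plane R => (q x * normc (fourier g x))%:E)) => //.
  - by move=> x; rewrite lee_fin ler_peMl// normc_ge0.
  - by apply/measurable_EFinP; exact: measurable_funM.
  - exact: le_lt_trans kb1 (ltry _).
pose k (x : plane R) := C * q x; pose w (x : plane R) := 1 + lnj mu x.
have k0 x : 0 <= k x by rewrite mulr_ge0.
have w0 x : 0 <= w x by rewrite addr_ge0// lnj_ge0.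
have mk : measurable_fun setT k by apply: measurable_funM => //; exact: measurable_cst.
have mw : measurable_fun setT w.
  by apply: measurable_funD; [exact: measurable_cst|exact: measurable_lnj].
pose a := C * (B * S); have a0 : 0 <= a by rewrite !mulr_ge0.
have ka : (\int[leb2]_x (k x * normc (fourier g x))%:E <= a%:E)%E.
  under eq_integral do rewrite /k -mulrA EFinM.
  rewrite ge0_integralZl//; first last.
  - by move=> x _; rewrite lee_fin mulr_ge0// normc_ge0.
  - by apply/measurable_EFinP; exact: measurable_funM.
  by rewrite /a EFinM; apply: lee_wpmul2l; rewrite ?lee_fin.
have hm (x y : plane R) :
    normc (lnpow_deriv_symbol mu j x - lnpow_deriv_symbol mu j y) <= k (x - y) * w y.
  exact: hC.
have mm := cmfun_symbol mu j.
have mh := cmfun_commutator_kernel mm mG mF.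
have nF := cmfun_normc mF.
pose T (x : plane R) := cint leb2 (fun y =>
  commutator_kernel (lnpow_deriv_symbol mu j) (fourier g) (fourier f) (x, y)).
have mT : cmfun T by exact: (cmfun_kernel_operator mh).
have hb (x y : plane R) :
    normc (commutator_kernel (lnpow_deriv_symbol mu j) (fourier g) (fourier f) (x, y)) <=
    (k (x - y) * normc (fourier g (x - y))) * (w y * normc (fourier f y)).
  rewrite /commutator_kernel /= !Normc.normcM mulrACA ler_wpM2r//.
  by rewrite mulr_ge0// normc_ge0.
have Tb : (L2n leb2 T <= (a * b)%:E)%E.
  have mkG := measurable_funM mk nG; have mwF := measurable_funM mw nF.
  have kG0 x : 0 <= k x * normc (fourier g x) := mulr_ge0 (k0 x) (normc_ge0 _).
  have wF0 x : 0 <= w x * normc (fourier f x) := mulr_ge0 (w0 x) (normc_ge0 _).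
  exact: (young mh mkG mwF kG0 wF0 hb a0 b0 ka wb).
have TL : cL2 leb2 T by split => //; exact: le_lt_trans Tb (ltry _).
have HL : cL2 leb2 (fun x => c%:C * T x) by exact: cL2Z.
have hL := cL2_fourier_opp HL.
(* The inverse transform of [c * T], written as a reflected transform. *)
exists (fun x => fourier (fun x => c%:C * T x) (- x)); split.
  split; first exact: hL.
  move=> phi tphi; have pL := cL2_test_function tphi.
  rewrite (commutator_distrE mm fL gL GL pL (cL2_symbol_test_function j hmu tphi)
    mk mw k0 w0 hm a0 b0 ka wb).
  exact: (cint_fourier_opp HL pL).
rewrite L2E.
have [mFH _] := fourier_cL2 HL.
rewrite (L2n_invariant measurable_plane_opp leb2_opp mFH) (fourier_isometry HL).
rewrite L2nZ// normcR (ger0_norm c_ge) NE SE -!EFinM.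
apply: (@le_trans _ _ (c%:E * (a * b)%:E)%E).
  by apply: lee_wpmul2l; rewrite ?lee_fin.
rewrite -EFinM lee_fin le_eqVlt; apply/orP; left; apply/eqP.
by rewrite /a /b; ring.
Qed.
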